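(* Let $R$ be a Noetherian commutative ring of Krull dimension $\le4$, let $P_0$ be a finitely generated projective $R$-module of constant rank $2$ with a trivialization $\theta_0:R\xrightarrow{\cong}\det(P_0)$ of its determinant, let $P_4=P_0\oplus Re_3\oplus Re_4$ and $P_5=P_4\oplus Re_5$, and assume that $SL(P_5)$ acts transitively on $Um(P_5)$. Let $\{\chi_i\}_{i\in I}$ be a set of non-degenerate alternating forms on $P_4$ such that $I\to\tilde V_{SL}(R)$, $i\mapsto[P_4,\chi_0\perp\psi_2,\chi_i]$, is a (well-defined) bijection. Then there is a bijection $$Um(P_0\oplus R)/E(P_0\oplus R)\cong\bigsqcup_{i\in I}Sp(\chi_i)E(P_4)\backslash SL(P_4).$$
   Context: For a finitely generated projective $R$-module $P$: $P^{\vee}=\mathrm{Hom}_R(P,R)$; $Um(P)$ is the set of epimorphisms $P\to R$; $SL(P)$ is the group of automorphisms of determinant $1$; these act on the right on $Um(P)$ by precomposition. For a direct sum $P=\bigoplus_iP_i$, $E(P)$ is the subgroup of $\mathrm{Aut}(P)$ generated by $\mathrm{id}_P+s$ with $s:P_j\to P_i$ linear, $i\ne j$; for $P_0\oplus R$ and $P_4$ the decompositions are $P_0\oplus R$ and $P_0\oplus Re_3\oplus Re_4$. $E(P_4)$ is normal in $SL(P_4)$. For a non-degenerate alternating form $\chi$ on $P_4$, $Sp(\chi)=\{\varphi\in\mathrm{Aut}(P_4):\varphi^t\chi\varphi=\chi\}\subset SL(P_4)$. $Sp(\chi)E(P_4)\backslash SL(P_4)$ is the set of right cosets of the subgroup $Sp(\chi)E(P_4)$.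 $\chi_0(p,q)=\theta_0^{-1}(p\wedge q)$ on $P_0$. An alternating isomorphism on $P$ is an isomorphism $f:P\to P^{\vee}$ with $f(p)(p)=0$ for all $p$ (the same as a non-degenerate alternating form). Triples $(P,f_0,f_1)$, $(P',f_0',f_1')$ with alternating isomorphisms are isometric if there is an isomorphism $h:P\to P'$ with $f_i=h^{\vee}f_i'h$, $i=0,1$; $[P,f_0,f_1]$ is the isometry class. $V_{SL}(R)$ is the quotient of the free abelian group on isometry classes of triples by (1) $[P\oplus P',g\perp g',f\perp f']=[P,g,f]+[P',g',f']$, (2) $[P,f_0,f_1]+[P,f_1,f_2]=[P,f_0,f_2]$, (3) $[P,g,f]=[P,g,\varphi^{\vee}f\varphi]$ for $\varphi\in SL(P)$. Let $A_{2n}(R)$ be the set of invertible alternating $2n\times2n$ matrices, $\psi_2=\begin{pmatrix}0&1\\-1&0\end{pmatrix}$, $\psi_{2n+2}=\psi_{2n}\perp\psi_2$, $A(R)=\mathrm{colim}_nA_{2n}(R)$ along $M\mapsto M\perp\psi_2$. Write $M\sim_{SL}N$ ($M\in A_{2m}(R)$, $N\in A_{2n}(R)$) if $M\perp\psi_{2n+2s}=E^t(N\perp\psi_{2m+2s})E$ for some $s\in\mathbb N$, $E\in SL_{2m+2n+2s}(R)$. $W'_{SL}(R)=A(R)/{\sim_{SL}}$ is a group under $\perp$ and $W_{SL}(R)$ is the kernel of the Pfaffian $W'_{SL}(R)\to R^{\times}$. $M\mapsto[R^{2m},\psi_{2m},M]$ induces $W'_{SL}(R)\cong V_{SL}(R)$;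 $\tilde V_{SL}(R)$ is the subgroup corresponding to $W_{SL}(R)$. *)

(* Defs.v *)
From HB Require Import structures.
From mathcomp Require Import all_boot all_algebra ring.
From mathcomp Require Import boolp classical_sets.

Set Implicit Arguments.
Unset Strict Implicit.
Unset Printing Implicit Defensive.

Import GRing.Theory.
Local Open Scope ring_scope.

(* Rings are [comPzRingType], so that the zero ring is not excluded.  The     *)
(* library's [idealr] hierarchy is restricted to decidable ideals of          *)
(* nontrivial rings, whence the [set]-based ideals below.                     *)

(* The set of classes of [e]; used only for equivalence relations. *)
Definition quot (T : Type) (e : T -> T -> Prop) : Type :=
  {C : T -> Prop | exists x, C = e x}.

Definition class_of (T : Type) (e : T -> T -> Prop) (x : T) : quot e :=
  exist _ (e x) (ex_intro _ x erefl).

(** * Ideals, Noetherian rings, Krull dimension *)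

Section Ideals.
Variable R : comPzRingType.

Definition ideal (I : set R) : Prop :=
  [/\ I 0, forall x y, I x -> I y -> I (x + y) & forall a x, I x -> I (a * x)].

Definition prime_ideal (I : set R) : Prop :=
  [/\ ideal I, ~ I 1 & forall x y, I (x * y) -> I x \/ I y].

Definition noetherian : Prop :=
  forall I : set R, ideal I ->
  exists (n : nat) (g : 'I_n -> R),
    forall x, I x <-> exists c : 'I_n -> R, x = \sum_i c i * g i.

Definition krull_dim_le (d : nat) : Prop :=
  forall p : 'I_d.+2 -> set R, (forall i, prime_ideal (p i)) ->
  ~ (forall i j : 'I_d.+2, (i < j)%N -> (p i `<` p j)%classic).

Lemma ideal_sub_prime (J : set R) :
  ideal J -> ~ J 1 -> exists p, prime_ideal p /\ (J `<=` p)%classic.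
Proof.
move=> [J0 JD JM] J1.
pose good (A : set R) := ideal (A `|` J)%classic /\ ~ (A `|` J)%classic 1.
have [|A [[iA A1] maxA]] := @Zorn_bigcup R good.
  move=> F Fg Ftot; split; last first.
    case=> [[A FA A1]|//]; have [_ nA] := Fg _ FA.
    by apply: nA; left.
  split; first by right.
  - move=> x y [[A FA Ax]|Jx] [[B FB By]|Jy].
    + case: (Ftot _ _ FA FB) => AB.
      * have [[_ D _] _] := Fg _ FB.
        have [||h|h] := D x y; [by left; exact: AB|by left| |].
          by left; exists B. by right.
      * have [[_ D _] _] := Fg _ FA.
        have [||h|h] := D x y; [by left|by left; apply: AB| |].
          by left; exists A. by right.
    + have [[_ D _] _] := Fg _ FA.
      have [||h|h] := D x y; [by left|by right| |].
        by left; exists A. by right.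
    + have [[_ D _] _] := Fg _ FB.
      have [||h|h] := D x y; [by right|by left| |].
        by left; exists B. by right.
    + by right; apply: JD.
  - move=> a x [[A FA Ax]|Jx]; last by right; apply: JM.
    have [[_ _ M] _] := Fg _ FA.
    have [|h|h] := M a x; [by left| |]; first by left; exists A.
    by right.
pose I := (A `|` J)%classic; rewrite -/I in iA A1.
have [I0 ID IM] := iA.
exists I; split; last by move=> x; right.
suff adj a : ~ I a -> exists m r, I m /\ 1 = m + r * a.
  split=> // x y Ixy; have [Ix|nIx] := pselect (I x); first by left.
  right; have [Iy|/adj[n [s [In e2]]]] := pselect (I y) => //.
  have [m [r [Im e1]]] := adj _ nIx.
  suff : I 1 by [].
  have -> : 1 = n * m + (s * y) * m + (r * x) * n + (r * s) * (x * y).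
    by rewrite -[LHS]mulr1 [X in X * _]e1 [X in _ * X]e2; ring.
  exact: ID (ID _ _ (ID _ _ (IM _ _ Im) (IM _ _ Im)) (IM _ _ In)) (IM _ _ Ixy).
move=> nIa; apply: contrapT => no.
pose B := [set x | exists m r, I m /\ x = m + r * a]%classic.
have IB x : I x -> B x by move=> Ix; exists x, 0; rewrite mul0r addr0.
have BJ : (B `|` J)%classic = B.
  apply/seteqP; split=> x; last by left.
  by case=> // Jx; apply: IB; right.
apply: (maxA B).
  split; first by move=> x Ax; apply: IB; left.
  move=> BA; apply: nIa; left; apply: BA; exists 0, 1.
  by rewrite add0r mul1r.
split; rewrite BJ; last by move=> [m [r h]]; apply: no; exists m, r.
split; first exact: IB.
- move=> x y [m [r [Im ->]]] [n [s [In ->]]]; exists (m + n), (r + s).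
  by split; [exact: ID|ring].
- move=> b x [m [r [Im ->]]]; exists (b * m), (b * r).
  by split; [exact: IM|ring].
Qed.

End Ideals.

(** * Modules *)

Section Modules.
Variable R : comPzRingType.

Definition mk_linear (U V : lmodType R) (f : U -> V) (hf : linear f) :
    {linear U -> V} :=
  HB.pack f (GRing.isLinear.Build R U V *:%R f hf).

Structure lin_iso (U V : lmodType R) := LinIso {
  iso_fun :> {linear U -> V};
  iso_inv : V -> U;
  isoK : cancel iso_fun iso_inv;
  isoVK : cancel iso_inv iso_fun
}.

Definition finitely_generated (P : lmodType R) : Prop :=
  exists (n : nat) (g : 'I_n -> P),
    forall p, exists c : 'I_n -> R, p = \sum_i c i *: g i.

Definition projective (P : lmodType R) : Prop :=
  forall (M N : lmodType R) (g : {linear M -> N}) (f : {linear P -> N}),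
    (forall y, exists x, g x = y) ->
    exists h : {linear P -> M}, forall p, g (h p) = f p.

Definition fg_projective (P : lmodType R) : Prop :=
  finitely_generated P /\ projective P.

(* The images of the [b i] form a basis of the localization of [P] at the     *)
(* prime [p], with denominators cleared.  Any basis of a localization can be  *)
(* rescaled to one of this form.                                              *)
Definition basis_at (p : set R) (P : lmodType R) (r : nat) (b : 'I_r -> P) :
    Prop :=
  (forall x, exists (s : R) (c : 'I_r -> R),
      ~ p s /\ s *: x = \sum_i c i *: b i) /\
  (forall c : 'I_r -> R,
      (exists s, ~ p s /\ s *: (\sum_i c i *: b i) = 0) ->
      forall i, exists t, ~ p t /\ t * c i = 0).

Definition constant_rank (P : lmodType R) (r : nat) : Prop :=
  forall p : set R, prime_ideal p -> exists b : 'I_r -> P, basis_at p b.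

Definition alternating_map (P M : lmodType R) (b : P -> P -> M) : Prop :=
  [/\ forall q, linear (b^~ q), forall p, linear (b p) & forall p, b p p = 0].

(* The exterior square of [P], given by its universal property; for [P] of    *)
(* constant rank 2 it is the determinant of [P].                              *)
Structure exterior_square (P : lmodType R) := ExteriorSquare {
  ext_mod :> lmodType R;
  wedge : P -> P -> ext_mod;
  wedge_alt : alternating_map wedge;
  wedge_univ : forall (M : lmodType R) (b : P -> P -> M), alternating_map b ->
    exists g : {linear ext_mod -> M},
      (forall p q, g (wedge p q) = b p q) /\
      (forall g' : {linear ext_mod -> M},
         (forall p q, g' (wedge p q) = b p q) -> g =1 g')
}.

(** Non-degenerate alternating forms, i.e. alternating isomorphisms
    [P -> P^v]: [form_nondeg] says that [p |-> form p] is a bijection from [P]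
    to [Hom_R(P, R)]. *)
Structure alt_form (P : lmodType R) := AltForm {
  form :> P -> P -> R^o;
  form_alt : alternating_map form;
  form_nondeg : forall g : {linear P -> R^o}, exists! p, form p =1 g
}.

(** * Automorphisms *)

Definition is_aut (P : lmodType R) (f : P -> P) : Prop :=
  linear f /\ bijective f.

(* Determinant of an endomorphism of a finitely generated projective module   *)
(* [P]: the determinant of [f (+) id_Q] on [P (+) Q], for any [Q] such that   *)
(* [P (+) Q] is free of finite rank.  The value depends on [f] only.  No      *)
(* constancy of the rank of [P] is needed.                                    *)
Definition has_det (P : lmodType R) (f : P -> P) (d : R) : Prop :=
  exists (Q : lmodType R) (n : nat) (h : lin_iso (P * Q)%type 'rV[R]_n)
    (A : 'M[R]_n),
    (forall p q, h (f p, q) = h (p, q) *m A) /\ \det A = d.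

Definition SL (P : lmodType R) (f : P -> P) : Prop := is_aut f /\ has_det f 1.

Definition Sp (P : lmodType R) (chi : alt_form P) (f : P -> P) : Prop :=
  is_aut f /\ forall p q, chi (f p) (f q) = chi p q.

Structure summand (P : lmodType R) := Summand {
  summand_mod :> lmodType R;
  s_in : {linear summand_mod -> P};
  s_out : {linear P -> summand_mod}
}.

Structure decomposition (P : lmodType R) := Decomposition {
  d_index : finType;
  d_summand :> d_index -> summand P;
  d_inK : forall i, cancel (s_in (d_summand i)) (s_out (d_summand i));
  d_out0 : forall i j x, i != j -> s_out (d_summand j) (s_in (d_summand i) x) = 0;
  d_sum : forall p, \sum_i s_in (d_summand i) (s_out (d_summand i) p) = p
}.

(* The subgroup of [Aut(P)] generated by a set of automorphisms. *)
Inductive generated (P : Type) (S : (P -> P) -> Prop) : (P -> P) -> Prop :=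
| gen_base f of S f : generated S f
| gen_id : generated S id
| gen_comp f g of generated S f & generated S g : generated S (f \o g)
| gen_inv f g of generated S f & cancel f g & cancel g f : generated S g.

Definition E (P : lmodType R) (d : decomposition P) : (P -> P) -> Prop :=
  generated (fun f => exists (i j : d_index d) (s : {linear d j -> d i}),
    i != j /\ f = fun p => p + s_in (d i) (s (s_out (d j) p))).

(** * Unimodular elements, orbits and cosets *)

Definition Um (P : lmodType R) : Type :=
  {a : P -> R^o | linear a /\ forall y, exists p, a p = y}.

(* [b] lies in the orbit of [a] under the right action of [G] *)
Definition Um_rel (P : lmodType R) (G : (P -> P) -> Prop) (a b : Um P) : Prop :=
  exists f, G f /\ forall p, sval b p = sval a (f p).

Definition SL_group (P : lmodType R) : Type := {f : P -> P | SL f}.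

(* [g] lies in the right coset [Sp(chi) E(P) f] *)
Definition SpE_rel (P : lmodType R) (d : decomposition P) (chi : alt_form P)
    (f g : SL_group P) : Prop :=
  exists s e, [/\ Sp chi s, E d e & forall p, sval g p = s (e (sval f p))].

(** * Basic finitely generated projective modules *)

Definition inl0 (U V : lmodType R) (u : U) : U * V := (u, 0).
Definition inr0 (U V : lmodType R) (v : V) : U * V := (0, v).

Fact inl0_linear (U V : lmodType R) : linear (@inl0 U V).
Proof. by move=> a u v; congr pair; rewrite /= scaler0 addr0. Qed.
HB.instance Definition _ (U V : lmodType R) :=
  GRing.isLinear.Build R U (U * V)%type *:%R (@inl0 U V) (@inl0_linear U V).

Fact inr0_linear (U V : lmodType R) : linear (@inr0 U V).
Proof. by move=> a u v; congr pair; rewrite /= scaler0 addr0. Qed.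
HB.instance Definition _ (U V : lmodType R) :=
  GRing.isLinear.Build R V (U * V)%type *:%R (@inr0 U V) (@inr0_linear U V).

Lemma pairE (U V : lmodType R) (x : U * V) : x = inl0 V x.1 + inr0 U x.2.
Proof. by case: x => a b; congr pair; rewrite /= ?addr0 ?add0r. Qed.

Lemma fg_projective_prod (P Q : lmodType R) :
  fg_projective P -> fg_projective Q -> fg_projective (P * Q)%type.
Proof.
move=> [[n [g gP]] pP] [[m [h hP]] pQ]; split.
  exists (n + m)%N, (fun i => match split i with
    | inl i => inl0 Q (g i) | inr j => inr0 P (h j) end) => -[p q].
  have [c ->] := gP p; have [d ->] := hP q.
  exists (fun i => match split i with inl i => c i | inr j => d j end).
  rewrite big_split_ord /= [LHS]pairE /= !linear_sum /=.
  congr (_ + _); apply: eq_bigr => i _.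
    by rewrite (unsplitK (inl i)) linearZ.
  by rewrite (unsplitK (inr i)) linearZ.
move=> M N k f ksurj.
have [h1 h1P] := pP M N k (f \o @inl0 P Q) ksurj.
have [h2 h2P] := pQ M N k (f \o @inr0 P Q) ksurj.
have lin : linear (fun x : P * Q => h1 x.1 + h2 x.2).
  by move=> a x y; rewrite /= !linearP scalerDr addrACA.
exists (mk_linear lin) => x.
by rewrite /= raddfD /= h1P h2P /= -raddfD -pairE.
Qed.

Lemma fg_projective_rV (n : nat) : fg_projective 'rV[R]_n.
Proof.
split.
  exists n, (fun i => delta_mx 0 i) => p; exists (fun i => p 0 i).
  exact: row_sum_delta.
move=> M N g f gsurj.
have [x xP] := fin_all_exists (fun i => gsurj (f (delta_mx 0 i))).
have lin : linear (fun p : 'rV[R]_n => \sum_i p 0 i *: x i).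
  move=> a p q; rewrite scaler_sumr -big_split; apply: eq_bigr => i _ /=.
  by rewrite !mxE scalerDl scalerA.
exists (mk_linear lin) => p.
rewrite [in RHS](row_sum_delta p) /= !linear_sum; apply: eq_bigr => i _.
by rewrite !linearZ /= xP.
Qed.

Lemma fg_projective_regular : fg_projective R^o.
Proof.
split.
  exists 1%N, (fun _ => 1) => p; exists (fun _ => p).
  by rewrite big_ord1 /GRing.scale /= mulr1.
move=> M N g f gsurj; have [x xP] := gsurj (f 1).
have lin : linear (fun a : R^o => (a : R) *: x).
  by move=> a p q; rewrite scalerDl scalerA.
exists (mk_linear lin) => p /=; rewrite linearZ /= xP -linearZ.
by rewrite /GRing.scale /= mulr1.
Qed.

(** * Constructions of alternating forms *)

Lemma alternatingN (P M : lmodType R) (b : P -> P -> M) :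
  alternating_map b -> forall p q, b p q = - b q p.
Proof.
move=> [bl br b0] p q; apply/eqP; rewrite -addr_eq0; apply/eqP.
have Dl x y z : b (x + y) z = b x z + b y z.
  by have := bl z 1 x y; rewrite !scale1r.
have Dr x y z : b z (x + y) = b z x + b z y.
  by have := br z 1 x y; rewrite !scale1r.
by have := b0 (p + q); rewrite Dl !Dr !b0 add0r addr0.
Qed.

Section Perp.
Variables (P Q : lmodType R) (f : alt_form P) (g : alt_form Q).

Let h (x y : P * Q) : R^o := f x.1 y.1 + g x.2 y.2.

Lemma alt_perp_alt : alternating_map h.
Proof.
have [fl fr f0] := form_alt f; have [gl gr g0] := form_alt g.
split=> [q a x y|p a x y|p]; rewrite /h /=.
- by rewrite fl gl scalerDr addrACA.
- by rewrite fr gr scalerDr addrACA.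
- by rewrite f0 g0 addr0.
Qed.

Lemma alt_perp_nondeg (k : {linear (P * Q)%type -> R^o}) :
  exists! x, h x =1 k.
Proof.
have fz x : f x 0 = 0 by have [_ fr _] := form_alt f; apply: (linear0 (mk_linear (fr x))).
have gz x : g x 0 = 0 by have [_ gr _] := form_alt g; apply: (linear0 (mk_linear (gr x))).
have [p [pP pU]] := form_nondeg f (k \o @inl0 P Q).
have [q [qP qU]] := form_nondeg g (k \o @inr0 P Q).
exists (p, q); split=> [x|[p' q'] e].
  by rewrite /h /= pP qP /= -raddfD -pairE.
congr pair; [apply: pU => x | apply: qU => x].
  by rewrite /= -e /h /= gz addr0.
by rewrite /= -e /h /= fz add0r.
Qed.

Definition alt_perp : alt_form (P * Q)%type :=
  AltForm alt_perp_alt alt_perp_nondeg.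
End Perp.

Section Hyperbolic.
Let h (x y : R^o * R^o) : R^o := (x.1 : R) * y.2 - (x.2 : R) * y.1.

Lemma alt_hyp_alt : alternating_map h.
Proof.
by split=> [q a x y|p a x y|p]; rewrite /h /GRing.scale /= /GRing.scale /=; ring.
Qed.

Lemma alt_hyp_nondeg (k : {linear (R^o * R^o)%type -> R^o}) :
  exists! x, h x =1 k.
Proof.
have kE x : k x = x.1 * k (1, 0) + x.2 * k (0, 1).
  have {1}-> : x = x.1 *: ((1, 0) : R^o * R^o) + x.2 *: ((0, 1) : R^o * R^o).
    case: x => a b; congr pair; rewrite /= /GRing.scale /=; ring.
  by rewrite linearD !linearZ.
exists (k (0, 1), - k (1, 0)); split=> [x|[a b] e].
  rewrite [in RHS]kE /h /= mulNr opprK [LHS](@addrC R).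
  by rewrite ![_ * _.1](@mulrC R) ![_ * _.2](@mulrC R).
by rewrite -!e /h /=; congr pair; ring.
Qed.

(* [psi_2] on [R e_3 (+) R e_4] *)
Definition alt_hyp : alt_form (R^o * R^o)%type :=
  AltForm alt_hyp_alt alt_hyp_nondeg.
End Hyperbolic.

Section MatrixForm.
Variable n : nat.

Definition alt_inv_mx (M : 'M[R]_n) : Prop :=
  [/\ M^T = - M, forall i, M i i = 0 &
      exists N : 'M[R]_n, M *m N = 1%:M /\ N *m M = 1%:M].

Let h (M : 'M[R]_n) (u v : 'rV[R]_n) : R^o := (u *m M *m v^T) 0 0.

Lemma alt_mx_alt (M : 'M[R]_n) : alt_inv_mx M -> alternating_map (h M).
Proof.
move=> [MT M0 _]; split=> [q a x y|p a x y|p]; rewrite /h.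
- by rewrite !mulmxDl -!scalemxAl !mxE.
- by rewrite linearP /= mulmxDr -scalemxAr !mxE.
rewrite -mulmxA mxE.
under eq_bigr => i _ do rewrite mxE big_distrr /=.
pose F i j := p 0 i * (M i j * p^T j 0).
have FN i j : F i j = - F j i.
  rewrite /F !mxE; have /matrixP/(_ j i) := MT; rewrite !mxE => ->; ring.
have F0 i : F i i = 0 by rewrite /F M0 mul0r mulr0.
rewrite -/F.
have split3 : \sum_i \sum_j F i j =
    \sum_(i < n) \sum_(j < n | (j < i)%N) F i j +
    \sum_(i < n) \sum_(j < n | (i < j)%N) F i j.
  rewrite -big_split; apply: eq_bigr => i _ /=.
  rewrite (bigD1 i) //= F0 add0r (bigID (fun j : 'I_n => (j < i)%N)) /=.
  congr (_ + _); apply: eq_bigl => j; rewrite -val_eqE /=; case: ltngtP => //.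
rewrite [LHS]split3 [X in _ + X](exchange_big_dep predT) //= -big_split /=.
apply: big1 => i _; rewrite -big_split /=; apply: big1 => j _.
by rewrite FN addNr.
Qed.

Lemma alt_mx_nondeg (M : 'M[R]_n) : alt_inv_mx M ->
  forall k : {linear 'rV[R]_n -> R^o}, exists! x, h M x =1 k.
Proof.
move=> [_ _ [N [MN NM]]] k.
pose a : 'rV[R]_n := \row_i (k (delta_mx 0 i) : R).
have kE v : k v = (a *m v^T) 0 0.
  rewrite [in LHS](row_sum_delta v) linear_sum mxE; apply: eq_bigr => i _.
  by rewrite linearZ /= !mxE mulrC.
exists (a *m N); split=> [v|x e].
  by rewrite /h -(mulmxA a) NM mulmx1 kE.
suff -> : a = x *m M by rewrite -mulmxA MN mulmx1.
apply/rowP => i; rewrite mxE -e /h trmx_delta -colE.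
by rewrite mxE.
Qed.

Definition alt_mx (M : 'M[R]_n) (hM : alt_inv_mx M) : alt_form 'rV[R]_n :=
  AltForm (alt_mx_alt hM) (alt_mx_nondeg hM).
End MatrixForm.

Definition psi2 : 'M[R]_2 := block_mx 0 1%:M (- 1%:M) 0 : 'M_(1 + 1).

(* Since all diagonal blocks agree, [psi_2 _|_ psi_2m = psi_2m _|_ psi_2]. *)
Fixpoint psi (m : nat) : 'M[R]_m.*2 :=
  if m is m'.+1 then block_mx psi2 0 0 (psi m') : 'M_(2 + m'.*2) else 0.

Lemma alt_inv_block a b (A : 'M[R]_a) (B : 'M[R]_b) :
  alt_inv_mx A -> alt_inv_mx B -> alt_inv_mx (block_mx A 0 0 B).
Proof.
move=> [AT A0 [A' [AA' A'A]]] [BT B0 [B' [BB' B'B]]]; split.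
- by rewrite tr_block_mx opp_block_mx AT BT !trmx0 !oppr0.
- move=> i; rewrite -[i]splitK; case: (split i) => j /=.
    by rewrite block_mxEul.
  by rewrite block_mxEdr.
exists (block_mx A' 0 0 B').
by rewrite !mulmx_block !mul0mx !mulmx0 !addr0 !add0r AA' A'A BB' B'B
  scalar_mx_block.
Qed.

Lemma alt_inv_hyp a :
  alt_inv_mx (block_mx 0 1%:M (- 1%:M) 0 : 'M[R]_(a + a)).
Proof.
split.
- by rewrite tr_block_mx opp_block_mx linearN !trmx0 !oppr0 /= !trmx1 opprK.
- move=> i; rewrite -[i]splitK; case: (split i) => j /=.
    by rewrite block_mxEul mxE.
  by rewrite block_mxEdr mxE.
exists (block_mx 0 (- 1%:M) 1%:M 0).
by rewrite !mulmx_block !mul0mx !mulmx0 !addr0 !add0r mulmxN mulNmx opprK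
  !mulmx1 -scalar_mx_block.
Qed.

Lemma psi2_alt : alt_inv_mx psi2.
Proof. exact: alt_inv_hyp 1%N. Qed.

Lemma psi_alt m : alt_inv_mx (psi m).
Proof.
elim: m => [|m IH]; last exact: alt_inv_block psi2_alt IH.
split=> [|[]//|]; first by apply/matrixP => -[].
by exists 0; split; apply/matrixP => -[].
Qed.

(* Pfaffian, by expansion along the first row *)
Fixpoint pfaffian (m : nat) : 'M[R]_m.*2 -> R :=
  if m is m'.+1 then fun M : 'M[R]_m'.*2.+2 =>
    \sum_(j < m'.*2.+1) (-1) ^+ j * M ord0 (lift ord0 j) *
      pfaffian (row' j (col' j (row' ord0 (col' ord0 M))))
  else fun => 1.

(** * The form [chi_0 (p, q) = theta_0^-1 (p /\ q)] *)

Section Chi0.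
Variables (P : lmodType R) (rk2 : constant_rank P 2).
Variables (L : exterior_square P) (theta : lin_iso R^o L).

Let c (p q : P) : R^o := iso_inv theta (wedge L p q).

Lemma iso_inv_linear (U V : lmodType R) (h : lin_iso U V) :
  linear (iso_inv h).
Proof.
by move=> a x y; apply: (can_inj (isoK h)); rewrite linearP !isoVK.
Qed.

Lemma chi0_alt : alternating_map c.
Proof.
have [wl wr w0] := wedge_alt L; have tl := @iso_inv_linear _ _ theta.
split=> [q a x y|p a x y|p]; rewrite /c ?wl ?wr -?tl //.
by rewrite w0; exact: (linear0 (mk_linear tl)).
Qed.

(* an alternating trilinear map on a module of rank 2 vanishes *)
Lemma chi0_jacobi p q r : c p q *: r + c q r *: p + c r p *: q = 0.
Proof.
have [cl cr c0] := chi0_alt.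
have cN := alternatingN chi0_alt.
have Dl x y z : c (x + y) z = c x z + c y z.
  by have := cl z 1 x y; rewrite !scale1r.
have Dr x y z : c z (x + y) = c z x + c z y.
  by have := cr z 1 x y; rewrite !scale1r.
have z0l z : c 0 z = 0 by apply: (linear0 (mk_linear (cl z))).
have z0r z : c z 0 = 0 by apply: (linear0 (mk_linear (cr z))).
have Zl a x z : c (a *: x) z = a * c x z.
  by have := cl z a x 0; rewrite z0l !addr0.
have Zr a x z : c z (a *: x) = a * c z x.
  by have := cr z a x 0; rewrite z0r !addr0.
set x := _ + _ + _.
pose J : set R := fun s => s *: x = 0.
suff : J 1 by rewrite /J scale1r.
apply: contrapT => J1.
have iJ : ideal J.
  split; rewrite /J ?scale0r //.
  - by move=> s t es et; rewrite scalerDl es et addr0.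
  - by move=> a s es; rewrite -scalerA es scaler0.
have [m [[im m1 mP] Jm]] := ideal_sub_prime iJ J1.
have [b [span _]] := rk2 (And3 im m1 mP).
have [s1 [c1 [ns1 e1]]] := span p.
have [s2 [c2 [ns2 e2]]] := span q.
have [s3 [c3 [ns3 e3]]] := span r.
have : m (s1 * s2 * s3).
  apply: Jm; rewrite /J.
  have -> : (s1 * s2 * s3) *: x = c (s1 *: p) (s2 *: q) *: (s3 *: r)
     + c (s2 *: q) (s3 *: r) *: (s1 *: p) + c (s3 *: r) (s1 *: p) *: (s2 *: q).
    rewrite /x !Zl !Zr !scalerDr !scalerA.
    by congr (_ *: _ + _ *: _ + _ *: _); ring.
  rewrite e1 e2 e3 !big_ord_recl !big_ord0 !addr0.
  set u := b ord0; set v := b _.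
  rewrite !Dl !Dr !Zl !Zr !c0 (cN v u).
  rewrite !scalerDr !scalerA.
  rewrite [X in X + _]addrACA [LHS]addrACA -!scalerDl.
  set A := (X in X *: u); set B := (X in X *: v).
  have -> : A = 0 by rewrite /A; ring.
  have -> : B = 0 by rewrite /B; ring.
  by rewrite !scale0r addr0.
by case/mP => [/mP[]|].
Qed.

Lemma chi0_cancel (M : lmodType R) (u v : M) :
  (forall p q, c p q *: u = c p q *: v) -> u = v.
Proof.
move=> e; have tl := @iso_inv_linear _ _ theta.
have lin (z : M) : linear (fun y : L => (iso_inv theta y : R) *: z).
  by move=> a x y; rewrite tl scalerDl scalerA.
have alt : alternating_map (fun p q => (c p q : R) *: u).
  have [cl cr c0] := chi0_alt.
  split=> [q a x y|p a x y|p]; rewrite ?cl ?cr ?c0 ?scale0r //.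
    by rewrite scalerDl scalerA.
  by rewrite scalerDl scalerA.
have [g [_ gU]] := wedge_univ L alt.
have g1 := gU (mk_linear (lin u)) (fun p q => erefl).
have g2 := gU (mk_linear (lin v)) (fun p q => esym (e p q)).
by have := g1 (theta 1); rewrite g2 /= isoK !scale1r.
Qed.

Lemma chi0_nondeg (k : {linear P -> R^o}) : exists! p, c p =1 k.
Proof.
have [cl cr c0] := chi0_alt; have cN := alternatingN chi0_alt.
have Zl a x z : c (a *: x) z = a * c x z.
  exact: (linearZ_LR (mk_linear (cl z))).
have Bl x y z : c (x - y) z = c x z - c y z.
  exact: (raddfB (mk_linear (cl z))).
have alt : alternating_map (fun p q : P => (k q : R) *: p - (k p : R) *: q).
  split=> [q a x y|p a x y|p]; last by rewrite subrr.
    rewrite linearP scalerDr scalerDl scalerBr opprD addrACA !scalerA mulrC.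
    by [].
  rewrite linearP scalerDr scalerDl scalerBr opprD addrACA !scalerA [k p * a]mulrC.
  by [].
have [g [gE _]] := wedge_univ L alt.
have gc p q : c p q *: g (theta 1) = k q *: p - k p *: q.
  rewrite -gE -linearZ /= -linearZ; congr (g _).
  by rewrite /GRing.scale /= mulr1 isoVK.
exists (g (theta 1)); split=> [r|v vP].
  apply: (@chi0_cancel R^o) => p q; rewrite /GRing.scale /= -Zl gc Bl !Zl.
  have := congr1 k (chi0_jacobi p q r).
  rewrite !linearD !linearZ linear0 /= (cN r p) /GRing.scale /= => e.
  by apply/eqP; rewrite -subr_eq0; apply/eqP; rewrite -[RHS]oppr0 -e; ring.
apply: chi0_cancel => p q; rewrite gc -!vP.
have := chi0_jacobi p q v; rewrite (cN q v) scaleNr => e.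
by apply: subr0_eq; rewrite -[RHS]oppr0 -e opprD opprB addrAC.
Qed.

Definition chi0 : alt_form P := AltForm chi0_alt chi0_nondeg.
End Chi0.

(** * The group [V_SL(R)] *)

Structure triple := Triple {
  t_mod : lmodType R;
  t_fgp : fg_projective t_mod;
  t_form0 : alt_form t_mod;
  t_form1 : alt_form t_mod
}.

Definition isometric (t t' : triple) : Prop :=
  exists h : lin_iso (t_mod t) (t_mod t'),
    (forall p q, t_form0 t p q = t_form0 t' (h p) (h q)) /\
    (forall p q, t_form1 t p q = t_form1 t' (h p) (h q)).

(* Words in the generators of [V_SL(R)] and the congruence presenting it: the *)
(* axioms of abelian groups, invariance under isometry and the relations      *)
(* (1)-(3).                                                                   *)
Inductive V_word :=
| V_gen of triple
| V_zero
| V_add of V_word & V_word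
| V_opp of V_word.

Inductive V_rel : V_word -> V_word -> Prop :=
| V_refl x : V_rel x x
| V_sym x y of V_rel x y : V_rel y x
| V_trans x y z of V_rel x y & V_rel y z : V_rel x z
| V_addc x x' y y' of V_rel x x' & V_rel y y' : V_rel (V_add x y) (V_add x' y')
| V_oppc x x' of V_rel x x' : V_rel (V_opp x) (V_opp x')
| V_addA x y z : V_rel (V_add x (V_add y z)) (V_add (V_add x y) z)
| V_addC x y : V_rel (V_add x y) (V_add y x)
| V_add0 x : V_rel (V_add V_zero x) x
| V_addN x : V_rel (V_add (V_opp x) x) V_zero
| V_isom t t' of isometric t t' : V_rel (V_gen t) (V_gen t')
| V_perp (P P' : lmodType R) (hP : fg_projective P) (hP' : fg_projective P')
    (g f : alt_form P) (g' f' : alt_form P') :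
    V_rel (V_gen (Triple (fg_projective_prod hP hP')
                    (alt_perp g g') (alt_perp f f')))
          (V_add (V_gen (Triple hP g f)) (V_gen (Triple hP' g' f')))
| V_chain (P : lmodType R) (hP : fg_projective P) (f0 f1 f2 : alt_form P) :
    V_rel (V_add (V_gen (Triple hP f0 f1)) (V_gen (Triple hP f1 f2)))
          (V_gen (Triple hP f0 f2))
| V_SLinv (P : lmodType R) (hP : fg_projective P) (g f f' : alt_form P)
    (phi : P -> P) of SL phi & (forall p q, f' p q = f (phi p) (phi q)) :
    V_rel (V_gen (Triple hP g f)) (V_gen (Triple hP g f')).

Definition V_SL : Type := quot V_rel.

Definition V_class (P : lmodType R) (hP : fg_projective P)
    (f0 f1 : alt_form P) : V_SL := class_of V_rel (V_gen (Triple hP f0 f1)).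

(* The image of [W_SL(R)], i.e. of the classes of matrices with Pfaffian 1,   *)
(* under [M |-> [R^2m, psi_2m, M]].                                           *)
Definition tilde_V_SL : Type :=
  {x : V_SL | exists (m : nat) (M : 'M[R]_m.*2) (hM : alt_inv_mx M),
     pfaffian M = 1 /\
     x = V_class (fg_projective_rV m.*2) (alt_mx (psi_alt m)) (alt_mx hM)}.

(** * The modules attached to [P_0] *)

Section PModules.
Variable P0 : lmodType R.

Definition P3 : lmodType R := (P0 * R^o)%type.
Definition P4 : lmodType R := (P0 * (R^o * R^o))%type.
Definition P5 : lmodType R := (P4 * R^o)%type.

Lemma fg_projective_P4 : fg_projective P0 -> fg_projective P4.
Proof.
move=> h; apply: fg_projective_prod h _.
exact: fg_projective_prod fg_projective_regular fg_projective_regular.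
Qed.

Definition P3_summand (i : bool) : summand P3 :=
  if i then Summand (@inr0 P0 R^o) snd else Summand (@inl0 P0 R^o) fst.

Definition P4_summand (i : option bool) : summand P4 :=
  match i with
  | None => Summand (@inl0 P0 (R^o * R^o)%type) fst
  | Some false =>
      Summand (@inr0 P0 (R^o * R^o)%type \o @inl0 R^o R^o) (fst \o snd)
  | Some true =>
      Summand (@inr0 P0 (R^o * R^o)%type \o @inr0 R^o R^o) (snd \o snd)
  end.

Lemma P3_inK i : cancel (s_in (P3_summand i)) (s_out (P3_summand i)).
Proof. by case: i. Qed.

Lemma P3_out0 i j x : i != j -> s_out (P3_summand j) (s_in (P3_summand i) x) = 0.
Proof. by move: x; case: i; case: j. Qed.

Lemma P3_sum p : \sum_i s_in (P3_summand i) (s_out (P3_summand i) p) = p.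
Proof. by rewrite big_bool /= addrC -pairE. Qed.

Definition P3_dec : decomposition P3 := Decomposition P3_inK P3_out0 P3_sum.

Lemma P4_inK i : cancel (s_in (P4_summand i)) (s_out (P4_summand i)).
Proof. by case: i => [[]|]. Qed.

Lemma P4_out0 i j x : i != j -> s_out (P4_summand j) (s_in (P4_summand i) x) = 0.
Proof. by move: x; case: i => [[]|]; case: j => [[]|]. Qed.

Lemma P4_sum p : \sum_i s_in (P4_summand i) (s_out (P4_summand i) p) = p.
Proof.
rewrite (bigD1 None) // (bigD1 (Some true)) // (bigD1 (Some false)) //=.
rewrite big1 ?addr0; last by case=> [[]|].
case: p => p [a b]; congr pair; first by rewrite /= !addr0.
by congr pair; rewrite /= ?addr0 ?add0r.
Qed.

Definition P4_dec : decomposition P4 := Decomposition P4_inK P4_out0 P4_sum.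

End PModules.
End Modules.

(* Main.v *)
From HB Require Import structures.
From mathcomp Require Import all_boot all_algebra ring zify.
From mathcomp Require Import boolp classical_sets.
Require Import Defs.

Set Implicit Arguments.
Unset Strict Implicit.
Unset Printing Implicit Defensive.

Import GRing.Theory.
Local Open Scope ring_scope.

(** Both sides classify the alternating forms on [P_4] with Pfaffian 1, relative
    to [chi_0 _|_ psi_2], up to the elementary group [E(P_4)].

    An alternating form on [P_4 = P_3 (+) R e_4], with [P_3 = P_0 (+) R e_3], is
    the same thing as a pair of a functional [a] on [P_3] (the pairing with
    [e_4]) and a vector [b] of [P_3] (the restriction to [P_3] is
    [vol3 b x y], the determinant of [b], [x], [y]); this is [form4 a b], and
    its Pfaffian is [a(b)].  If [a(b) = 1], then [a] is unimodular, and every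
    unimodular functional arises.  The map from forms to functionals induces a
    bijection from [E(P_4)]-orbits to [E(P_3)]-orbits.  It is well defined
    ([E4_row_orbit]) because [e_4 |-> e_4 + y] replaces [a] by
    [a + vol3 b _ y = a \o (1 + b (x) vol3 b _ y)], and this Koszul transvection
    is elementary ([E3_koszul]).  It is injective ([row_orbit_E4]) because
    two forms with the same [a] differ by some [x |-> x + l(x) e_4], by
    exactness of the Koszul complex of [a].

    On the other hand a form has Pfaffian 1 if and only if its class lies in
    [tilde_V_SL] ([in_tilde_form4]).  By hypothesis it then has the class of
    exactly one [chi_i], and two forms with the same class differ by an element
    of [SL(P_4)] ([V_class_cancel]).  So the forms of Pfaffian 1 are the disjoint
    union of the [SL(P_4)]-orbits of the [chi_i], that is of the coset spaces
    [Sp(chi_i) \ SL(P_4)].  Dividing by [E(P_4)], which is normal ([P4_normal]),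
    gives the right hand side.

    Two points need a theory of their own.  An equality in [V_SL] is turned into
    a stable isometry by checking the relations of the presentation on the
    relation [stably_eq]; the auxiliary summand is embedded isometrically in a
    hyperbolic space ([hyp_stabilize]) and hyperbolic planes are cancelled one
    by one ([hyp_cancel]), which rests on the transitivity of the symplectic
    group on unimodular vectors.  That follows from Bass' stable range theorem
    ([bass]), proved here by induction on boundary ideals.  And the Pfaffian,
    given by its expansion along the first row, is shown to be multiplied by the
    determinant under a change of basis ([pf_det]), since it is multilinear and
    alternating as a function of the basis.  Its value on [form4 a b] is computed
    over the open sets where [P_0] is free ([local_pfaffian]). *)

(** * Linear isomorphisms and complements *)

Section LinIso.
Variable R : comPzRingType.
Implicit Types P Q M N : lmodType R.

Lemma mk_linearE (U V : lmodType R) (f : U -> V) (hf : linear f) x :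
  mk_linear hf x = f x.
Proof. by []. Qed.

Lemma iso_invD (U V : lmodType R) (h : lin_iso U V) x y :
  iso_inv h (x + y) = iso_inv h x + iso_inv h y.
Proof. exact: (raddfD (mk_linear (iso_inv_linear h))). Qed.

Lemma iso_invZ (U V : lmodType R) (h : lin_iso U V) a x :
  iso_inv h (a *: x) = a *: iso_inv h x.
Proof. exact: (linearZ_LR (mk_linear (iso_inv_linear h))). Qed.

Definition iso_of (U V : lmodType R) (f : U -> V) (hf : linear f) (g : V -> U)
    (fK : cancel f g) (gK : cancel g f) : lin_iso U V :=
  @LinIso R U V (mk_linear hf) g fK gK.

Definition iso_id P : lin_iso P P.
Proof. by exists (mk_linear (fun a x y => erefl (a *: x + y))) id. Defined.

Definition iso_sym P Q (h : lin_iso P Q) : lin_iso Q P.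
Proof. exact: (iso_of (iso_inv_linear h) (@isoVK _ _ _ h) (@isoK _ _ _ h)). Defined.

Definition iso_trans M N P (h : lin_iso M N) (k : lin_iso N P) : lin_iso M P.
Proof.
apply: (@iso_of _ _ (k \o h) _ (iso_inv h \o iso_inv k)).
- by move=> a x y /=; rewrite !linearP.
- by move=> x /=; rewrite !isoK.
- by move=> x /=; rewrite !isoVK.
Defined.

Definition iso_prod M N P Q (h : lin_iso M P) (k : lin_iso N Q) :
  lin_iso (M * N)%type (P * Q)%type.
Proof.
apply: (@iso_of _ _ (fun x => (h x.1, k x.2)) _ (fun x => (iso_inv h x.1, iso_inv k x.2))).
- by move=> a x y /=; rewrite !linearP.
- by move=> [x y] /=; rewrite !isoK.
- by move=> [x y] /=; rewrite !isoVK.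
Defined.

Definition iso_swap M N : lin_iso (M * N)%type (N * M)%type.
Proof.
apply: (@iso_of _ _ (fun x : M * N => (x.2, x.1)) _ (fun x => (x.2, x.1))); by [|case].
Defined.

Definition iso_assoc M N P : lin_iso ((M * N) * P)%type (M * (N * P))%type.
Proof.
apply: (@iso_of _ _ (fun x : (M * N) * P => (x.1.1, (x.1.2, x.2))) _
  (fun x => ((x.1, x.2.1), x.2.2))); by [|case=> [[]]|case=> ? []].
Defined.

Definition iso_row m n : lin_iso ('rV[R]_m * 'rV[R]_n)%type 'rV[R]_(m + n).
Proof.
apply: (@iso_of _ _ (fun x : 'rV[R]_m * 'rV[R]_n => row_mx x.1 x.2) _
  (fun x => (lsubmx x, rsubmx x))).
- by move=> a x y /=; rewrite scale_row_mx add_row_mx.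
- by case=> x y /=; rewrite row_mxKl row_mxKr.
- by move=> x /=; rewrite hsubmxK.
Defined.

Definition iso_unit_row P : lin_iso (P * 'rV[R]_0)%type P.
Proof.
apply: (@iso_of _ _ (fun x : P * 'rV[R]_0 => x.1) _ (fun x => (x, 0))) => //.
by case=> x y /=; rewrite [y]thinmx0.
Defined.

(** Being a direct summand of a free module of finite rank is what [has_det]
    asks of a module. *)
Definition complemented P : Prop :=
  exists (Q : lmodType R) (n : nat), inhabited (lin_iso (P * Q)%type 'rV[R]_n).

Lemma complemented_row n : complemented 'rV[R]_n.
Proof. by exists 'rV[R]_0, n; constructor; apply: iso_unit_row. Qed.

Lemma complemented_iso P Q : lin_iso P Q -> complemented P -> complemented Q.
Proof.
move=> h [S [n [k]]]; exists S, n; constructor.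
exact: iso_trans (iso_prod (iso_sym h) (iso_id S)) k.
Qed.

Definition iso_interchange M N P Q :
  lin_iso ((M * N) * (P * Q))%type ((M * P) * (N * Q))%type.
Proof.
apply: (@iso_of _ _ (fun x : (M * N) * (P * Q) => ((x.1.1, x.2.1), (x.1.2, x.2.2))) _
  (fun x => ((x.1.1, x.2.1), (x.1.2, x.2.2)))); by [|case=> [[? ?] []]].
Defined.

Lemma complemented_prod P Q :
  complemented P -> complemented Q -> complemented (P * Q)%type.
Proof.
move=> [S [m [h]]] [T [n [k]]]; exists (S * T)%type, (m + n)%N; constructor.
apply: iso_trans (iso_row m n); apply: iso_trans (iso_prod h k).
exact: iso_interchange.
Qed.

Lemma complemented_fstE P Q : complemented (P * Q)%type -> complemented P.
Proof.
move=> [S [n [h]]]; exists (Q * S)%type, n; constructor.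
exact: iso_trans (iso_sym (iso_assoc P Q S)) h.
Qed.

Section Kernel.
Variables (U V : lmodType R) (f : {linear U -> V}).
(** Submodule types need a boolean membership predicate, whence [asbool]. *)
Definition ker_pred : {pred U} := fun x => `[< f x = 0 >].
Lemma ker_closed : GRing.submod_closed ker_pred.
Proof.
split; first by apply/asboolP; rewrite linear0.
move=> a x y /asboolP fx /asboolP fy.
by apply/asboolP; rewrite linearP fx fy scaler0 addr0.
Qed.
HB.instance Definition _ := GRing.isSubmodClosed.Build R U ker_pred ker_closed.
Record kernel := Kernel { ker_val :> U; kerP : ker_pred ker_val }.
HB.instance Definition _ := [isSub for ker_val].
HB.instance Definition _ := [Choice of kernel by <:].
HB.instance Definition _ := [SubChoice_isSubLmodule of kernel by <:].
End Kernel.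

Lemma dual_basis P : fg_projective P ->
  exists (n : nat) (g : 'I_n -> P) (phi : {linear P -> 'rV[R]_n}),
    forall p, p = \sum_i phi p 0 i *: g i.
Proof.
case=> [[n [g gP]] pP]; exists n, g.
have lin : linear (fun v : 'rV[R]_n => \sum_i v 0 i *: g i).
  move=> a p q; rewrite scaler_sumr -big_split; apply: eq_bigr => i _ /=.
  by rewrite !mxE scalerDl scalerA.
have [|phi phiP] := pP _ _ (mk_linear lin) (iso_id P).
  move=> y; have [c ->] := gP y; exists (\row_i c i).
  by apply: eq_bigr => i _; rewrite mxE.
by exists phi => p; have /= -> := phiP p.
Qed.

Lemma complemented_fg_projective P : fg_projective P -> complemented P.
Proof.
move=> /dual_basis[n [g [phi gphi]]].
have lin : linear (fun v : 'rV[R]_n => \sum_i v 0 i *: g i).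
  move=> a p q; rewrite scaler_sumr -big_split; apply: eq_bigr => i _ /=.
  by rewrite !mxE scalerDl scalerA.
pose r := mk_linear lin.
have rphi p : r (phi p) = p by rewrite [RHS]gphi.
exists (kernel r), n; constructor.
have inker v : ker_pred r (v - phi (r v)).
  by apply/asboolP; rewrite linearB rphi subrr.
apply: (@iso_of _ _ (fun x : P * kernel r => phi x.1 + val x.2) _
  (fun v => (r v, Kernel (inker v)))).
- by move=> a x y; rewrite /= !linearP scalerDr addrACA.
- move=> [p [x Hx]] /=; have /asboolP rx := Hx.
  have rp : r (phi p + x) = p by rewrite linearD rphi rx addr0.
  congr pair => //; apply: val_inj.
  by change (phi p + x - phi (r (phi p + x)) = x); rewrite rp addrC addKr.
- by move=> v /=; rewrite addrC subrK.
Qed.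

End LinIso.

(** * The special linear group of a complemented module *)

Section SpecialLinear.
Variable R : comPzRingType.
Implicit Types P Q M N : lmodType R.

Lemma lin_mxP m n (f : 'rV[R]_m -> 'rV[R]_n) :
  linear f -> exists A, forall v, f v = v *m A.
Proof.
by move=> lf; exists (lin1_mx (mk_linear lf)) => v; rewrite mul_rV_lin1.
Qed.

Lemma mulmx_rVP m n (A B : 'M[R]_(m, n)) :
  (forall v : 'rV_m, v *m A = v *m B) -> A = B.
Proof. by move=> e; apply/row_matrixP => i; rewrite !rowE e. Qed.

Lemma mx_of_aut P Q n (h : lin_iso (P * Q)%type 'rV[R]_n) (f : P -> P) :
  linear f -> exists A : 'M[R]_n, forall p q, h (f p, q) = h (p, q) *m A.
Proof.
move=> lf.
have [|A AP] := @lin_mxP n n (fun v => h (f (iso_inv h v).1, (iso_inv h v).2)).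
  move=> a x y /=; rewrite (iso_inv_linear h) /= lf -[RHS]linearP /=.
  by congr (h _); congr pair.
by exists A => p q; rewrite -AP isoK.
Qed.

(** Two complements of [P] are compared on [(P (+) Q) (+) (P (+) Q')]: exchanging
    the two copies of [P] conjugates [f] on the first one to [f] on the second. *)
Lemma det_unique P (f : P -> P) d : linear f -> has_det f d ->
  forall Q n (h : lin_iso (P * Q)%type 'rV[R]_n) (A : 'M[R]_n),
    (forall p q, h (f p, q) = h (p, q) *m A) -> \det A = d.
Proof.
move=> lf [Q' [n' [h' [A' [hA' <-]]]]] Q n h A hA.
pose k := iso_trans (iso_prod h h') (iso_row R n n').
have kE x : k x = row_mx (h x.1) (h' x.2) by [].
pose sg (x : (P * Q) * (P * Q')) := ((x.2.1, x.1.2), (x.1.1, x.2.2)).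
have [|S SP] := @lin_mxP (n + n') (n + n') (fun v => k (sg (iso_inv k v))).
  move=> a x y.
  change (k (sg (iso_inv k (a *: x + y))) = a *: k (sg (iso_inv k x)) + k (sg (iso_inv k y))).
  by rewrite -linearP (iso_inv_linear k).
have SE x : k x *m S = k (sg x) by rewrite -SP isoK.
have SS : S *m S = 1%:M.
  apply: mulmx_rVP => v; rewrite mulmxA mulmx1 -(isoVK k v) !SE.
  by congr (k _); case: (iso_inv k v) => [[? ?] []].
have e : block_mx A 0 0 1%:M *m S = S *m block_mx 1%:M 0 0 A'.
  apply: mulmx_rVP => v; rewrite !mulmxA -(isoVK k v).
  case: (iso_inv k v) => [[p q] [p' q']].
  rewrite SE !kE !mul_row_block !mulmx0 !mulmx1 !addr0 !add0r /=.
  by rewrite -hA -hA' -(kE ((f p, q), (p', q'))) SE.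
have : \det (block_mx A 0 0 1%:M *m S *m S) = \det (S *m block_mx 1%:M 0 0 A' *m S).
  by rewrite e.
rewrite -mulmxA SS mulmx1 !det_mulmx mulrAC -det_mulmx SS det1 mul1r.
by rewrite !det_ublock !det1 mulr1 mul1r.
Qed.

Lemma SL_complemented P (f : P -> P) : SL f -> complemented P.
Proof. by case=> _ [Q [n [h _]]]; exists Q, n. Qed.

Lemma SL_linear P (f : P -> P) : SL f -> linear f.
Proof. by case=> [[]]. Qed.

Lemma SL_ext P (f g : P -> P) : f =1 g -> SL f -> SL g.
Proof. by move/funext => ->. Qed.

(** Allows several automorphisms of [P] to be read as matrices over one and the
    same complement. *)
Lemma SL_mx P (f : P -> P) : SL f ->
  forall Q n (h : lin_iso (P * Q)%type 'rV[R]_n),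
    exists A : 'M[R]_n, (forall p q, h (f p, q) = h (p, q) *m A) /\ \det A = 1.
Proof.
move=> [[lf _] df] Q n h; have [A AP] := mx_of_aut h lf.
by exists A; split=> //; apply: det_unique AP.
Qed.

Lemma SL_id P : complemented P -> SL (@id P).
Proof.
move=> [Q [n [h]]]; split; first by split=> [a x y //|]; exists id.
by exists Q, n, h, 1%:M; split=> [p q|]; rewrite ?mulmx1 ?det1.
Qed.

Lemma SL_comp P (f g : P -> P) : SL f -> SL g -> SL (f \o g).
Proof.
move=> Sf Sg; have [Q [n [h]]] := SL_complemented Sf.
have [A [hA dA]] := SL_mx Sf h; have [B [hB dB]] := SL_mx Sg h.
have [[lf bf] _] := Sf; have [[lg bg] _] := Sg; split.
  by split; [move=> a x y /=; rewrite lg lf|exact: bij_comp].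
exists Q, n, h, (B *m A); split; last by rewrite det_mulmx dA dB mul1r.
by move=> p q; rewrite hA hB mulmxA.
Qed.

Lemma inv_linear P Q (f : P -> Q) (g : Q -> P) :
  linear f -> cancel f g -> cancel g f -> linear g.
Proof. by move=> lf fK gK a x y; rewrite -{1}(gK x) -{1}(gK y) -lf fK. Qed.

Lemma SL_inv P (f g : P -> P) : SL f -> cancel f g -> cancel g f -> SL g.
Proof.
move=> Sf fK gK; have [[lf bf] _] := Sf.
have lg := inv_linear lf fK gK.
have [Q [n [h]]] := SL_complemented Sf.
have [A [hA dA]] := SL_mx Sf h; have [B hB] := mx_of_aut h lg.
split; first by split=> //; exists f.
exists Q, n, h, B; split=> //.
have <- : \det (A *m B) = 1; last by rewrite det_mulmx dA mul1r.
suff -> : A *m B = 1%:M by rewrite det1.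
apply: mulmx_rVP => v; rewrite mulmx1 -(isoVK h v) mulmxA.
by case: (iso_inv h v) => p q; rewrite -hA -hB fK.
Qed.

Lemma SL_conj P Q (k : lin_iso P Q) (f : P -> P) :
  SL f -> SL (fun x => k (f (iso_inv k x))).
Proof.
move=> Sf; have [[lf [g fK gK]] [T [n [h [A [hA dA]]]]]] := Sf; split.
  split; first by move=> a x y; rewrite (iso_inv_linear k) lf linearP.
  exists (fun x => k (g (iso_inv k x))) => x; rewrite isoK ?fK ?gK isoVK //.
exists T, n, (iso_trans (iso_prod (iso_sym k) (iso_id T)) h), A; split=> // p q.
by rewrite /= isoK hA.
Qed.

Lemma SL_prodl P N (f : P -> P) : complemented N -> SL f ->
  SL (fun x : P * N => (f x.1, x.2)).
Proof.
move=> [T [m [k]]] Sf; have [[lf [g fK gK]] [Q [n [h [A [hA dA]]]]]] := Sf; split.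
  split; first by move=> a x y /=; rewrite lf.
  by exists (fun x => (g x.1, x.2)) => -[x y] /=; rewrite ?fK ?gK.
pose l := iso_trans (iso_interchange P N Q T)
           (iso_trans (iso_prod h k) (iso_row R n m)).
exists (Q * T)%type, (n + m)%N, l, (block_mx A 0 0 1%:M).
split; last by rewrite det_ublock dA det1 mulr1.
move=> [p x] [q t]; rewrite [LHS]/= [l _]/= mul_row_block.
by rewrite !mulmx0 mulmx1 addr0 add0r hA.
Qed.

(** If [Q] is a complement of [P (+) N], then [N (+) Q] is one of [P]. *)
Lemma SL_unprodl P N (f : P -> P) : linear f -> bijective f ->
  SL (fun x : P * N => (f x.1, x.2)) -> SL f.
Proof.
move=> lf bf [_ [Q [n [h [A [hA dA]]]]]]; split=> //.
exists (N * Q)%type, n, (iso_trans (iso_sym (iso_assoc P N Q)) h), A.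
by split=> // p [x q]; have /= := hA (p, x) q.
Qed.

Lemma SL_prodr P N (f : N -> N) : complemented P -> SL f ->
  SL (fun x : P * N => (x.1, f x.2)).
Proof.
move=> cP Sf; apply: SL_ext (SL_conj (iso_swap N P) (SL_prodl cP Sf)).
by case.
Qed.

Lemma SL_elem_aut P N (s : {linear N -> P}) :
  is_aut (fun x : P * N => (x.1 + s x.2, x.2)).
Proof.
split.
  move=> a x y; congr pair => //=.
  by rewrite linearP scalerDr addrACA.
by exists (fun x => (x.1 - s x.2, x.2)) => -[x y] /=; rewrite ?addrK ?subrK.
Qed.

Lemma SL_elem P N (s : {linear N -> P}) : complemented P -> complemented N ->
  SL (fun x : P * N => (x.1 + s x.2, x.2)).
Proof.
move=> [Q [n [h]]] [T [m [k]]]; split; first exact: SL_elem_aut.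
have [|S SP] := @lin_mxP m n (fun v => h (s (iso_inv k v).1, 0)).
  move=> a x y /=; rewrite -[RHS]linearP; congr (h _).
  rewrite (iso_inv_linear k) /= linearP; congr pair.
  by rewrite /= scaler0 addr0.
pose l := iso_trans (iso_interchange P N Q T)
           (iso_trans (iso_prod h k) (iso_row R n m)).
exists (Q * T)%type, (n + m)%N, l, (block_mx 1%:M 0 S 1%:M).
split; last by rewrite det_lblock !det1 mulr1.
move=> [p x] [q t]; rewrite [LHS]/= [l _]/= mul_row_block.
rewrite !mulmx0 !mulmx1 add0r -SP isoK /= -linearD.
by congr (row_mx (h _) _); congr pair; rewrite /= addr0.
Qed.

Lemma SL_elem' P N (s : {linear P -> N}) : complemented P -> complemented N ->
  SL (fun x : P * N => (x.1, x.2 + s x.1)).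
Proof.
move=> cP cN; apply: SL_ext (SL_conj (iso_swap N P) (SL_elem s cN cP)).
by case.
Qed.

(** The block matrix with rows [(0, -k^-1)] and [(k, 0)] is a product of three
    elementary ones. *)
Lemma SL_signed_swap P N (k : lin_iso P N) : complemented P ->
  SL (fun x : P * N => (- iso_inv k x.2, k x.1)).
Proof.
move=> cP; have cN := complemented_iso k cP.
have E1 := SL_elem' k cP cN.
have li : linear (fun y => - iso_inv k y).
  by move=> a x y; rewrite (iso_inv_linear k) opprD scalerN.
have E3 := SL_elem (mk_linear li) cP cN.
apply: SL_ext (SL_comp E1 (SL_comp E3 E1)) => -[x y] /=.
rewrite iso_invD isoK opprD addrCA subrr addr0.
by rewrite linearN isoVK addrC addKr.
Qed.

End SpecialLinear.

(** * Pfaffians *)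

Section Contraction.
Variable R : comPzRingType.

(** Contraction with [c]: the alternating sum of the [c s_i] times the value of
    [G] on [s] without [s_i].  Pfaffians and determinants are iterated
    contractions. *)
Fixpoint contr (T : Type) (c : T -> R) (G : seq T -> R) (s : seq T) : R :=
  if s is y :: s' then c y * G s' - contr c (G \o cons y) s' else 0.

Definition alternating (T : Type) (G : seq T -> R) : Prop :=
  forall s1 s2 x, G (s1 ++ x :: x :: s2) = 0.

Definition swapping (T : Type) (G : seq T -> R) : Prop :=
  forall s1 s2 x y, G (s1 ++ x :: y :: s2) = - G (s1 ++ y :: x :: s2).

Definition multilinear (U : lmodType R) (G : seq U -> R) : Prop :=
  forall s1 s2 a x y,
    G (s1 ++ (a *: x + y) :: s2) = a * G (s1 ++ x :: s2) + G (s1 ++ y :: s2).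

Lemma eq_contr (T : Type) (c c' : T -> R) (G G' : seq T -> R) s :
  c =1 c' -> G =1 G' -> contr c G s = contr c' G' s.
Proof.
move=> ec; elim: s G G' => //= y s IH G G' eG; rewrite ec eG.
by congr (_ - _); apply: IH => t /=.
Qed.

Lemma contr_map (S T : Type) (h : S -> T) c G s :
  contr c G (map h s) = contr (c \o h) (G \o map h) s.
Proof. by elim: s G => //= y s IH G; rewrite IH. Qed.

Lemma contrZ (T : Type) (c : T -> R) G a s :
  contr c (fun t => G t * a) s = contr c G s * a.
Proof.
elim: s G => [|y s IH] G /=; first by rewrite mul0r.
by rewrite (IH (G \o cons y)) mulrBl mulrA.
Qed.

Lemma contrB (T : Type) (c : T -> R) G G' s :
  contr c (fun t => G t - G' t) s = contr c G s - contr c G' s.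
Proof.
elim: s G G' => [|y s IH] G G' /=; first by rewrite subr0.
by rewrite (IH (G \o cons y) (G' \o cons y)); ring.
Qed.

Lemma contr0 (T : Type) (c : T -> R) s : contr c (fun=> 0) s = 0.
Proof. by elim: s => //= y s IH; rewrite (IH : contr c (_ \o _) s = 0) mulr0 subr0. Qed.

Lemma contrDl (T : Type) (c1 c2 : T -> R) a G s :
  contr (fun y => a * c1 y + c2 y) G s = a * contr c1 G s + contr c2 G s.
Proof.
elim: s G => [|y s IH] G /=; first by rewrite mulr0 addr0.
by rewrite IH; ring.
Qed.

(** Contraction with a fixed functional is a Koszul differential. *)
Lemma contr_contr (T : Type) (c : T -> R) G s : contr c (contr c G) s = 0.
Proof.
elim: s G => //= y s IH G.
rewrite (@eq_contr _ c c (contr c G \o cons y)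
  (fun t => G t * c y - contr c (G \o cons y) t)) //.
  by rewrite contrB contrZ IH; ring.
by move=> t /=; rewrite mulrC.
Qed.

Lemma contr_alternating (T : Type) (c : T -> R) G :
  alternating G -> alternating (contr c G).
Proof.
move=> aG s1; elim: s1 G aG => [|y s1 IH] G aG s2 x /=.
  rewrite (@eq_contr _ c c ((G \o cons x) \o cons x) (fun=> 0)) ?contr0 //.
    by rewrite subr0 subrr.
  by move=> t; apply: (aG [::]).
rewrite aG mulr0 sub0r IH ?oppr0 // => t1 t2 z; exact: (aG (y :: t1)).
Qed.

Lemma contr_multilinear (U : lmodType R) (c : U -> R) G :
  (forall a x y, c (a *: x + y) = a * c x + c y) ->
  multilinear G -> multilinear (contr c G).
Proof.
move=> lc mG s1; elim: s1 G mG => [|z s1 IH] G mG s2 a x y /=.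
  rewrite lc (@eq_contr _ c c _
    (fun t => (G \o cons x) t * a - (- (G \o cons y) t))) //.
    rewrite contrB contrZ.
    rewrite (@eq_contr _ c c (fun t => - _) (fun t => (G \o cons y) t * -1)) //.
      by rewrite contrZ; ring.
    by move=> t /=; rewrite mulrN1.
  by move=> t /=; rewrite (mG [::]) /= opprK mulrC.
rewrite mG IH; last by move=> t1 t2 *; exact: (mG (z :: t1)).
by ring.
Qed.

Lemma eq_contr_mem (T : eqType) (c : T -> R) (G G' : seq T -> R) s :
  (forall t, (size t).+1 = size s -> {subset t <= s} -> G t = G' t) ->
  contr c G s = contr c G' s.
Proof.
elim: s G G' => //= y s IH G G' eG; congr (_ * _ - _).
  by apply: eG => // t; rewrite inE orbC => ->.
apply: IH => t st tS /=; apply: eG => /=; first by rewrite st.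
by move=> z; rewrite !inE => /orP[->//|/tS ->]; rewrite orbT.
Qed.

Lemma contr_cat0 (T : eqType) (c : T -> R) G s1 s2 :
  (forall y, y \in s2 -> c y = 0) ->
  contr c G (s1 ++ s2) = contr c (fun t => G (t ++ s2)) s1.
Proof.
move=> c0; elim: s1 G => [|y s1 IH] G /=; last by rewrite IH.
elim: s2 c0 G => //= y s2 IH c0 G; rewrite c0 ?inE ?eqxx // mul0r sub0r IH ?oppr0 //.
by move=> z zs; rewrite c0 // inE zs orbT.
Qed.

Lemma contr_enum (T : Type) n (c : T -> R) G (h : 'I_n.+1 -> T) :
  contr c G (map h (enum 'I_n.+1)) =
  \sum_(j < n.+1) (-1) ^+ j * c (h j) * G (map (h \o lift j) (enum 'I_n)).
Proof.
elim: n G h => [|n IH] G h.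
  rewrite enum_ordSl big_ord1 (size0nil (size_enum_ord 0)) /= expr0.
  by rewrite subr0 mul1r.
rewrite enum_ordSl /= -map_comp IH [RHS]big_ord_recl /= expr0 mul1r; congr (_ + _).
rewrite -sumrN; apply: eq_bigr => j _ /=.
rewrite -mulNr -mulNr -mulN1r -exprS; congr (_ * _ * G _).
rewrite [in RHS]enum_ordSl /= -map_comp; congr (h _ :: _).
  by apply: val_inj.
by apply: eq_map => i /=; congr (h _); apply: val_inj; rewrite /= /bump; lia.
Qed.

End Contraction.

Section Pfaffian.
Variable R : comPzRingType.

Lemma nilp_cat_cons (T : Type) (s1 s2 : seq T) x : nilp (s1 ++ x :: s2) = false.
Proof. by case: s1. Qed.

(** The Pfaffian of the Gram matrix of [w] on [s], expanded along the first
    vector; it vanishes unless [s] has length [2n].  Lists make it easy to remove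
    and to exchange vectors. *)
Fixpoint pfs (T : Type) (n : nat) (w : T -> T -> R) (s : seq T) : R :=
  match n, s with
  | 0, s => (nilp s)%:R
  | n'.+1, [::] => 0
  | n'.+1, x :: s' => contr (w x) (pfs n' w) s'
  end.

Lemma eq_pfs (T : Type) n (w w' : T -> T -> R) s :
  (forall x y, w x y = w' x y) -> pfs n w s = pfs n w' s.
Proof.
move=> e; elim: n s => [|n IH] [|x s] //=; apply: eq_contr => //; exact: e.
Qed.

Lemma pfs_map (S T : Type) (h : S -> T) n w s :
  pfs n w (map h s) = pfs n (fun x y => w (h x) (h y)) s.
Proof.
elim: n s => [|n IH] [|x s] //=; rewrite contr_map; exact: eq_contr.
Qed.

Lemma pfaffianE m (M : 'M[R]_m.*2) :
  pfaffian M = pfs m (fun i j => M i j) (enum 'I_m.*2).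
Proof.
elim: m M => [|m IH] M.
  by rewrite (size0nil (size_enum_ord 0)).
rewrite [LHS]/= enum_ordSl /= contr_enum; apply: eq_bigr => j _; rewrite IH.
congr (_ * _); rewrite pfs_map; apply: eq_pfs => x y.
by rewrite !mxE.
Qed.

Lemma pfs_multilinear (U : lmodType R) n (w : U -> U -> R) :
  (forall z a x y, w z (a *: x + y) = a * w z x + w z y) ->
  (forall z a x y, w (a *: x + y) z = a * w x z + w y z) ->
  multilinear (pfs n w).
Proof.
move=> wr wl; elim: n => [|n IH] s1 s2 a x y.
  by rewrite /= !nilp_cat_cons mulr0 addr0.
case: s1 => [|z s1] /=; last by apply: contr_multilinear.
rewrite -contrDl; apply: eq_contr => //; exact: wl.
Qed.

(** Two equal leading vectors give a contraction applied twice. *)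
Lemma pfs_alternating (T : Type) n (w : T -> T -> R) :
  (forall x, w x x = 0) -> alternating (pfs n w).
Proof.
move=> w0; elim: n => [|n IH] s1 s2 x.
  by rewrite /= nilp_cat_cons.
case: s1 => [|z s1] /=; last by apply: contr_alternating.
rewrite w0 mul0r sub0r; apply/eqP; rewrite oppr_eq0; apply/eqP.
case: n IH => [|n] IH.
  by rewrite (@eq_contr _ _ _ (w x) _ (fun=> 0)) ?contr0.
by rewrite (@eq_contr _ _ _ (w x) _ (contr (w x) (pfs n w))) ?contr_contr.
Qed.

Lemma pfs_cat (T : eqType) k l (w : T -> T -> R) s1 s2 :
  size s1 = k.*2 -> (forall x y, x \in s1 -> y \in s2 -> w x y = 0) ->
  pfs (k + l) w (s1 ++ s2) = pfs k w s1 * pfs l w s2.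
Proof.
elim: k s1 => [|k IH] [|x s1] //= sz w0; first by rewrite mul1r.
rewrite contr_cat0; last by move=> y; apply: w0; rewrite inE eqxx.
rewrite -contrZ; apply: eq_contr_mem => t st tS; apply: IH.
  by move: sz => [] ; rewrite -st => -[].
by move=> a b /tS at' bs; apply: w0 => //; rewrite inE at' orbT.
Qed.

(** The determinant of [c j (v i)], developed along the columns. *)
Fixpoint dets (T : Type) (cs : seq (T -> R)) (s : seq T) : R :=
  if cs is c :: cs' then contr c (dets cs') s else (nilp s)%:R.

Lemma detsE (T : Type) n (c : 'I_n -> T -> R) (v : 'I_n -> T) :
  \det (\matrix_(i, j) c j (v i)) = dets (map c (enum 'I_n)) (map v (enum 'I_n)).
Proof.
elim: n c v => [|n IH] c v.
  by rewrite det_mx00 (size0nil (size_enum_ord 0)).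
rewrite (expand_det_col _ ord0) [in map c _]enum_ordSl /= contr_enum.
apply: eq_bigr => i _; rewrite mxE /cofactor addn0 mulrCA mulrA; congr (_ * _).
rewrite -map_comp -IH; congr (\det _).
by apply/matrixP => a b; rewrite !mxE.
Qed.

Lemma dets_multilinear (U : lmodType R) (cs : seq (U -> R)) :
  (forall c, List.In c cs -> forall a x y, c (a *: x + y) = a * c x + c y) ->
  multilinear (dets cs).
Proof.
elim: cs => [|c cs IH] lc s1 s2 a x y /=.
  by rewrite /= !nilp_cat_cons mulr0 addr0.
by apply: contr_multilinear; [apply: lc; left|apply: IH => d dc; apply: lc; right].
Qed.

Lemma dets_alternating (T : Type) (cs : seq (T -> R)) : alternating (dets cs).
Proof.
elim: cs => [|c cs IH] /=; last exact: contr_alternating.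
by move=> s1 s2 x; rewrite /= nilp_cat_cons.
Qed.

Lemma alternating_swap (U : lmodType R) (G : seq U -> R) :
  multilinear G -> alternating G -> swapping G.
Proof.
move=> mG aG s1 s2 x y.
have Dr z s2' a b : G (s1 ++ (a + b) :: z :: s2') =
    G (s1 ++ a :: z :: s2') + G (s1 ++ b :: z :: s2').
  by have := mG s1 (z :: s2') 1 a b; rewrite scale1r mul1r.
have Dl z s2' a b : G (s1 ++ z :: (a + b) :: s2') =
    G (s1 ++ z :: a :: s2') + G (s1 ++ z :: b :: s2').
  have := mG (rcons s1 z) s2' 1 a b.
  by rewrite scale1r mul1r -!cats1 -!catA.
have := aG s1 s2 (x + y); rewrite Dr !Dl !aG add0r addr0.
by move/eqP; rewrite addr_eq0 => /eqP.
Qed.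

Lemma swapping_move (T : Type) (G : seq T -> R) s1 x s2 : swapping G ->
  G (s1 ++ x :: s2) = (-1) ^+ size s1 * G (x :: s1 ++ s2).
Proof.
elim: s1 G => [|y s1 IH] G sG; first by rewrite expr0 mul1r.
have sG' : swapping (G \o cons y) by move=> t1 t2 a b; exact: (sG (y :: t1)).
have /= -> := IH (G \o cons y) sG'.
by have /= -> := sG [::] (s1 ++ s2) y x; rewrite exprS mulrN mulN1r mulNr.
Qed.

(** The head of [u] is moved to the front of [t]; the sign is read off from the
    lists alone, so that it is the same for all [G]. *)
Lemma swapping_perm (T : eqType) (t u : seq T) : perm_eq t u ->
  exists b : nat, forall G : seq T -> R, swapping G -> G t = (-1) ^+ b * G u.
Proof.
elim: u t => [|x u IH] t.
  by move/perm_nilP => ->; exists 0%N => G _; rewrite expr0 mul1r.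
move=> tu; have /splitPr xt : x \in t by rewrite (perm_mem tu) inE eqxx.
case: xt tu => t1 t2 tu.
have /IH[b bP] : perm_eq (t1 ++ t2) u.
  by rewrite -(perm_cons x) -(permPl (permEl (perm_catCA t1 [:: x] t2))) perm_sym perm_sym tu.
exists (size t1 + b)%N => G sG; rewrite swapping_move // exprD -mulrA.
by congr (_ * _); apply: (bP (G \o cons x)) => s1 s2 *; exact: (sG (x :: s1)).
Qed.

Lemma alternating_dup (T : eqType) (G : seq T -> R) t :
  swapping G -> alternating G -> ~~ uniq t -> G t = 0.
Proof.
elim: t G => //= x t IH G sG aG; rewrite negb_and negbK.
have sG' : swapping (G \o cons x) by move=> t1 t2 a b; exact: (sG (x :: t1)).
have aG' : alternating (G \o cons x) by move=> t1 t2 a; exact: (aG (x :: t1)).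
case/orP => [/splitPr[t1 t2]|/(IH (G \o cons x)) h]; last exact: h.
have /= -> := swapping_move t1 x t2 sG'.
by have /= -> := aG [::] (t1 ++ t2) x; rewrite mulr0.
Qed.

Lemma multilinear_sum (U : lmodType R) (G : seq U -> R) s1 s2 n (x : 'I_n -> R)
    (e : 'I_n -> U) : multilinear G ->
  G (s1 ++ (\sum_i x i *: e i) :: s2) = \sum_i x i * G (s1 ++ e i :: s2).
Proof.
move=> mG.
have lin : linear (fun y => G (s1 ++ y :: s2) : R^o) by move=> a y z; apply: mG.
rewrite [LHS](linear_sum (mk_linear lin)); apply: eq_bigr => i _.
exact: (linearZ_LR (mk_linear lin)).
Qed.

(** Expand all vectors in the standard basis: a list of [n] basis vectors either
    contains a repetition or is a permutation of the basis. *)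
Lemma multilinear_alternating_eq0 n (G : seq 'rV[R]_n -> R) :
  multilinear G -> alternating G ->
  G (map (delta_mx 0) (enum 'I_n)) = 0 -> forall s, size s = n -> G s = 0.
Proof.
move=> mG aG G1; have sG := alternating_swap mG aG.
pose e : 'I_n -> 'rV[R]_n := delta_mx 0.
have basis (t : seq 'I_n) : size t = n -> G (map e t) = 0.
  move=> st; pose G' := G \o map e.
  have sG' : swapping G' by move=> t1 t2 a b; rewrite /G' /= !map_cat sG.
  have aG' : alternating G' by move=> t1 t2 a; rewrite /G' /= !map_cat aG.
  case: (boolP (uniq t)) => [ut|/(alternating_dup sG' aG')//].
  have /swapping_perm[b bP] : perm_eq t (enum 'I_n).
    apply: uniq_perm (enum_uniq _) _ => //.
    have [||//] := @uniq_min_size _ t (enum 'I_n) ut.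
      by move=> i _; rewrite mem_enum.
    by rewrite st size_enum_ord.
  by have /= := bP G' sG'; rewrite /G' /= G1 mulr0.
suff aux s (t : seq 'I_n) : (size t + size s)%N = n -> G (map e t ++ s) = 0.
  by move=> s ss; apply: (aux s [::]).
elim: s t => [|x s IH] t st; first by rewrite cats0 basis // -[RHS]st addn0.
rewrite (row_sum_delta x) multilinear_sum // big1 // => i _.
rewrite (_ : _ ++ _ = map e (rcons t i) ++ s); first by rewrite IH ?mulr0 // size_rcons -[RHS]st addnS.
by rewrite map_rcons cat_rcons.
Qed.

(** The difference of the two sides is multilinear and alternating, and it
    vanishes on the standard basis. *)
Lemma multilinear_alternating_det n (G : seq 'rV[R]_n -> R) (A : 'M[R]_n) :
  multilinear G -> alternating G ->
  G (map (fun i => row i A) (enum 'I_n)) = \det A * G (map (delta_mx 0) (enum 'I_n)).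
Proof.
move=> mG aG.
pose cs := map (fun (j : 'I_n) (v : 'rV[R]_n) => v 0 j) (enum 'I_n).
have dE (B : 'M[R]_n) : \det B = dets cs (map (fun i => row i B) (enum 'I_n)).
  by rewrite -detsE; congr (\det _); apply/matrixP => i j; rewrite !mxE.
have d1 : dets cs (map (delta_mx 0) (enum 'I_n)) = 1.
  rewrite -(det1 R n) dE; congr (dets cs _); apply: eq_map => i.
  by rewrite rowE mulmx1.
pose k := G (map (delta_mx 0) (enum 'I_n)).
have mcs : multilinear (dets cs).
  apply: dets_multilinear => c; rewrite /cs.
  elim: (enum 'I_n) => //= i s IH [<-|/IH //] a x y; by rewrite !mxE.
have := @multilinear_alternating_eq0 n (fun s => G s - dets cs s * k) _ _ _
  (map (fun i => row i A) (enum 'I_n)).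
move/(_ _ _ _ _)/eqP; rewrite dE -/k subr_eq0 => h; apply/eqP; apply: h.
- by move=> s1 s2 a x y; rewrite mG mcs; ring.
- by move=> s1 s2 x; rewrite aG dets_alternating mul0r subr0.
- by rewrite d1 mul1r subrr.
- by rewrite size_map size_enum_ord.
Qed.

Lemma map_enum_split (T : Type) m n (v : 'I_(m + n) -> T) :
  map v (enum 'I_(m + n)) =
  map (v \o lshift n) (enum 'I_m) ++ map (v \o @rshift m n) (enum 'I_n).
Proof.
rewrite (map_comp v) (map_comp v (@rshift m n)) -map_cat; congr map.
apply: (inj_map val_inj); rewrite map_cat -(map_comp val (lshift n)) -(map_comp val (@rshift m n)).
have -> : map (val \o lshift n) (enum 'I_m) = iota 0 m by exact: val_enum_ord.
have -> : map (val \o @rshift m n) (enum 'I_n) = iota m n.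
  by rewrite (map_comp (addn m) val) val_enum_ord -iotaDl addn0.
by rewrite [LHS]val_enum_ord iotaD.
Qed.

End Pfaffian.

(** * Special linear isometries, and an invariant of the presentation of V_SL *)

Section SLIsometry.
Variable R : comPzRingType.
Implicit Types M N P Q : lmodType R.

Definition SLiso M (F G : M -> M -> R) : Prop :=
  exists alpha : M -> M, SL alpha /\ forall x y, F (alpha x) (alpha y) = G x y.

Definition perp M N (F : M -> M -> R) (G : N -> N -> R) (x y : M * N) : R :=
  F x.1 y.1 + G x.2 y.2.

Lemma SLiso_refl M (F : M -> M -> R) : complemented M -> SLiso F F.
Proof. by move=> cM; exists id; split=> //; apply: SL_id. Qed.

Lemma SLiso_sym M (F G : M -> M -> R) : SLiso F G -> SLiso G F.
Proof.
move=> [a [Sa h]]; have [[_ [b aK bK]] _] := Sa; exists b.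
by split=> [|x y]; [exact: SL_inv Sa aK bK|rewrite -h !bK].
Qed.

Lemma SLiso_trans M (F G H : M -> M -> R) : SLiso F G -> SLiso G H -> SLiso F H.
Proof.
move=> [a [Sa ha]] [b [Sb hb]]; exists (a \o b).
by split=> [|x y /=]; [exact: SL_comp|rewrite ha hb].
Qed.

Lemma SLiso_iso M N (h : lin_iso M N) (F G : M -> M -> R) (F' G' : N -> N -> R) :
  SLiso F' G' -> (forall x y, F x y = F' (h x) (h y)) ->
  (forall x y, G x y = G' (h x) (h y)) -> SLiso F G.
Proof.
move=> [a [Sa ha]] eF eG; exists (fun x => iso_inv h (a (h x))).
split; last by move=> x y; rewrite eF eG !isoVK.
exact: (SL_conj (iso_sym h) Sa).
Qed.

Lemma SLiso_complemented M (F G : M -> M -> R) : SLiso F G -> complemented M.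
Proof. by case=> a [/SL_complemented]. Qed.

Lemma SLiso_prod M N (F G : M -> M -> R) (F' G' : N -> N -> R) :
  SLiso F G -> SLiso F' G' -> SLiso (perp F F') (perp G G').
Proof.
move=> i1 i2; have cM := SLiso_complemented i1; have cN := SLiso_complemented i2.
move: i1 i2 => [a [Sa ha]] [b [Sb hb]].
exists ((fun x => (a x.1, x.2)) \o (fun x => (x.1, b x.2))); split.
  by apply: SL_comp; [apply: SL_prodl|apply: SL_prodr].
by move=> x y /=; rewrite /perp /= ha hb.
Qed.

(** The sign in [(x, y) |-> (- y, x)] gives the exchange of summands determinant
    1 and is invisible to an alternating form. *)
Lemma SLiso_perp_swap P N (k : lin_iso P N) (F F' : P -> P -> R)
    (G G' : N -> N -> R) : complemented P ->
  (forall x y, F (- x) (- y) = F x y) ->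
  (forall x y, F x y = G' (k x) (k y)) -> (forall x y, F' x y = G (k x) (k y)) ->
  SLiso (perp F G) (perp F' G').
Proof.
move=> cP eF FG' F'G; exists (fun x => (- iso_inv k x.2, k x.1)).
split; first exact: SL_signed_swap.
by move=> x y; rewrite /perp /= eF FG' F'G !isoVK addrC.
Qed.

Section AltForm.
Variables (P : lmodType R) (f : alt_form P).
Lemma formDl x y z : f (x + y) z = f x z + f y z.
Proof. by have [fl _ _] := form_alt f; have := fl z 1 x y; rewrite !scale1r. Qed.
Lemma formDr x y z : f z (x + y) = f z x + f z y.
Proof. by have [_ fr _] := form_alt f; have := fr z 1 x y; rewrite !scale1r. Qed.
Lemma formZl a x z : f (a *: x) z = a * f x z.
Proof. have [fl _ _] := form_alt f; exact: (linearZ_LR (mk_linear (fl z))). Qed.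
Lemma formZr a x z : f z (a *: x) = a * f z x.
Proof. have [_ fr _] := form_alt f; exact: (linearZ_LR (mk_linear (fr z))). Qed.
Lemma form0l z : f 0 z = 0.
Proof. by rewrite -(scale0r 0) formZl mul0r. Qed.
Lemma form0r z : f z 0 = 0.
Proof. by rewrite -(scale0r 0) formZr mul0r. Qed.
Lemma formNl x z : f (- x) z = - f x z.
Proof. by rewrite -scaleN1r formZl mulN1r. Qed.
Lemma formNr x z : f z (- x) = - f z x.
Proof. by rewrite -scaleN1r formZr mulN1r. Qed.
Lemma formBl x y z : f (x - y) z = f x z - f y z.
Proof. by rewrite formDl formNl. Qed.
Lemma formBr x y z : f z (x - y) = f z x - f z y.
Proof. by rewrite formDr formNr. Qed.
Lemma formxx x : f x x = 0.
Proof. by have [_ _ f0] := form_alt f. Qed.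
Lemma form_anti x y : f x y = - f y x.
Proof. exact: alternatingN (form_alt f) x y. Qed.
Lemma formNN x y : f (- x) (- y) = f x y.
Proof. by rewrite formNl formNr opprK. Qed.
Lemma form_inj x x' : f x =1 f x' -> x = x'.
Proof.
move=> e; have [_ fr _] := form_alt f.
have [z [_ U]] := form_nondeg f (mk_linear (fr x)).
by rewrite -(U x (fun=> erefl)) -(U x' (fun y => esym (e y))).
Qed.
End AltForm.

(** The equality [[P, f, g] = [P', f', g']] in [V_SL] is read as
    [f _|_ g' = g _|_ f'], up to special linear isometry and after the addition
    of one form [q] to both sides. *)
Definition stably_eq (t t' : triple R) : Prop :=
  exists (Q : lmodType R) (_ : fg_projective Q) (q : alt_form Q),
    SLiso (perp (perp (t_form0 t) (t_form1 t')) q)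
          (perp (perp (t_form1 t) (t_form0 t')) q).

Definition zero_triple : triple R :=
  Triple (fg_projective_rV R 0) (alt_mx (psi_alt R 0)) (alt_mx (psi_alt R 0)).

Definition add_triple (t t' : triple R) : triple R :=
  Triple (fg_projective_prod (t_fgp t) (t_fgp t'))
    (alt_perp (t_form0 t) (t_form0 t')) (alt_perp (t_form1 t) (t_form1 t')).

Definition opp_triple (t : triple R) : triple R :=
  Triple (t_fgp t) (t_form1 t) (t_form0 t).

(** A word in the generators has the class of a single triple. *)
Fixpoint word_triple (w : V_word R) : triple R :=
  match w with
  | V_gen t => t
  | V_zero => zero_triple
  | V_add x y => add_triple (word_triple x) (word_triple y)
  | V_opp x => opp_triple (word_triple x)
  end.

Lemma stably_eqP (t t' : triple R) :
  SLiso (perp (t_form0 t) (t_form1 t')) (perp (t_form1 t) (t_form0 t')) ->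
  stably_eq t t'.
Proof.
move=> h; exists 'rV[R]_0, (fg_projective_rV R 0), (alt_mx (psi_alt R 0)).
by apply: SLiso_prod => //; apply: SLiso_refl; apply: complemented_row.
Qed.

Lemma stably_eq_isometric t t' : isometric t t' -> stably_eq t t'.
Proof.
case=> k [h0 h1]; apply: stably_eqP; apply: (SLiso_perp_swap (k := k)) => //.
- exact/complemented_fg_projective/t_fgp.
- exact: formNN.
Qed.

Lemma stably_eq_refl t : stably_eq t t.
Proof. by apply: stably_eq_isometric; exists (iso_id (t_mod t)). Qed.

Lemma stably_eq_sym t t' : stably_eq t t' -> stably_eq t' t.
Proof.
move=> [Q [hQ [q /SLiso_sym h]]]; exists Q, hQ, q.
apply: (SLiso_iso (h := iso_prod (iso_swap _ _) (iso_id Q)) h);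
  by move=> x y; rewrite /perp /=; congr (_ + _); rewrite addrC.
Qed.


(** The orthogonal sum of the two isometries contains [f' _|_ g'] on one side and
    [g' _|_ f'] on the other, which are exchanged with a sign. *)
Lemma stably_eq_trans t t' t'' :
  stably_eq t t' -> stably_eq t' t'' -> stably_eq t t''.
Proof.
case: t t' t'' => P hP f g [P' hP' f' g'] [P'' hP'' f'' g'']
  [Q [hQ [q]]] /= h1 [Q' [hQ' [q']]] /= h2.
exists ((P' * P') * (Q * Q'))%type.
exists (fg_projective_prod (fg_projective_prod hP' hP') (fg_projective_prod hQ hQ')).
exists (alt_perp (alt_perp f' g') (alt_perp q q')) => /=.
have h3 := SLiso_prod h1 h2.
pose k (x : (P * P'') * ((P' * P') * (Q * Q'))) :=
  (((x.1.1, x.2.1.2), x.2.2.1), ((x.2.1.1, x.1.2), x.2.2.2)).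
have lk : linear k by [].
pose k' (x : ((P * P') * Q) * ((P' * P'') * Q')) :=
  ((x.1.1.1, x.2.1.2), ((x.2.1.1, x.1.1.2), (x.1.2, x.2.2))).
have kK : cancel k k' by case=> [[? ?] [[? ?] [? ?]]].
have k'K : cancel k' k by case=> [[[? ?] ?] [[? ?] ?]].
pose G := perp (perp g f'') (perp (perp g' f') (perp q q')).
apply: (SLiso_trans (G := G)).
  apply: (SLiso_iso (h := iso_of lk kK k'K) h3) => x y;
    rewrite /G /perp /=; ring.
change (SLiso G (perp (perp g f'') (perp (perp f' g') (perp q q')))).
apply: SLiso_prod.
  exact/SLiso_refl/complemented_prod/(complemented_fg_projective hP'')/complemented_fg_projective.
apply: SLiso_prod.
  apply: (SLiso_perp_swap (k := iso_id P')) => //.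
  - exact/complemented_fg_projective.
  - exact: formNN.
by apply/SLiso_refl/complemented_prod; apply/complemented_fg_projective.
Qed.

(** Turns an equality in [V_SL] into an isometry: all relations of the
    presentation hold for [stably_eq]. *)
Lemma V_rel_stably_eq x y : V_rel x y -> stably_eq (word_triple x) (word_triple y).
Proof.
elim: x y / => /=.
- move=> x; exact: stably_eq_refl.
- move=> x y _; exact: stably_eq_sym.
- move=> x y z _ h1 _ h2; exact: stably_eq_trans h1 h2.
- move=> x x' y y' _ [Q [hQ [q h1]]] _ [Q' [hQ' [q' h2]]].
  exists (Q * Q')%type, (fg_projective_prod hQ hQ'), (alt_perp q q') => /=.
  have h3 := SLiso_prod h1 h2.
  set P := t_mod _ in h3 *; set P' := t_mod _ in h3 *.
  set S := t_mod _ in h3 *; set S' := t_mod _ in h3 *.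
  pose k (z : ((P * S) * (P' * S')) * (Q * Q')) :=
    (((z.1.1.1, z.1.2.1), z.2.1), ((z.1.1.2, z.1.2.2), z.2.2)).
  pose k' (z : ((P * P') * Q) * ((S * S') * Q')) :=
    (((z.1.1.1, z.2.1.1), (z.1.1.2, z.2.1.2)), (z.1.2, z.2.2)).
  have lk : linear k by [].
  have kK : cancel k k' by case=> [[[? ?] [? ?]] [? ?]].
  have k'K : cancel k' k by case=> [[[? ?] ?] [[? ?] ?]].
  apply: (SLiso_iso (h := iso_of lk kK k'K) h3) => a b; rewrite /perp /=; ring.
- move=> x x' _ [Q [hQ [q h1]]]; exists Q, hQ, q => /=.
  exact: SLiso_sym.
- move=> x y z; apply: stably_eq_isometric.
  by exists (iso_sym (iso_assoc _ _ _)); split=> p q /=; rewrite addrA.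
- move=> x y; apply: stably_eq_isometric.
  by exists (iso_swap _ _); split=> p q /=; rewrite addrC.
- move=> x; apply: stably_eq_isometric.
  exists (iso_trans (iso_swap _ _) (iso_unit_row _)).
  by split=> -[p1 p2] [q1 q2] /=; rewrite [p1]thinmx0 !mul0mx mxE add0r.
- move=> x; apply: stably_eqP => /=; case: (word_triple x) => P hP f g /=.
  have cP := complemented_fg_projective hP.
  apply: (@SLiso_prod _ _ (perp g f) (perp f g)).
    by apply: (SLiso_perp_swap (k := iso_id P)) => //; apply: formNN.
  exact/SLiso_refl/complemented_row.
- exact: stably_eq_isometric.
- by move=> *; apply: stably_eq_isometric; exists (iso_id _).
- move=> P hP f0 f1 f2; apply: stably_eqP => /=.
  have cP := complemented_fg_projective hP.
  have sw (f g : alt_form P) : SLiso (perp f g) (perp g f).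
    by apply: (SLiso_perp_swap (k := iso_id P)) => //; apply: formNN.
  apply: (@SLiso_trans _ _ (perp (perp f1 f0) f2)).
    by apply: (@SLiso_prod _ _ (perp f0 f1)) => //; apply: SLiso_refl.
  apply: (SLiso_iso (h := iso_assoc P P P)
    (SLiso_prod (@SLiso_refl _ f1 cP) (sw f0 f2))) => x y;
    by rewrite /perp /= addrA.
- move=> P hP g f f' phi Sphi e; apply: stably_eqP => /=.
  have cP := complemented_fg_projective hP.
  apply: (@SLiso_trans _ _ (perp f' g)).
    by apply: (SLiso_perp_swap (k := iso_id P)) => //; apply: formNN.
  apply: SLiso_prod; last exact: SLiso_refl.
  by apply: SLiso_sym; exists phi; split=> // x y; rewrite e.
Qed.

End SLIsometry.

(** * Hyperbolic stabilization *)

Section Hyperbolic.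
Variable R : comPzRingType.
Implicit Types M N P Q W : lmodType R.

Definition Psi l : alt_form 'rV[R]_l.*2 := alt_mx (psi_alt R l).

Definition row2 (e : R^o * R^o) : 'rV[R]_2 := \row_i (if i == 0 then e.1 else e.2).

Lemma row2_linear : linear row2.
Proof. by move=> a x y; apply/rowP => i; rewrite !mxE; case: ifP. Qed.

Lemma Psi_row2 l e e' (b b' : 'rV[R]_l.*2) :
  Psi l.+1 (row_mx (row2 e) b) (row_mx (row2 e') b') = alt_hyp R e e' + Psi l b b'.
Proof.
pose B : 'M[R]_(2 + l.*2) := block_mx (psi2 R) 0 0 (psi R l).
change ((row_mx (row2 e) b *m B *m (row_mx (row2 e') b')^T) 0 0 =
  alt_hyp R e e' + Psi l b b').
rewrite /B mul_row_block tr_row_mx !mulmx0 addr0 add0r mul_row_col mxE.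
congr (_ + _).
have -> : row2 e = row_mx (e.1)%:M (e.2)%:M :> 'rV_(1 + 1).
  apply/rowP => i; rewrite !mxE; case: splitP => j; rewrite ord1 mxE eqxx => ei.
    by have -> : i = 0 by apply: val_inj; rewrite /= ei.
  by have -> : i = 1 by apply: val_inj; rewrite /= ei.
pose C : 'M[R]_(1 + 1) := block_mx 0 1%:M (- 1%:M) 0.
change ((row_mx (e.1)%:M (e.2)%:M *m C *m (row2 e' : 'rV_(1 + 1))^T) 0 0 =
  alt_hyp R e e').
rewrite /C mul_row_block !mulmx0 addr0 add0r mulmxN !mulmx1.
rewrite mxE big_split_ord /= !big_ord1 !row_mxEl !row_mxEr !mxE /=.
by rewrite !mulr1n; ring.
Qed.

Lemma hyp_family Q l (u v : 'I_l -> {linear Q -> R^o}) :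
  exists j : {linear Q -> 'rV[R]_l.*2}, forall x y,
    Psi l (j x) (j y) = \sum_k ((u k x : R) * v k y - (v k x : R) * u k y).
Proof.
elim: l u v => [|l IH] u v.
  have l0 : linear (fun _ : Q => 0 : 'rV[R]_0) by move=> a x y; rewrite scaler0 addr0.
  by exists (mk_linear l0) => x y; rewrite form0l big_ord0.
have [j jE] := IH (fun k => u (lift ord0 k)) (fun k => v (lift ord0 k)).
have lin : linear (fun x : Q =>
    row_mx (row2 (u ord0 x, v ord0 x)) (j x) : 'rV[R]_l.+1.*2).
  move=> a x y; rewrite (@scale_row_mx _ 1 2 l.*2) (@add_row_mx _ 1 2 l.*2).
  by rewrite -row2_linear -linearP; congr (row_mx (row2 _) _); rewrite !linearP.
exists (mk_linear lin) => x y.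
by rewrite mk_linearE Psi_row2 jE [RHS]big_ord_recl.
Qed.

(** Write an alternating form as the difference of a bilinear form, triangular
    in a system of generators, and of its transpose. *)
Lemma hyp_embedding Q (q : alt_form Q) : fg_projective Q ->
  exists l (j : {linear Q -> 'rV[R]_l.*2}), forall x y, Psi l (j x) (j y) = q x y.
Proof.
move=> /dual_basis[n [g [phi gphi]]].
have lu k : linear (fun x => phi x 0 k : R^o).
  by move=> a x y; rewrite linearP !mxE.
have lv (k : 'I_n) : linear (fun x => \sum_(i < n | (k < i)%N) phi x 0 i * q (g k) (g i) : R^o).
  move=> a x y; rewrite linearP scaler_sumr -big_split; apply: eq_bigr => i _ /=.
  by rewrite !mxE mulrDl -mulrA.
have [j jE] := hyp_family (fun k => mk_linear (lu k)) (fun k => mk_linear (lv k)).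
exists n, j => x y; rewrite jE.
have sl (z : Q) (c : 'I_n -> R) : q (\sum_i c i *: g i) z = \sum_i c i * q (g i) z.
  have [ql _ _] := form_alt q.
  rewrite [LHS](linear_sum (mk_linear (ql z))).
  by apply: eq_bigr => i _; exact: formZl.
have sr (z : Q) (c : 'I_n -> R) : q z (\sum_i c i *: g i) = \sum_i c i * q z (g i).
  have [_ qr _] := form_alt q.
  rewrite [LHS](linear_sum (mk_linear (qr z))).
  by apply: eq_bigr => i _; exact: formZr.
rewrite [in RHS](gphi x) [in RHS](gphi y) sl.
pose F k i : R := phi x 0 k * (phi y 0 i * q (g k) (g i)).
transitivity (\sum_k \sum_i F k i); last first.
  by apply: eq_bigr => k _; rewrite sr mulr_sumr.
have -> : \sum_k \sum_i F k i =
    \sum_(k < n) \sum_(i < n | (k < i)%N) F k i + \sum_(k < n) \sum_(i < n | (i < k)%N) F k i.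
  rewrite -big_split; apply: eq_bigr => k _ /=.
  rewrite (bigD1 k) //= {1}/F formxx !mulr0 add0r (bigID (fun i : 'I_n => (k < i)%N)) /=.
  by congr (_ + _); apply: eq_bigl => i; rewrite -val_eqE /=; case: ltngtP.
rewrite [X in _ = _ + X](exchange_big_dep predT) //= -big_split /=.
apply: eq_bigr => k _; rewrite mulr_sumr mulr_suml -sumrN.
congr (_ + _); apply: eq_bigr => i _; rewrite /F /=.
by rewrite (form_anti q (g i)) !mulrN mulrA mulrAC.
Qed.

Lemma adjoint W Q (q : alt_form Q) (B : W -> Q -> R^o) :
  (forall y, linear (B^~ y)) -> (forall w, linear (B w)) ->
  exists pi : {linear W -> Q}, forall w y, q (pi w) y = B w y.
Proof.
move=> Bl Br.
have /choice[pi piE] : forall w, exists x, q x =1 B w.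
  by move=> w; have [x [xE _]] := form_nondeg q (mk_linear (Br w)); exists x.
have lpi : linear pi.
  move=> a x y; apply: (form_inj (f := q)) => z.
  by rewrite formDl formZl !piE Bl.
by exists (mk_linear lpi).
Qed.

(** After adding [N], the extension of [alpha] along the split injection [J] is
    conjugate to [id_M (+) alpha] by the involution exchanging [J(N)] and [N]. *)
Lemma SL_extend M N (J : {linear N -> M}) (pi : {linear M -> N}) (alpha : N -> N) :
  cancel J pi -> complemented M -> SL alpha ->
  SL (fun m => m + (J (alpha (pi m)) - J (pi m))).
Proof.
move=> JK cM Sa; have [[la [alpha' aK a'K]] _] := Sa.
have la' := inv_linear la aK a'K.
pose ext (f : N -> N) m := m + (J (f (pi m)) - J (pi m)).
have piE f m : pi (ext f m) = f (pi m).
  by rewrite linearD linearB !JK addrC subrK.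
have extK f g : cancel f g -> cancel (ext f) (ext g).
  move=> fK m; rewrite {1}/ext piE fK /ext -addrA.
  by rewrite -(opprB (J (f (pi m)))) subrr addr0.
have lext : linear (ext alpha).
  move=> a x y; rewrite /ext linearP la !linearP.
  by rewrite [X in _ + X = _]addrACA -scalerDr addrACA -scalerDr.
apply: (SL_unprodl (N := N) lext).
  by exists (ext alpha'); apply: extK.
pose th (z : M * N) := (z.1 - J (pi z.1) + J z.2, pi z.1).
have lth : linear th.
  move=> a [x1 x2] [y1 y2]; congr pair; rewrite /= ?linearP //.
  by rewrite [X in X + _ = _]addrACA -scalerDr addrACA -scalerDr.
have thK : cancel th th.
  move=> [m n]; rewrite /th /= linearD linearB !JK subrr add0r.
  by rewrite addrK subrK.
apply: SL_ext (SL_conj (iso_of lth thK thK) (SL_prodr cM Sa)) => -[m n].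
rewrite /= /th /= linearD linearB !JK subrr add0r addrK; congr pair.
by rewrite /ext -addrA [- _ + _]addrC.
Qed.

(** [q] embeds isometrically in a hyperbolic space, and the given isometry is
    extended by the identity on the orthogonal of the image. *)
Lemma hyp_stabilize P Q (q : alt_form Q) (chi chi' : alt_form P) :
  fg_projective Q -> SLiso (perp chi' q) (perp chi q) ->
  exists l, SLiso (perp chi' (Psi l)) (perp chi (Psi l)).
Proof.
move=> hQ iso; have [l [j jE]] := hyp_embedding q hQ; exists l.
have [Psil Psir _] := form_alt (Psi l).
have [||pi piE] := @adjoint 'rV[R]_l.*2 Q q (fun w y => Psi l w (j y)).
- by move=> y; apply: Psil.
- by move=> w a x y; rewrite linearP Psir.
have jK : cancel j pi.
  by move=> x; apply: (form_inj (f := q)) => y; rewrite piE jE.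
have lJ : linear (fun z : P * Q => (z.1, j z.2)).
  by move=> a [x1 x2] [y1 y2]; congr pair; rewrite /= linearP.
have lPi : linear (fun z : P * 'rV[R]_l.*2 => (z.1, pi z.2)).
  by move=> a [x1 x2] [y1 y2]; congr pair; rewrite /= linearP.
have cP := complemented_fstE (SLiso_complemented iso).
have [alpha [Sa aE]] := iso.
have := SL_extend (J := mk_linear lJ) (pi := mk_linear lPi) _ _ Sa.
move=> /(_ _ _)[||Sb].
- by case=> x y /=; rewrite jK.
- exact/complemented_prod/complemented_row.
move=> h; eexists; split; first exact: (conj Sb h).
move=> [p w] [p' w'] /=; rewrite /perp /=.
have := aE (p, pi w) (p', pi w').
case: (alpha (p, pi w)) => a b; case: (alpha (p', pi w')) => a' b'.
rewrite /perp /= => e.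
have -> : p + (a - p) = a by rewrite addrC subrK.
have -> : p' + (a' - p') = a' by rewrite addrC subrK.
have anti y v : Psi l (j y) v = - q (pi v) y by rewrite form_anti piE.
change (chi' a a' + Psi l (w + (j b - j (pi w))) (w' + (j b' - j (pi w'))) =
  chi p p' + Psi l w w').
rewrite !formDl !formDr !formNl !formNr !jE -!piE !anti.
rewrite (form_anti q (pi w') b) (form_anti q (pi w') (pi w)).
have -> : chi' a a' = chi p p' + q (pi w) (pi w') - q b b' by rewrite -e addrK.
ring.
Qed.

End Hyperbolic.

(** * Krull dimension and unimodular elements *)

Section Bass.
Variable R : comPzRingType.
Implicit Types (P Q : lmodType R) (I J p m : set R).

(** An ideal that is maximal among those containing [J] and avoiding [S] is
    prime. *)
Lemma krull_prime J (S : set R) : ideal J -> S 1 ->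
  (forall x y, S x -> S y -> S (x * y)) -> (forall x, J x -> ~ S x) ->
  exists p, [/\ prime_ideal p, (J `<=` p)%classic & forall x, p x -> ~ S x].
Proof.
move=> [J0 JD JM] S1 SM JS.
pose good (A : set R) := ideal (A `|` J)%classic /\ forall x, (A `|` J)%classic x -> ~ S x.
have [|A [[iA AS] maxA]] := @Zorn_bigcup R good.
  move=> F Fg Ftot; split; last first.
    move=> x [[A FA Ax]|/JS//]; have [_ nA] := Fg _ FA.
    by apply: nA; left.
  split; first by right.
  - move=> x y [[A FA Ax]|Jx] [[B FB By]|Jy]; last by right; apply: JD.
    + have [C [FC Cx Cy]] : exists C, [/\ F C, C x & C y].
        by case: (Ftot _ _ FA FB) => AB; [exists B|exists A]; split=> //; apply: AB.
      have [[_ D _] _] := Fg _ FC.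
      by have [||h|h] := D x y; [left|left|left; exists C|right].
    + have [[_ D _] _] := Fg _ FA.
      by have [||h|h] := D x y; [left|right|left; exists A|right].
    + have [[_ D _] _] := Fg _ FB.
      by have [||h|h] := D x y; [right|left|left; exists B|right].
  - move=> a x [[A FA Ax]|Jx]; last by right; apply: JM.
    have [[_ _ M] _] := Fg _ FA.
    by have [|h|h] := M a x; [left|left; exists A|right].
pose I := (A `|` J)%classic; rewrite -/I in iA AS.
have [I0 ID IM] := iA.
exists I; split=> //; last by move=> x; right.
suff adj a : ~ I a -> exists k r, I k /\ S (k + r * a).
  split=> //; first by move=> I1; exact: (AS 1).
  move=> x y Ixy; have [Ix|nIx] := pselect (I x); first by left.
  right; have [Iy|/adj[n [s [In Sn]]]] := pselect (I y) => //.
  have [k [r [Ik Sk]]] := adj _ nIx.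
  case: (AS _ _ (SM _ _ Sk Sn)).
  have -> : (k + r * x) * (n + s * y) = n * k + (s * y) * k + (r * x) * n + (r * s) * (x * y).
    by ring.
  exact: ID (ID _ _ (ID _ _ (IM _ _ Ik) (IM _ _ Ik)) (IM _ _ In)) (IM _ _ Ixy).
move=> nIa; apply: contrapT => no.
pose B := [set x | exists k r, I k /\ x = k + r * a]%classic.
have IB x : I x -> B x by move=> Ix; exists x, 0; rewrite mul0r addr0.
have BJ : (B `|` J)%classic = B.
  apply/seteqP; split=> x; last by left.
  by case=> // Jx; apply: IB; right.
apply: (maxA B).
  split; first by move=> x Ax; apply: IB; left.
  move=> BA; apply: nIa; left; apply: BA; exists 0, 1.
  by rewrite add0r mul1r.
split; rewrite BJ; last by move=> x [k [r [Ik ->]]] h; apply: no; exists k, r.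
split; first exact: IB.
- move=> x y [k [r [Ik ->]]] [n [s [In ->]]]; exists (k + n), (r + s).
  by split; [exact: ID|ring].
- move=> b x [k [r [Ik ->]]]; exists (b * k), (b * r).
  by split; [exact: IM|ring].
Qed.

Lemma radical_pow J a : ideal J ->
  (forall p, prime_ideal p -> (J `<=` p)%classic -> p a) -> exists n, J (a ^+ n).
Proof.
move=> iJ h; apply: contrapT => no.
have [|||p [pp Jp pS]] := @krull_prime J [set x | exists n, x = a ^+ n]%classic iJ.
- by exists 0%N.
- by move=> x y [i ->] [j ->]; exists (i + j)%N; rewrite exprD.
- by move=> x Jx [n e]; apply: no; exists n; rewrite -e.
by apply: (pS a) => //; [exact: h|exists 1%N].
Qed.

Lemma primeX p a n : prime_ideal p -> p (a ^+ n) -> p a.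
Proof.
move=> [_ p1 pM]; elim: n => [//|n IH]; rewrite exprS => /pM[//|]; exact: IH.
Qed.

Lemma ideal_sum p n (F : 'I_n -> R) : ideal p -> (forall i, p (F i)) -> p (\sum_i F i).
Proof. by move=> [p0 pD _] pF; apply: big_ind => //. Qed.

(** [dim (R / J) < n]. *)
Definition dim_lt (n : nat) J : Prop :=
  forall q : 'I_n.+1 -> set R,
    (forall i, prime_ideal (q i) /\ (J `<=` q i)%classic) ->
    ~ (forall i j : 'I_n.+1, (i < j)%N -> (q i `<` q j)%classic).

(** The ideal [(b) + (rad J : b)]. *)
Definition boundary J b : set R :=
  [set z | exists r s, z = r * b + s /\
     forall p, prime_ideal p -> (J `<=` p)%classic -> p (s * b)]%classic.

Lemma boundary_ideal J b : ideal (boundary J b).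
Proof.
split.
- exists 0, 0; split; first by rewrite mul0r addr0.
  by move=> p [[p0 _ _] _ _] _; rewrite mul0r.
- move=> x y [r [s [-> hs]]] [r' [s' [-> hs']]]; exists (r + r'), (s + s').
  split; first by ring.
  move=> p pp Jp; have [[_ pD _] _ _] := pp; rewrite mulrDl.
  by apply: pD; [apply: hs|apply: hs'].
- move=> a x [r [s [-> hs]]]; exists (a * r), (a * s); split; first by ring.
  by move=> p pp Jp; have [[_ _ pM] _ _] := pp; rewrite -mulrA; apply: pM; apply: hs.
Qed.

Lemma boundary_sub J b : (J `<=` boundary J b)%classic.
Proof.
move=> x Jx; exists 0, x; split; first by rewrite mul0r add0r.
by move=> p [[_ _ pM] _ _] Jp; rewrite mulrC; apply: pM; apply: Jp.
Qed.

(** A prime containing the boundary of [b] is not minimal over [J]: it contains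
    strictly a prime avoiding the products [s * b ^+ k] with [s] outside. *)
Lemma boundary_not_minimal J b p : ideal J -> prime_ideal p ->
  (boundary J b `<=` p)%classic ->
  exists q, [/\ prime_ideal q, (J `<=` q)%classic & (q `<` p)%classic].
Proof.
move=> iJ pp bp; have [ip p1 pP] := pp; have [p0 pD pM] := ip.
have [|||q [pq Jq qS]] := @krull_prime J
    [set x | exists s k, ~ p s /\ x = s * b ^+ k]%classic iJ.
- by exists 1, 0%N; rewrite mulr1.
- move=> x y [s [k [ns ->]]] [t [l [nt ->]]]; exists (s * t), (k + l)%N.
  by split=> [/pP[]//|]; rewrite exprD; ring.
- move=> x Jx [s [k [ns e]]]; apply: ns; apply: bp; exists 0, s.
  split; first by rewrite mul0r add0r.
  move=> m pm Jm; have [[_ _ mM] _ mP] := pm.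
  have : m (s * b ^+ k) by rewrite -e; apply: Jm.
  by case/mP => [ms|/(primeX pm) mb]; [rewrite mulrC; apply: mM|apply: mM].
exists q; split=> //; split.
  move=> x qx; apply: contrapT => npx; apply: (qS x) => //.
  by exists x, 0%N; rewrite expr0 mulr1.
have pb : p b.
  apply: bp; exists 1, 0; split; first by rewrite mul1r addr0.
  by move=> m [[m0 _ _] _ _] _; rewrite mul0r.
move=> /(_ b pb) qb; apply: (qS b) => //.
by exists 1, 1%N; rewrite mul1r expr1.
Qed.

Lemma dim_lt_boundary n J b : ideal J -> dim_lt n.+1 J -> dim_lt n (boundary J b).
Proof.
move=> iJ dJ q qP qlt.
have [q0 [pq0 Jq0 q0lt]] := boundary_not_minimal iJ (qP ord0).1 (qP ord0).2.
apply: (dJ (fun i => if unlift ord0 i is Some k then q k else q0)).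
  move=> i; case: unliftP => [k _|_] //; split; first exact: (qP k).1.
  exact: subset_trans (@boundary_sub J b) (qP k).2.
move=> i j; case: unliftP => [k ->|->]; case: unliftP => [l ->|->] //.
  exact: qlt.
move=> _; case: (posnP l) => [l0|lpos].
  by have -> : l = ord0 by apply: val_inj.
have [h1 h2] := q0lt; have [h3 h4] := qlt ord0 l lpos.
split; first exact: subset_trans h3.
by move=> h; apply: h4 => x /h /h1.
Qed.

(** Kronecker's theorem, by induction on the dimension.  Modulo the boundary of
    [b ord0] the other [b i] can be corrected, so that a power of [a] is a
    combination of them, of [b ord0] and of some [s] with [s * b ord0] in the
    radical of [J].  This [s] corrects [b ord0]: where [s * b ord0] and
    [b ord0 + a * s] vanish, either [a] vanishes or both [s] and [b ord0] do. *)
Lemma kronecker n J a (b : 'I_n -> R) : ideal J -> dim_lt n J ->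
  exists x : 'I_n -> R, forall p, prime_ideal p -> (J `<=` p)%classic ->
    (forall i, p (b i + a * x i)) -> p a.
Proof.
elim: n J b => [|n IH] J b iJ dJ.
  exists (fun=> 0) => p pp Jp _; case: (dJ (fun=> p)) => //.
  by move=> i j; rewrite (ord1 i) (ord1 j).
pose bn := b ord0.
have [x xP] := IH _ (fun i => b (lift ord0 i)) (boundary_ideal J bn)
  (dim_lt_boundary (b := bn) iJ dJ).
pose c i := b (lift ord0 i) + a * x i.
pose K : set R := [set z | exists y (d : 'I_n -> R),
  boundary J bn y /\ z = y + \sum_i d i * c i]%classic.
have [bd0 bdD bdM] := boundary_ideal J bn.
have iK : ideal K.
  split.
  - by exists 0, (fun=> 0); split=> //; rewrite big1 ?addr0 // => i; rewrite mul0r.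
  - move=> z z' [y [d [hy ->]]] [y' [d' [hy' ->]]]; exists (y + y'), (fun i => d i + d' i).
    split; first exact: bdD.
    by rewrite addrACA -big_split; congr (_ + _); apply: eq_bigr => i _; rewrite mulrDl.
  - move=> r z [y [d [hy ->]]]; exists (r * y), (fun i => r * d i).
    split; first exact: bdM.
    by rewrite mulrDr mulr_sumr; congr (_ + _); apply: eq_bigr => i _; rewrite mulrA.
have [|N [y [d [[r [s [-> hs]]] e]]]] := radical_pow (a := a) iK.
  move=> p pp Kp; apply: xP => // [z Jz|i].
    by apply: Kp; exists z, (fun=> 0); split=> //; rewrite big1 ?addr0 // => i; rewrite mul0r.
  apply: Kp; exists 0, (fun j => (j == i)%:R); split=> //.
  rewrite add0r (bigD1 i) //= eqxx mul1r big1 ?addr0 // => j /negPf ->.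
  by rewrite mul0r.
exists (fun i => if unlift ord0 i is Some k then x k else s) => p pp Jp h.
have [ip _ pP] := pp; have [p0 pD pM] := ip.
have psb : p s -> p bn -> p a.
  move=> ps pb; apply: (primeX (n := N) pp); rewrite e; apply: (pD); last first.
    apply: ideal_sum => // i; apply: pM.
    by have := h (lift ord0 i); rewrite liftK.
  by apply: (pD); [apply: pM|].
have := h ord0; rewrite unlift_none -/bn => has.
have pB u v : p (u + v) -> p u -> p v.
  by move=> puv pu; rewrite -(addKr u v) -mulN1r; apply: (pD) => //; apply: pM.
case/pP: (hs p pp Jp) => [ps|pb].
  by apply: psb => //; apply: (pB (a * s)); [rewrite addrC|apply: pM].
by have /pP[//|ps] := pB _ _ has pb; apply: psb.
Qed.

Definition unimodular P (x : P) : Prop := exists l : {linear P -> R^o}, l x = 1.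

Lemma unimodularP P (x : P) :
  unimodular x <->
  (forall p, prime_ideal p -> (forall l : {linear P -> R^o}, p (l x)) -> False).
Proof.
split=> [[l lx] p [_ p1 _] h|h]; first by apply: p1; rewrite -lx.
pose J : set R := [set z | exists l : {linear P -> R^o}, l x = z]%classic.
have iJ : ideal J.
  split.
  - by exists \0.
  - by move=> _ _ [l <-] [k <-]; exists (l \+ k).
  - move=> a _ [l <-].
    have lin : linear (fun y => (a : R) * l y : R^o).
      by move=> b y z; rewrite linearP /= mulrDr /GRing.scale /= mulrCA.
    by exists (mk_linear lin).
apply: contrapT => nx; have [|p [pp Jp]] := @ideal_sub_prime R J iJ.
  by move=> [l e]; apply: nx; exists l.
by apply: (h p pp) => l; apply: Jp; exists l.
Qed.

(** Part of a basis with its coordinate functionals over the open set where [d]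
    is invertible, with denominators cleared. *)
Definition dual_system P n (d : R) (b : 'I_n -> P) (f : 'I_n -> {linear P -> R^o}) :=
  forall i k, f i (b k) = if i == k then d else 0.

Definition locally_split P n : Prop := forall p, prime_ideal p ->
  exists d b f, ~ p d /\ @dual_system P n d b f.

(** As [P] is projective, the coordinates of its finitely many generators in a
    local basis define functionals on [P]; a common denominator is [d]. *)
Lemma local_basis P n : fg_projective P -> constant_rank P n ->
  forall p, prime_ideal p -> exists d b f,
    [/\ ~ p d, @dual_system P n d b f & forall x, d *: x = \sum_i f i x *: b i].
Proof.
move=> /dual_basis[m [g [phi gphi]]] hr p pp; have [[p0 pD pM] p1 pP] := pp.
have [b [span ind]] := hr p pp.
have prodP k (s : 'I_k -> R) : (forall i, ~ p (s i)) -> ~ p (\prod_i s i).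
  by move=> ns; apply: (big_ind (fun z => ~ p z)) => // x y nx ny /pP[].
have [s0 [c0 sc0]] : exists (s : 'I_m -> R) (c : 'I_m -> 'I_n -> R),
    forall j, ~ p (s j) /\ s j *: g j = \sum_i c j i *: b i.
  have /choice[s /choice[c h]] := fun j => span (g j).
  by exists s, c.
pose s := \prod_j s0 j.
pose c j i := (\prod_(k | k != j) s0 k) * c0 j i.
have sc j : s *: g j = \sum_i c j i *: b i.
  rewrite /s (bigD1 j) //= mulrC -scalerA (sc0 j).2 scaler_sumr.
  by apply: eq_bigr => i _; rewrite scalerA.
have lf i : linear (fun x => \sum_j phi x 0 j * c j i : R^o).
  move=> a x y; rewrite linearP scaler_sumr -big_split; apply: eq_bigr => j _ /=.
  by rewrite !mxE mulrDl -mulrA.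
pose f0 i := mk_linear (lf i).
have sf x : s *: x = \sum_i f0 i x *: b i.
  rewrite {1}(gphi x) scaler_sumr.
  under eq_bigr => j _ do rewrite scalerA mulrC -scalerA sc scaler_sumr.
  rewrite exchange_big; apply: eq_bigr => i _ /=; rewrite scaler_suml.
  by apply: eq_bigr => j _; rewrite scalerA.
pose err (ik : 'I_n * 'I_n) : R := f0 ik.1 (b ik.2) - (if ik.1 == ik.2 then s else 0).
have /choice[t tP] : forall ik, exists t : R, (~ p t) /\ (t * err ik = 0).
  move=> [i k] /=.
  apply: (ind (fun i => f0 i (b k) - if i == k then s else 0)).
  exists 1; split=> //; rewrite scale1r.
  under eq_bigr => j _ do rewrite scalerBl.
  rewrite sumrB -sf (bigD1 k) //= eqxx big1 ?addr0 ?subrr // => j /negPf ->.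
  by rewrite scale0r.
pose t0 := \prod_ik t ik.
have t0P i k : t0 * f0 i (b k) = t0 * if i == k then s else 0.
  apply: subr0_eq; rewrite -mulrBr /t0 (bigD1 (i, k)) //= mulrAC (tP (i, k)).2.
  by rewrite mul0r.
have ltf i : linear (fun x => t0 * f0 i x : R^o).
  by move=> a x y; rewrite linearP /= mulrDr /GRing.scale /= mulrCA.
exists (t0 * s), b, (fun i => mk_linear (ltf i)); split.
- case/pP; last exact/prodP/(fun j => (sc0 j).1).
  by apply: (big_ind (fun z => ~ p z)) => // [x y nx ny /pP[]//|ik _]; case: (tP ik).
- by move=> i k /=; rewrite t0P; case: ifP => // _; rewrite mulr0.
- move=> x; rewrite -scalerA sf scaler_sumr.
  by apply: eq_bigr => i _; rewrite scalerA.
Qed.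

Lemma locally_split_prod P Q n k : locally_split P n -> locally_split Q k ->
  locally_split (P * Q)%type (n + k).
Proof.
move=> hP hQ p pp; have [_ _ pP] := pp.
have [d [b [f [nd df]]]] := hP p pp; have [e [c [g [ne eg]]]] := hQ p pp.
have lf i : linear (fun x : P * Q => (e : R) * f i x.1 : R^o).
  by move=> a x y; rewrite linearP /= mulrDr /GRing.scale /= mulrCA.
have lg i : linear (fun x : P * Q => (d : R) * g i x.2 : R^o).
  by move=> a x y; rewrite linearP /= mulrDr /GRing.scale /= mulrCA.
exists (d * e), (fun i => match split i with
    inl j => (b j, 0) | inr j => (0, c j) end),
  (fun i => match split i with
    inl j => mk_linear (lf j) | inr j => mk_linear (lg j) end).
split=> [/pP[]//|i l].
have -> : (i == l) = (split i == split l) by rewrite (can_eq (@splitK _ _)).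
case: (split i) => i'; case: (split l) => l' /=; rewrite ?linear0 ?mulr0 //=.
  by rewrite df -[inl _ == _]/(i' == l'); case: ifP; rewrite ?mulr0 // mulrC.
by rewrite eg -[inr _ == _]/(i' == l'); case: ifP; rewrite ?mulr0.
Qed.

Lemma locally_split_regular : locally_split R^o 1.
Proof.
move=> p [_ p1 _]; exists 1, (fun=> 1), (fun=> idfun); split=> // i k.
by rewrite (ord1 i) (ord1 k).
Qed.

(** Quasi-compactness of the spectrum. *)
Lemma unit_combination (D : set R) :
  (forall p, prime_ideal p -> exists d, D d /\ ~ p d) ->
  exists cs : seq (R * R),
    (forall x, x \in cs -> D x.2) /\ 1 = \sum_(x <- cs) x.1 * x.2.
Proof.
move=> hD.
pose K : set R := [set z | exists (cs : seq (R * R)),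
  (forall x, x \in cs -> D x.2) /\ z = \sum_(x <- cs) x.1 * x.2]%classic.
have iK : ideal K.
  split.
  - by exists [::]; split=> [x|]; rewrite ?in_nil ?big_nil.
  - move=> _ _ [cs [h ->]] [cs' [h' ->]]; exists (cs ++ cs'); rewrite big_cat.
    by split=> // x; rewrite mem_cat => /orP[/h|/h'].
  - move=> a _ [cs [h ->]]; exists [seq (a * x.1, x.2) | x <- cs]; split.
      by move=> x /mapP[y ycs ->]; exact: (h y ycs).
    by rewrite big_map mulr_sumr; apply: eq_bigr => x _; rewrite mulrA.
apply: contrapT => nK; have [p [pp Kp]] := ideal_sub_prime iK nK.
have [d [Dd npd]] := hD p pp; apply: npd; apply: Kp; exists [:: (1, d)].
by rewrite big_seq1 mul1r; split=> // x; rewrite inE => /eqP ->.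
Qed.

(** Bass' stable range condition: if [(x, a)] is unimodular, then so is
    [x + a *: y].  Stated with primes it passes from [P] to [P (+) Q]. *)
Definition stable_range P : Prop := forall (x : P) (a : R),
  exists y : P, forall p, prime_ideal p ->
    (forall l : {linear P -> R^o}, p (l (x + a *: y))) -> p a.

Lemma zero_ideal : ideal ([set 0]%classic : set R).
Proof.
by split=> [|x y -> ->|a x ->]; rewrite /= ?addr0 ?mulr0.
Qed.

(** A dual system reduces the claim to Kronecker's theorem on the open set where
    its [d] is invertible; such open sets cover the spectrum, and taking the
    correction divisible by [d] leaves what was done off that set unchanged. *)
Lemma bass P n : locally_split P n -> dim_lt n [set 0]%classic -> stable_range P.
Proof.
move=> hP hd x a.
have local d : (exists b f, @dual_system P n d b f) -> forall (a : R) x, exists y : P,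
    forall p, prime_ideal p -> (forall l : {linear P -> R^o}, p (l (x + a *: y))) -> p (a * d).
  move=> [b [f fb]] a' x'.
  have [z zP] := kronecker (a' * d) (fun i => f i x') zero_ideal hd.
  exists (\sum_i z i *: b i) => p pp h; apply: zP => // [r ->|i].
    by case: pp => [[]].
  suff -> : f i x' + a' * d * z i = f i (x' + a' *: \sum_i z i *: b i) by [].
  rewrite linearD linearZ linear_sum (bigD1 i) //= linearZ /= fb eqxx big1 ?addr0.
    by rewrite /GRing.scale /= -mulrA [d * _]mulrC.
  by move=> k /negPf; rewrite eq_sym linearZ /= fb => ->; rewrite scaler0.
pose D : set R := [set d | exists b f, @dual_system P n d b f]%classic.
have many (ds : seq R) : (forall d, d \in ds -> D d) -> exists y : P,
    forall p, prime_ideal p -> (forall l : {linear P -> R^o}, p (l (x + a *: y))) ->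
      forall d, d \in ds -> p (a * d).
  elim: ds => [|d ds IH] hds; first by exists 0.
  have [|y yP] := IH; first by move=> e eds; apply: hds; rewrite inE eds orbT.
  have [|y' y'P] := local d _ (a * d) (x + a *: y); first by apply: hds; rewrite inE eqxx.
  exists (y + d *: y') => p pp; have [[p0 pD pM] _ pP] := pp.
  rewrite scalerDr addrA scalerA => h.
  have pad : p (a * d).
    by case/pP: (y'P p pp h) => // pd; apply: pM.
  move=> e; rewrite inE => /orP[/eqP -> //|]; apply: yP => // l.
  have := h l; rewrite linearD linearZ /= => hl.
  rewrite -[l _](addrK ((a * d) * l y')) -mulN1r; apply: (pD) => //.
  by apply: (pM); rewrite mulrC; apply: pM.
have [|cs [hcs csE]] := @unit_combination D.
  by move=> p pp; have [d [b [f [nd df]]]] := hP p pp; exists d; split=> //; exists b, f.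
have [|y yP] := many [seq x.2 | x <- cs]; first by move=> _ /mapP[z zcs ->]; apply: hcs.
exists y => p pp h; have [[p0 pD pM] _ _] := pp.
rewrite -[a]mulr1 csE mulr_sumr big_seq.
apply: (big_ind (fun z => p z)) => // z zcs; rewrite mulrCA; apply: pM.
by apply: yP pp h _ _; apply: map_f.
Qed.

End Bass.

(** * Symplectic cancellation *)

Section Cancellation.
Variable R : comPzRingType.
Implicit Types P Q : lmodType R.

Lemma stable_range_prod P Q : stable_range P -> stable_range (P * Q)%type.
Proof.
move=> sr [x z] a; have [y yP] := sr x a; exists (y, 0) => p pp h.
by apply: yP pp _ => l; have := h (l \o fst).
Qed.

Lemma stable_range_iso P Q : lin_iso P Q -> stable_range P -> stable_range Q.
Proof.
move=> k sr x a; have [y yP] := sr (iso_inv k x) a; exists (k y) => p pp h.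
apply: yP pp _ => l.
have := h (l \o mk_linear (iso_inv_linear k)).
by rewrite /= iso_invD iso_invZ isoK.
Qed.

Local Notation H := (R^o * R^o)%type.

Section Transvections.
Variables (P : lmodType R) (chi : alt_form P).

Let om := alt_perp chi (alt_hyp R).

(** [trans1] and [trans2] are the transvections that fix the first and the second
    vector of the hyperbolic plane. *)
Definition trans1 (v : P) (c : R) (z : P * H) : P * H :=
  (z.1 + z.2.2 *: v, (z.2.1 + chi v z.1 + c * z.2.2, z.2.2)).

Definition trans2 (v : P) (c : R) (z : P * H) : P * H :=
  (z.1 + z.2.1 *: v, (z.2.1, z.2.2 - chi v z.1 + c * z.2.1)).

Lemma trans1_isometry v c y z : om (trans1 v c y) (trans1 v c z) = om y z.
Proof.
rewrite /= !formDl !formDr !formZl !formZr formxx (form_anti chi y.1 v).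
ring.
Qed.

Lemma trans2_isometry v c y z : om (trans2 v c y) (trans2 v c z) = om y z.
Proof.
rewrite /= !formDl !formDr !formZl !formZr formxx (form_anti chi y.1 v).
ring.
Qed.

Hypothesis cP : complemented P.

Lemma complemented_regular : complemented R^o.
Proof. exact/complemented_fg_projective/fg_projective_regular. Qed.

Lemma SL_trans1 v c : SL (trans1 v c).
Proof.
have cR := complemented_regular; have cH := complemented_prod cR cR.
have l1 : linear (fun h : H => (h.2 : R) *: v).
  by move=> a x y; rewrite /= scalerDl scalerA.
have [_ cr _] := form_alt chi.
have l2 : linear (fun p : P => (chi v p, 0) : H).
  by move=> a x y; rewrite cr; congr pair; rewrite /= scaler0 addr0.
have l3 : linear (fun x : R^o => c * x : R^o).
  by move=> a x y; rewrite mulrDr /GRing.scale /= mulrCA.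
apply: SL_ext (SL_comp (SL_prodr cP (SL_elem (mk_linear l3) cR cR))
  (SL_comp (SL_elem' (mk_linear l2) cP cH) (SL_elem (mk_linear l1) cP cH))).
case=> p [a b]; rewrite /trans1 /= formDr formZr formxx mulr0 !addr0.
by [].
Qed.

Lemma SL_trans2 v c : SL (trans2 v c).
Proof.
have cR := complemented_regular; have cH := complemented_prod cR cR.
have l1 : linear (fun h : H => (h.1 : R) *: v).
  by move=> a x y; rewrite /= scalerDl scalerA.
have [_ cr _] := form_alt chi.
have l2 : linear (fun p : P => (0, - chi v p) : H).
  by move=> a x y; rewrite cr; congr pair; rewrite /= ?scaler0 ?addr0 // opprD scalerN.
have l3 : linear (fun x : R^o => c * x : R^o).
  by move=> a x y; rewrite mulrDr /GRing.scale /= mulrCA.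
apply: SL_ext (SL_comp (SL_prodr cP (SL_elem' (mk_linear l3) cR cR))
  (SL_comp (SL_elem' (mk_linear l2) cP cH) (SL_elem (mk_linear l1) cP cH))).
case=> p [a b]; rewrite /trans2 /= formDr formZr formxx mulr0 !addr0.
by [].
Qed.

(** Bass' condition makes the first two coordinates unimodular, after which the
    last coordinate can be turned into [1] and used to clear the others. *)
Lemma symplectic_transitive x : stable_range (P * R^o)%type -> unimodular x ->
  exists s, [/\ SL s, forall y z, om (s y) (s z) = om y z & s x = (0, (0, 1))].
Proof.
case: x => p [a b] sr /unimodularP ux.
have [[q c] qc] := sr (p, a) b.
have [l l1] : unimodular ((p + b *: q, a + b * c) : P * R^o).
  apply/unimodularP => m mm h; have [[m0 mD mM] _ _] := mm.
  have mb := qc m mm h; apply: (ux m mm) => k.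
  have lk : linear (fun z : P * R^o => k (z.1, (z.2, 0))).
    move=> t y z; rewrite -linearP; congr (k (_, _)); congr pair.
    by rewrite /= scaler0 addr0.
  have := h (mk_linear lk) => /= h1.
  have -> : ((p, (a, b)) : P * H) =
     (p + b *: q, (a + b * c, 0)) - b *: (q, ((c : R^o), 0)) + b *: (0, (0, 1 : R^o)).
    congr pair; first by rewrite /= scaler0 addr0 addrK.
    congr pair; rewrite /= /GRing.scale /=; ring.
  rewrite linearD linearB !linearZ /= /GRing.scale /= -mulN1r.
  apply: (mD); last by rewrite mulrC; apply: mM.
  by apply: (mD) => //; rewrite mulrC; apply: mM.
set p1 := p + b *: q in l1; pose a1 : R := a + chi q p + c * b.
have lt1 : trans1 q c (p, (a, b)) = (p1, (a1, b)) by [].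
have [_ cr _] := form_alt chi.
have ll : linear (fun z : P * R^o => l (z.1, z.2 - chi q z.1)).
  move=> t y z; rewrite -linearP; congr (l (_, _)); rewrite /= cr.
  by rewrite /GRing.scale /=; ring.
pose l' := mk_linear ll.
have l'1 : l' (p1, a1) = 1.
  rewrite -l1 /=; congr (l (_, _)).
  rewrite /a1 /p1 formDr formZr formxx; ring.
have lE y r : l' (y, r) = l' (y, 0) + r * l' (0, 1).
  rewrite -linearZ -linearD; congr (l' (_, _)); rewrite /= ?scaler0 ?addr0 //.
  by rewrite /GRing.scale /= mulr1 add0r.
have lw : linear (fun y : P => (b - 1) * l' (y, 0) : R^o).
  move=> t y z; have -> : ((t *: y + z, 0) : P * R^o) = t *: (y, 0) + (z, 0).
    by congr pair; rewrite /= scaler0 addr0.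
  by rewrite linearP /= mulrDr /GRing.scale /= mulrCA.
have [w [wE _]] := form_nondeg chi (mk_linear lw).
pose mu : R := (1 - b) * l' (0, 1).
pose p2 := p1 + a1 *: w.
have lt2 : trans2 w mu (p1, (a1, b)) = (p2, (a1, 1)).
  congr pair; congr pair; rewrite /= wE /=.
  transitivity (b + (1 - b) * l' (p1, a1)); last by rewrite l'1; ring.
  by rewrite lE /mu /=; ring.
exists (trans1 (- p2) (- a1) \o (trans2 w mu \o trans1 q c)); split.
- by apply: SL_comp (SL_trans1 _ _) (SL_comp (SL_trans2 _ _) (SL_trans1 _ _)).
- by move=> y z; rewrite trans1_isometry trans2_isometry trans1_isometry.
rewrite /comp lt1 lt2 /trans1 /=; congr pair; first by rewrite scale1r subrr.
by congr pair; rewrite formNl formxx oppr0 addr0 mulr1 subrr.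
Qed.

End Transvections.

(** By transitivity the isometry may be assumed to fix the second vector [f] of
    the hyperbolic plane.  It then acts on the orthogonal of [f] modulo [f], which
    is [P]. *)
Lemma hyp_cancel P (chi chi' : alt_form P) : complemented P ->
  stable_range (P * R^o)%type ->
  SLiso (perp chi' (alt_hyp R)) (perp chi (alt_hyp R)) -> SLiso chi' chi.
Proof.
move=> cP sr [b [Sb bE]].
pose f : P * H := (0, (0, 1)).
have [[lb [b' bK b'K]] _] := Sb.
have lb' := inv_linear lb bK b'K.
have uf : unimodular (b f).
  have lu : linear (fun z => (b' z).2.2 : R^o) by move=> a x y; rewrite lb'.
  by exists (mk_linear lu) => /=; rewrite bK.
have [s [Ss sE sf]] := symplectic_transitive chi' cP sr uf.
have Sg := SL_comp Ss Sb.
pose g := s \o b; rewrite -/g in Sg.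
have gf : g f = f by [].
have gE x y : perp chi' (alt_hyp R) (g x) (g y) = perp chi (alt_hyp R) x y.
  by rewrite -bE; apply: sE.
have [[lg [g' gK g'K]] _] := Sg.
have lg' := inv_linear lg gK g'K.
have g'f : g' f = f by rewrite -{1}gf gK.
have g'E x y : perp chi (alt_hyp R) (g' x) (g' y) = perp chi' (alt_hyp R) x y.
  by rewrite -gE !g'K.
have perpf c z : perp (form (c : alt_form P)) (alt_hyp R) z f = z.2.1.
  by rewrite /perp /= form0r; ring.
have g21 z : (g z).2.1 = z.2.1.
  by have := gE z f; rewrite gf !perpf.
have g'21 z : (g' z).2.1 = z.2.1.
  by have := g'E z f; rewrite g'f !perpf.
(* on [P], both maps are given by their first component, modulo [f] *)
have key (k k' : P * H -> P * H) : linear k -> linear k' -> cancel k k' -> k' f = f ->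
    (forall z, (k z).2.1 = z.2.1) -> forall p, (k' ((k (p, 0)).1, 0)).1 = p.
  move=> lk lk' kK k'f k21 p.
  have e : k (p, 0) = (k (p, 0)).2.2 *: f + ((k (p, 0)).1, 0).
    have := k21 (p, 0); case: (k (p, 0)) => x [y1 y2] /= ->.
    congr pair; first by rewrite /= scaler0 add0r.
    congr pair; rewrite /= /GRing.scale /=; ring.
  have := kK (p, 0); rewrite {1}e lk' k'f => /(congr1 fst) /=.
  by rewrite scaler0 add0r.
pose h p := (g (p, 0)).1; pose h' p := (g' (p, 0)).1.
have hK : cancel h h' by move=> p; apply: key.
have h'K : cancel h' h by move=> p; apply: key.
have lh : linear h.
  move=> a x y; rewrite /h.
  have -> : ((a *: x + y, 0) : P * H) = a *: (x, 0) + (y, 0).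
    by congr pair; rewrite /= scaler0 addr0.
  by rewrite lg.
exists h; split; last first.
  move=> x y; have := gE (x, 0) (y, 0); rewrite /perp /= !g21 /=.
  by rewrite !mul0r !mulr0 subr0 !addr0.
have cR := complemented_regular; have cH := complemented_prod cR cR.
apply: (SL_unprodl (N := H) lh); first by exists h'.
pose e : P * H := (0, (1, 0)).
(* the columns of [g] other than [h] are cleared by elementary maps *)
have gdec z : g z = g (z.1, 0) + z.2.1 *: g e + z.2.2 *: f.
  rewrite -{1}gf -(linearZ_LR (mk_linear lg)) /= -(linearZ_LR (mk_linear lg)) /=.
  rewrite -(raddfD (mk_linear lg)) /= -(raddfD (mk_linear lg)) /=; congr g.
  case: z => p [a c]; congr pair; first by rewrite /= !scaler0 !addr0.
  by congr pair; rewrite /= /GRing.scale /=; ring.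
have l1 : linear (fun h : H => - ((h.1 : R) *: (g e).1)).
  by move=> a x y; rewrite /= scalerDl opprD scalerN scalerA.
have l2 : linear (fun x : R^o => - (x * (g e).2.2) : R^o).
  by move=> a x y; rewrite mulrDl opprD /GRing.scale /=; ring.
have l3 : linear (fun p : P => (0, - (g (h' p, 0)).2.2) : H).
  have lh' := inv_linear lh hK h'K.
  move=> a x y; rewrite lh'.
  have -> : ((a *: h' x + h' y, 0) : P * H) = a *: (h' x, 0) + (h' y, 0).
    by congr pair; rewrite /= scaler0 addr0.
  rewrite lg; congr pair; rewrite /= ?scaler0 ?addr0 //.
  by rewrite opprD scalerN.
apply: SL_ext (SL_comp (SL_elem' (mk_linear l3) cP cH)
  (SL_comp (SL_prodr cP (SL_elem' (mk_linear l2) cR cR))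
  (SL_comp (SL_elem (mk_linear l1) cP cH) Sg))) => -[p [a c]] /=.
rewrite g21 /=.
have -> : (g (p, (a, c))).1 - a *: (g e).1 = h p.
  by rewrite gdec /= scaler0 addr0 addrK.
congr pair; congr pair; rewrite /= ?addr0 //.
by rewrite hK gdec /= /GRing.scale /=; ring.
Qed.

End Cancellation.

(** * Classes in V_SL: cancellation and the Pfaffian *)

Section Classes.
Variable R : comPzRingType.
Implicit Types P Q : lmodType R.

Lemma class_of_eq (T : Type) (e : T -> T -> Prop) x y :
  e y y -> class_of e x = class_of e y -> e x y.
Proof. by move=> eyy /(congr1 sval) /= ->. Qed.

Lemma eq_class_of (T : Type) (e : T -> T -> Prop) x y :
  (forall z, e x z <-> e y z) -> class_of e x = class_of e y.
Proof.
move=> h; apply: eq_exist; apply/funext => z; exact/propext/h.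
Qed.

Lemma V_class_eq P P' (hP : fg_projective P) (hP' : fg_projective P')
    (f0 f1 : alt_form P) (g0 g1 : alt_form P') :
  V_class hP f0 f1 = V_class hP' g0 g1 <->
  V_rel (V_gen (Triple hP f0 f1)) (V_gen (Triple hP' g0 g1)).
Proof.
split=> [|h]; first by apply: class_of_eq; apply: V_refl.
apply: eq_class_of => z; split; apply: V_trans => //; exact: V_sym.
Qed.

Definition iso_row2 : lin_iso (R^o * R^o)%type 'rV[R]_2.
Proof.
apply: (@iso_of _ _ _ _ (@row2_linear R) (fun v => (v 0 0, v 0 1))).
  by case=> x y; rewrite !mxE.
move=> v; apply/rowP => i; rewrite !mxE; case: eqP => [-> //|i0].
have -> // : i = 1; apply: val_inj; move: i0.
by case: i => [[|[|//]]] // h [] //; apply: val_inj.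
Defined.

Lemma psi_cancel P l (chi chi' : alt_form P) : complemented P ->
  stable_range (P * R^o)%type ->
  SLiso (perp chi' (Psi R l)) (perp chi (Psi R l)) -> SLiso chi' chi.
Proof.
move=> cP sr; elim: l => [|l IH] iso.
  apply: (SLiso_iso (h := iso_sym (iso_unit_row P)) iso) => x y;
  by rewrite /perp [X in _ + X]form0l addr0.
apply: IH; have cW := complemented_prod cP (complemented_row R l.*2).
apply: (@hyp_cancel _ _ (alt_perp chi (Psi R l)) (alt_perp chi' (Psi R l)) cW).
  apply: (stable_range_iso _ (stable_range_prod (Q := 'rV[R]_l.*2) sr)).
  apply: iso_trans (iso_assoc _ _ _) (iso_trans _ (iso_sym (iso_assoc _ _ _))).
  exact: iso_prod (iso_id _) (iso_swap _ _).
pose h : lin_iso ((P * 'rV[R]_l.*2) * (R^o * R^o))%type (P * 'rV[R]_l.+1.*2)%type :=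
  iso_trans (iso_assoc _ _ _) (iso_prod (iso_id P)
    (iso_trans (iso_swap _ _) (iso_trans (iso_prod iso_row2 (iso_id _)) (iso_row R 2 l.*2)))).
have hE (c : alt_form P) x y : perp (alt_perp c (Psi R l)) (alt_hyp R) x y =
    perp c (Psi R l.+1) (h x) (h y).
  case: x y => [[p b] e] [[p' b'] e'].
  change (c p p' + Psi R l b b' + alt_hyp R e e' =
    c p p' + Psi R l.+1 (row_mx (row2 e) b) (row_mx (row2 e') b')).
  by rewrite Psi_row2 -addrA [Psi R l b b' + _]addrC.
exact: SLiso_iso iso (hE chi') (hE chi).
Qed.

(** The common summand of a stable equality becomes hyperbolic, and its planes
    are cancelled one at a time. *)
Lemma V_class_cancel P (hP : fg_projective P) (f chi chi' : alt_form P) :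
  stable_range (P * R^o)%type ->
  V_class hP f chi = V_class hP f chi' -> SLiso chi' chi.
Proof.
move=> sr /V_class_eq /V_rel_stably_eq[Q [hQ [q]]] /= iso.
have cP := complemented_fg_projective hP.
have cQ := complemented_fg_projective hQ.
have [l h] : exists l, SLiso (perp chi' (Psi R l)) (perp chi (Psi R l)).
  apply: (@hyp_stabilize _ P (P * Q)%type (alt_perp f q)).
    exact: fg_projective_prod.
  have h1 : SLiso (perp (perp f chi') q) (perp (perp f chi) q).
    apply: SLiso_trans iso _; apply: (@SLiso_prod _ _ _ (perp chi f) (perp f chi)).
      by apply: (SLiso_perp_swap (k := iso_id P)) => //; apply: formNN.
    exact: SLiso_refl.
  apply: (SLiso_iso (h := iso_trans (iso_sym (iso_assoc P P Q))
    (iso_prod (iso_swap P P) (iso_id Q))) h1) => x y;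
  by rewrite /perp /= addrA; congr (_ + _); exact: addrC.
exact: psi_cancel h.
Qed.

Definition pf n k (F : 'rV[R]_n -> 'rV[R]_n -> R) : R :=
  pfs k F (map (delta_mx 0) (enum 'I_n)).

Definition bilinear_alt (U : lmodType R) (F : U -> U -> R) : Prop :=
  [/\ forall z a x y, F z (a *: x + y) = a * F z x + F z y,
      forall z a x y, F (a *: x + y) z = a * F x z + F y z &
      forall x, F x x = 0].

Lemma eq_pf n k (F F' : 'rV[R]_n -> 'rV[R]_n -> R) :
  (forall x y, F x y = F' x y) -> pf k F = pf k F'.
Proof. exact: eq_pfs. Qed.

(** The Pfaffian is multilinear and alternating as a function of the basis. *)
Lemma pf_det n k (F : 'rV[R]_n -> 'rV[R]_n -> R) (A : 'M[R]_n) : bilinear_alt F ->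
  pf k (fun x y => F (x *m A) (y *m A)) = \det A * pf k F.
Proof.
move=> [Fr Fl F0]; rewrite /pf -(pfs_map (fun x => x *m A)) -map_comp.
have -> : map ((fun x => x *m A) \o delta_mx 0) (enum 'I_n) =
    map (fun i => row i A) (enum 'I_n).
  by apply: eq_map => i /=; rewrite rowE.
apply: multilinear_alternating_det; first exact: pfs_multilinear.
exact: pfs_alternating.
Qed.

Lemma pf_SL n k (F G : 'rV[R]_n -> 'rV[R]_n -> R) : bilinear_alt F ->
  SLiso F G -> pf k F = pf k G.
Proof.
move=> bF [a [Sa aE]]; have [A [hA dA]] := SL_mx Sa (iso_unit_row 'rV[R]_n).
rewrite -(@eq_pf n k (fun x y => F (x *m A) (y *m A)) G).
  by rewrite pf_det // dA mul1r.
move=> x y; rewrite -aE.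
have aA z : a z = z *m A by have := hA z 0.
by rewrite !aA.
Qed.

Lemma pf_perp k l n (F : 'rV[R]_k.*2 -> 'rV[R]_k.*2 -> R) (G : 'rV[R]_n -> 'rV[R]_n -> R) :
  (forall x, F x 0 = 0) -> (forall y, G 0 y = 0) ->
  (forall y, F 0 y = 0) -> (forall x, G x 0 = 0) ->
  @pf (k.*2 + n) (k + l) (fun x y => F (lsubmx x) (lsubmx y) + G (rsubmx x) (rsubmx y)) =
  pf k F * pf l G.
Proof.
move=> Fx0 G0y F0y Gx0; rewrite /pf map_enum_split.
set w := (X in pfs _ X _).
have -> : map (delta_mx 0 \o @lshift k.*2 n) (enum 'I_k.*2) =
    map (fun x : 'rV[R]_k.*2 => row_mx x (0 : 'rV[R]_n)) (map (delta_mx 0) (enum 'I_k.*2)).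
  by rewrite -[RHS]map_comp; apply: eq_map => i /=; rewrite delta_mx_lshift.
have -> : map (delta_mx 0 \o @rshift k.*2 n) (enum 'I_n) =
    map (fun x : 'rV[R]_n => row_mx (0 : 'rV[R]_k.*2) x) (map (delta_mx 0) (enum 'I_n)).
  by rewrite -[RHS]map_comp; apply: eq_map => i /=; rewrite delta_mx_rshift.
rewrite pfs_cat.
- rewrite !pfs_map; congr (_ * _); apply: eq_pfs => x y;
    by rewrite /w !row_mxKl !row_mxKr ?Fx0 ?G0y ?addr0 ?add0r.
- by rewrite size_map size_map size_enum_ord.
move=> x y /mapP[x' _ ->] /mapP[y' _ ->]; rewrite /w.
by rewrite !row_mxKl !row_mxKr Fx0 G0y addr0.
Qed.

Lemma pfaffian_pf m (M : 'M[R]_m.*2) (hM : alt_inv_mx M) :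
  pfaffian M = pf m (alt_mx hM).
Proof.
rewrite pfaffianE /pf [RHS]pfs_map; apply: eq_pfs => i j /=.
by rewrite -rowE trmx_delta -colE !mxE.
Qed.

Definition det2 (u v : 'rV[R]_2) : R := u 0 0 * v 0 1 - u 0 1 * v 0 0.

Lemma pf_det2 : pf 1 det2 = 1.
Proof.
rewrite /pf enum_ordSl enum_ordSl (size0nil (size_enum_ord 0)) /= /det2 !mxE /=.
by rewrite mulr1 mulr0 !subr0 mulr1.
Qed.

Lemma Psi_split m (x y : 'rV[R]_(2 + m.*2)) :
  Psi R m.+1 x y = det2 (lsubmx x) (lsubmx y) + Psi R m (rsubmx x) (rsubmx y).
Proof.
have rE (u : 'rV[R]_2) : row2 (u 0 0, u 0 1) = u by exact: (isoVK iso_row2 u).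
rewrite -{1}(hsubmxK x) -{1}(hsubmxK y) -{1}(rE (lsubmx x)) -{1}(rE (lsubmx y)).
exact: Psi_row2.
Qed.

Lemma pf_Psi m : pf m (Psi R m) = 1.
Proof.
elim: m => [|m IH]; first by rewrite /pf (size0nil (size_enum_ord 0)).
have h := @pf_perp 1 m m.*2 det2 (Psi R m).
have d0r (u : 'rV_2) : det2 u 0 = 0 by rewrite /det2 !mxE !mulr0 subr0.
have d0l (u : 'rV_2) : det2 0 u = 0 by rewrite /det2 !mxE !mul0r subr0.
have {}h := h d0r (form0l _) d0l (form0r _).
rewrite pf_det2 IH mulr1 in h; rewrite -[RHS]h.
apply: eq_pf => x y; exact: Psi_split.
Qed.

(** Equal classes give a special isometry of stabilizations, which preserves the
    Pfaffian; the reference forms contribute the factor 1. *)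
Lemma V_class_pfaffian m k (M : 'M[R]_m.*2) (N : 'M[R]_k.*2)
    (hM : alt_inv_mx M) (hN : alt_inv_mx N) :
  V_class (fg_projective_rV R m.*2) (Psi R m) (alt_mx hM) =
  V_class (fg_projective_rV R k.*2) (Psi R k) (alt_mx hN) ->
  pfaffian M = pfaffian N.
Proof.
move=> /V_class_eq /V_rel_stably_eq[Q [hQ [q]]] /= iso.
have [l] := @hyp_stabilize _ ('rV[R]_m.*2 * 'rV[R]_k.*2)%type Q q
  (alt_perp (alt_mx hM) (Psi R k)) (alt_perp (Psi R m) (alt_mx hN)) hQ iso.
move=> {}iso.
pose F (f : alt_form 'rV[R]_m.*2) (g : alt_form 'rV[R]_k.*2)
    (x y : 'rV[R]_(m.*2 + (k.*2 + l.*2))) : R :=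
  f (lsubmx x) (lsubmx y) +
  (g (lsubmx (rsubmx x)) (lsubmx (rsubmx y)) +
   Psi R l (rsubmx (rsubmx x)) (rsubmx (rsubmx y))).
have pfF f g : pf (m + (k + l)) (F f g) = pf m f * pf k g.
  rewrite /F (@pf_perp m (k + l) (k.*2 + l.*2) f
    (fun x y => g (lsubmx x) (lsubmx y) + Psi R l (rsubmx x) (rsubmx y)));
    try by move=> x; rewrite ?linear0 ?form0l ?form0r ?addr0.
  rewrite (@pf_perp k l l.*2 g (Psi R l)); try by move=> x; rewrite ?form0l ?form0r.
  by rewrite pf_Psi mulr1.
have bF f g : bilinear_alt (F f g).
  rewrite /F; move: (Psi R l) => c.
  split=> *; rewrite ?linearP /= ?formDl ?formDr ?formZl ?formZr ?formxx; ring.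
have : SLiso (F (Psi R m) (alt_mx hN)) (F (alt_mx hM) (Psi R k)).
  apply: (SLiso_iso (h := iso_sym (iso_trans (iso_assoc _ _ _) (iso_trans
    (iso_prod (iso_id _) (iso_row R k.*2 l.*2)) (iso_row R m.*2 _)))) iso) => x y;
  by rewrite /F /perp /= addrA.
move/(@pf_SL _ (m + (k + l)) _ _ (bF _ _)); rewrite !pfF !pf_Psi mul1r mulr1.
by rewrite -!pfaffian_pf => ->.
Qed.

End Classes.

(** * Alternating forms on P_4 *)

Section MatrixOfForm.
Variable R : comPzRingType.
Implicit Types P Q : lmodType R.

(** The vectors that represent the coordinate functionals are the rows of the
    inverse of the Gram matrix. *)
Lemma bilinear_mx n (F : 'rV[R]_n -> 'rV[R]_n -> R) : bilinear_alt F ->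
  (forall k : {linear 'rV[R]_n -> R^o}, exists u, F u =1 k) ->
  exists (M : 'M[R]_n) (hM : alt_inv_mx M), forall u v, alt_mx hM u v = F u v.
Proof.
move=> [Fr Fl F0] Fsurj.
pose M : 'M[R]_n := \matrix_(i, j) F (delta_mx 0 i) (delta_mx 0 j).
have ME u v : (u *m M *m v^T) 0 0 = F u v.
  have lr : linear (F u : _ -> R^o) by move=> a x y; apply: Fr.
  rewrite [in RHS](row_sum_delta v) [RHS](linear_sum (mk_linear lr)) mxE.
  apply: eq_bigr => j _; rewrite [RHS](linearZ_LR (mk_linear lr)) /= !mxE mulrC.
  congr (_ * _).
  have ll : linear (fun u => F u (delta_mx 0 j) : R^o) by move=> a x y; apply: Fl.
  rewrite [in RHS](row_sum_delta u) [RHS](linear_sum (mk_linear ll)).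
  by apply: eq_bigr => i _; rewrite [RHS](linearZ_LR (mk_linear ll)) /= !mxE.
have Fanti x y : F x y = - F y x.
  have Fl1 u v z : F (u + v) z = F u z + F v z by have := Fl z 1 u v; rewrite scale1r mul1r.
  have Fr1 u v z : F z (u + v) = F z u + F z v by have := Fr z 1 u v; rewrite scale1r mul1r.
  have := F0 (x + y); rewrite Fl1 !Fr1 !F0 add0r addr0 => /eqP.
  by rewrite addr_eq0 => /eqP.
have MT : M^T = - M by apply/matrixP => i j; rewrite !mxE Fanti.
have /choice[p pE] : forall i : 'I_n, exists u, F u =1 (fun v => v 0 i).
  move=> i; have li : linear (fun v : 'rV[R]_n => v 0 i : R^o).
    by move=> a x y; rewrite !mxE.
  exact: (Fsurj (mk_linear li)).
pose N : 'M[R]_n := \matrix_i p i.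
have NM : N *m M = 1%:M.
  apply/matrixP => i j.
  have -> : (N *m M) i j = (p i *m M *m (delta_mx 0 j : 'rV_n)^T) 0 0.
    by rewrite trmx_delta -colE !mxE; apply: eq_bigr => k _; rewrite [N i k]mxE.
  by rewrite ME pE !mxE eqxx.
have MN : M *m (- N^T) = 1%:M.
  by rewrite mulmxN -mulNmx -MT -trmx_mul NM trmx1.
have e : - N^T = N by rewrite -[LHS]mul1mx -NM -mulmxA MN mulmx1.
have hM : alt_inv_mx M.
  split=> // [i|]; first by rewrite mxE.
  by exists N; split=> //; rewrite -{1}e.
by exists M, hM.
Qed.

(** If [j] embeds [(P, f)] into [(R^2m, psi_2m)] with adjoint [pi], replacing
    [f] by [g] on the image of [j] changes [psi_2m] into a matrix form that has
    the class of [(P, f, g)]: the signed exchange of [P] with its image in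
    [P (+) R^2m] carries [g _|_ psi_2m] to [f _|_ M]. *)
Lemma V_class_matrix P (hP : fg_projective P) (f g : alt_form P) m
    (j : {linear P -> 'rV[R]_m.*2}) (pi : {linear 'rV[R]_m.*2 -> P}) :
  (forall x y, Psi R m (j x) (j y) = f x y) ->
  (forall w x, f (pi w) x = Psi R m w (j x)) ->
  exists (M : 'M[R]_m.*2) (hM : alt_inv_mx M),
    (forall u v, alt_mx hM u v = Psi R m u v + (g (pi u) (pi v) - f (pi u) (pi v))) /\
    V_class hP f g = V_class (fg_projective_rV R m.*2) (Psi R m) (alt_mx hM).
Proof.
move=> jE piE.
have jK : cancel j pi.
  by move=> x; apply: (form_inj (f := f)) => y; rewrite piE jE.
pose F u v := Psi R m u v + (g (pi u) (pi v) - f (pi u) (pi v)).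
have [||M [hM ME]] := @bilinear_mx _ F.
- rewrite /F; move: (Psi R m) => c.
  split=> *; rewrite ?linearP ?formDl ?formDr ?formZl ?formZr ?formxx; ring.
- move=> k; have [p [pE _]] := form_nondeg g (k \o j).
  have [v [vE _]] := form_nondeg (Psi R m) k.
  exists (j p + (v - j (pi v))) => w.
  have pip : pi (j p + (v - j (pi v))) = p by rewrite linearD linearB !jK subrr addr0.
  have jA y z : Psi R m (j y) z = f y (pi z) by rewrite form_anti -piE -form_anti.
  rewrite /F pip pE !formDl formNl !jA vE (piE v) vE /=; ring.
exists M, hM; split=> //.
have cP := complemented_fg_projective hP; have cW := complemented_row R m.*2.
have lN : linear (fun w => - pi w) by move=> a x y; rewrite linearP opprD scalerN.
have Sth := SL_comp (SL_elem' j cP cW) (SL_comp (SL_elem (mk_linear lN) cP cW) (SL_elem' j cP cW)).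
set th := (X in SL X) in Sth.
have thE p w : th (p, w) = (- pi w, w + j p - j (pi w)).
  rewrite /th /= linearD jK opprD addrCA subrr addr0; congr pair.
  by rewrite linearN.
apply/V_class_eq.
pose hW := fg_projective_prod hP (fg_projective_rV R m.*2).
have e1 : V_rel (V_gen (Triple hW (alt_perp f (Psi R m)) (alt_perp g (Psi R m))))
                (V_gen (Triple hW (alt_perp f (Psi R m)) (alt_perp f (alt_mx hM)))).
  apply: V_SLinv Sth _ => -[p w] [p' w']; rewrite !thE.
  change (f p p' + alt_mx hM w w' = g (- pi w) (- pi w') +
    Psi R m (w + j p - j (pi w)) (w' + j p' - j (pi w'))).
  rewrite ME /F formNN !formBl !formDl !formBr !formDr !jE -!piE.
  have jA y z : Psi R m (j y) z = f y (pi z) by rewrite form_anti -piE -form_anti.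
  rewrite !jA; ring.
have zero P' (hP' : fg_projective P') (c : alt_form P') : V_rel (V_gen (Triple hP' c c)) (V_zero R).
  set x := V_gen _.
  have h : V_rel (V_add x x) x by apply: V_chain.
  apply: V_trans (V_sym (V_add0 x)) _.
  apply: V_trans (V_addc (V_sym (V_addN x)) (V_refl x)) _.
  apply: V_trans (V_sym (V_addA _ _ _)) _.
  apply: V_trans (V_addc (V_refl _) h) _; exact: V_addN.
have addz x z : V_rel z (V_zero R) -> V_rel (V_add x z) x.
  move=> hz; apply: V_trans (V_addC _ _) _.
  apply: V_trans (V_addc hz (V_refl x)) _; exact: V_add0.
apply: V_trans (V_sym (addz _ _ (zero _ (fg_projective_rV R m.*2) (Psi R m)))) _.
apply: V_trans (V_sym (V_perp _ _ _ _ _ _)) _.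
apply: V_trans e1 _.
apply: V_trans (V_perp _ _ _ _ _ _) _.
apply: V_trans (V_addC _ _) _.
exact: (addz _ _ (zero _ hP f)).
Qed.

(** Here [e] is the determinant of [A]; by [A \o B = d] it is invertible wherever
    [d] is. *)
Lemma pfs_endo (W : lmodType R) n (k : lin_iso W 'rV[R]_n) (A B : W -> W) d :
  linear A -> linear B -> (forall x, A (B x) = d *: x) ->
  exists e e', e * e' = d ^+ n /\ forall l (F : W -> W -> R), bilinear_alt F ->
    let bas := map (iso_inv k \o delta_mx 0) (enum 'I_n) in
    pfs l (fun x y => F (A x) (A y)) bas = e * pfs l F bas.
Proof.
move=> lA lB AB.
have mxof (C : W -> W) : linear C -> exists M, forall v, k (C (iso_inv k v)) = v *m M.
  move=> lC; apply: lin_mxP => a x y.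
  by rewrite (iso_inv_linear k) lC linearP.
have [M ME] := mxof A lA; have [N NE] := mxof B lB.
exists (\det M), (\det N); split.
  rewrite mulrC -det_mulmx -det_scalar; congr (\det _); apply: mulmx_rVP => v.
  by rewrite mulmxA -NE -ME isoK AB linearZ isoVK mul_mx_scalar.
move=> l F [Fr Fl F0] /=.
rewrite map_comp [LHS]pfs_map [in RHS]pfs_map.
rewrite -[pfs l _ _ in RHS]/(pf l (fun x y => F (iso_inv k x) (iso_inv k y))) -pf_det.
  apply: eq_pfs => x y; rewrite -!ME !isoK //.
split=> *; rewrite ?iso_invD ?iso_invZ //.
Qed.

End MatrixOfForm.

(** * The forms on P_4 with Pfaffian 1 *)

Section Chi0Facts.
Variable R : comPzRingType.
Variables (P : lmodType R) (rk2 : constant_rank P 2).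
Variables (L : exterior_square P) (theta : lin_iso R^o L).

(** The exterior square classifies alternating maps, and it is free on [theta 1]. *)
Lemma chi0_multiple (f : P -> P -> R^o) : alternating_map f ->
  exists r : R, forall p q, f p q = r * chi0 rk2 theta p q.
Proof.
move=> /(wedge_univ L)[g [gE _]]; exists (g (theta 1)) => p q.
rewrite -gE -[in LHS](isoVK theta (wedge L p q)) mulrC -[RHS]linearZ /=.
rewrite -[in RHS]linearZ; congr (g (theta _)).
by rewrite /GRing.scale /= mulr1.
Qed.

End Chi0Facts.

Section Forms4.
Variable R : comPzRingType.
Variables (P0 : lmodType R) (c : alt_form P0).

Definition pair3 (a b : P3 P0) : R := c a.1 b.1 + a.2 * b.2.

Definition vol3 (b x y : P3 P0) : R :=
  b.2 * c x.1 y.1 + (c b.1 x.1 * y.2 - c b.1 y.1 * x.2).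

Definition to3 (x : P4 P0) : P3 P0 := (x.1, x.2.1).

(** The alternating forms on [P_0 (+) R e_3 (+) R e_4]: pairing with [e_4] is the
    functional given by [a], and [b] spans the radical on [P_0 (+) R e_3].  Its
    Pfaffian is [pair3 a b]. *)
Definition form4 (a b : P3 P0) (x y : P4 P0) : R^o :=
  vol3 b (to3 x) (to3 y) + (pair3 a (to3 x) * y.2.2 - pair3 a (to3 y) * x.2.2).

Hypothesis jacobi : forall p q r, c p q *: r + c q r *: p + c r p *: q = 0.

Lemma jacobi_form s p q r : c p q * c s r + c q r * c s p + c r p * c s q = 0.
Proof. by have := congr1 (c s) (jacobi p q r); rewrite !formDr !formZr form0r. Qed.

Lemma form4_alt a b : alternating_map (form4 a b).
Proof.
split=> [y t x x'|x t y y'|x]; rewrite /form4 /vol3 /pair3 /to3 /=.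
- rewrite !formDl !formDr !formZl !formZr /GRing.scale /=; ring.
- rewrite !formDr !formZr /GRing.scale /=; ring.
- rewrite !formxx; ring.
Qed.

(** The inverse is the form with the roles of [a] and [b] exchanged. *)
Lemma form4_onto a b : pair3 a b = 1 ->
  forall k : {linear P4 P0 -> R^o}, exists x, form4 a b x =1 k.
Proof.
move=> ab k.
have lk0 : linear (fun y : P0 => k (y, 0)).
  move=> t x y; rewrite -linearP; congr (k (_, _)).
  by rewrite /= scaler0 addr0.
have [kap [kapE _]] := form_nondeg c (mk_linear lk0).
pose k3 : R := k (0, (1, 0)); pose k4 : R := k (0, (0, 1)).
have kE y : k y = c kap y.1 + k3 * y.2.1 + k4 * y.2.2.
  rewrite kapE /=.
  have {1}-> : y = ((y.1, 0) : P4 P0) + (y.2.1 : R) *: ((0, (1, 0)) : P4 P0) +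
      (y.2.2 : R) *: ((0, (0, 1)) : P4 P0).
    case: y => p [r s]; congr pair; first by rewrite /= !scaler0 !addr0.
    by congr pair; rewrite /= /GRing.scale /=; ring.
  by rewrite !linearD !linearZ /= /GRing.scale /= ![_ * k _]mulrC.
pose al := a.1; pose a3 : R := a.2; pose b0 := b.1; pose b3 : R := b.2.
have ab' : c al b0 + a3 * b3 = 1 by [].
pose x : P4 P0 := (a3 *: kap + k4 *: b0 - k3 *: al,
  ((b3 * k4 - c al kap : R), (c b0 kap - b3 * k3 : R))).
exists x.
move=> y; rewrite kE /form4 /vol3 /pair3 /to3 /= -/al -/a3 -/b0 -/b3.
  rewrite !formBl !formBr !formDl !formDr !formZl !formZr !formxx (form_anti c b0 al).
  have J := jacobi_form y.1 al kap b0.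
  rewrite [c y.1 al]form_anti [c y.1 kap]form_anti [c y.1 b0]form_anti
    (form_anti c kap b0) (form_anti c b0 al) in J.
  have -> : c kap y.1 + k3 * y.2.1 + k4 * y.2.2 =
    (c al b0 + a3 * b3) * (c kap y.1 + k3 * y.2.1 + k4 * y.2.2) by rewrite ab' mul1r.
  by apply: subr0_eq; rewrite -[RHS]oppr0 -[in RHS]J; ring.
Qed.

Lemma form4_nondeg a b : pair3 a b = 1 ->
  forall k : {linear P4 P0 -> R^o}, exists! x, form4 a b x =1 k.
Proof.
move=> ab k; have [x xE] := form4_onto ab k; exists x; split=> // x' x'E.
have [fl fr _] := form4_alt a b; have anti := alternatingN (form4_alt a b).
apply/eqP; rewrite -subr_eq0; apply/eqP; set d := x - x'.
have d0 y : form4 a b d y = 0.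
  have -> : d = (-1) *: x' + x by rewrite scaleN1r addrC.
  by rewrite fl xE x'E scaleN1r addNr.
(* the reference form represents the same functionals *)
apply: (form_inj (f := alt_perp c (alt_hyp R))) => y.
rewrite [RHS]form0l form_anti.
have [_ gr _] := form_alt (alt_perp c (alt_hyp R)).
have [z zE] := form4_onto ab (mk_linear (gr y)).
by have /= <- := zE d; rewrite anti d0 !oppr0.
Qed.

Definition alt_form4 a b (ab : pair3 a b = 1) : alt_form (P4 P0) :=
  AltForm (form4_alt a b) (form4_nondeg ab).

Hypothesis multiple : forall f : P0 -> P0 -> R^o, alternating_map f ->
  exists r : R, forall p q, f p q = r * c p q.

Lemma form4_complete (chi : alt_form (P4 P0)) :
  exists a b, forall x y, chi x y = form4 a b x y.
Proof.
pose i0 (p : P0) : P4 P0 := (p, 0).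
pose e3 : P4 P0 := (0, (1, 0)); pose e4 : P4 P0 := (0, (0, 1)).
have [cl cr c0] := form_alt chi.
have li t p q : i0 (t *: p + q) = t *: i0 p + i0 q.
  by congr pair; rewrite /= scaler0 addr0.
have [|r rE] := multiple (f := fun p q => chi (i0 p) (i0 q)).
  by split=> [q t x y|p t x y|p]; rewrite ?li ?cl ?cr.
have l3 : linear (fun p => chi (i0 p) e3) by move=> t x y; rewrite li cl.
have l4 : linear (fun p => chi (i0 p) e4) by move=> t x y; rewrite li cl.
have [b0 [b0E _]] := form_nondeg c (mk_linear l3).
have [a0 [a0E _]] := form_nondeg c (mk_linear l4).
exists (a0, chi e3 e4), (b0, r) => x y.
have dec (z : P4 P0) : z = i0 z.1 + (z.2.1 : R) *: e3 + (z.2.2 : R) *: e4.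
  case: z => p [s t]; congr pair; first by rewrite /= !scaler0 !addr0.
  by congr pair; rewrite /= /GRing.scale /=; ring.
rewrite [in LHS](dec x) [in LHS](dec y) !formDl !formDr !formZl !formZr !formxx rE.
rewrite /form4 /vol3 /pair3 /to3 /= a0E b0E a0E b0E /=.
rewrite (form_anti chi e3 (i0 _)) (form_anti chi e4 (i0 _)) (form_anti chi e4 e3).
ring.
Qed.

End Forms4.

(** * The Pfaffian of a form on P_4 *)

Section PfaffianForm4.
Variable R : comPzRingType.
Local Notation H := (R^o * R^o)%type.

Lemma local_eq0 (x : R) :
  (forall p, prime_ideal p -> exists s, ~ p s /\ s * x = 0) -> x = 0.
Proof.
move=> h; have [|cs [csD e]] := @unit_combination R [set s | s * x = 0]%classic.
  by move=> p pp; have [s [ns sx]] := h p pp; exists s.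
rewrite -[x]mul1r e mulr_suml big_seq big1 // => z zcs.
by rewrite -mulrA csD // mulr0.
Qed.

Variables (P0 : lmodType R) (c : alt_form P0).
Hypothesis jacobi : forall p q r, c p q *: r + c q r *: p + c r p *: q = 0.
Variables (m : nat) (ps : alt_form 'rV[R]_m.*2) (j : {linear P0 -> 'rV[R]_m.*2}) (pi : {linear 'rV[R]_m.*2 -> P0}).
Hypotheses (jE : forall x y, ps (j x) (j y) = c x y)
  (piE : forall w x, c (pi w) x = ps w (j x)).

Local Notation V := ('rV[R]_m.*2).

Let jK : cancel j pi.
Proof. by move=> x; apply: (form_inj (f := c)) => y; rewrite piE jE. Qed.

Let jA y z : ps (j y) z = c y (pi z).
Proof. by rewrite form_anti -piE -form_anti. Qed.

Definition coordHV : lin_iso (H * V)%type 'rV[R]_m.+1.*2 :=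
  iso_trans (iso_prod (iso_row2 R) (iso_id V)) (iso_row R 2 m.*2).

Definition coordHHV : lin_iso (H * (H * V))%type 'rV[R]_m.+2.*2 :=
  iso_trans (iso_prod (iso_row2 R) coordHV) (iso_row R 2 m.+1.*2).

Definition basH : seq H := [:: (1, 0); (0, 1)].

Lemma bas_row (U : lmodType R) n (k : lin_iso U 'rV[R]_n) :
  map (iso_inv (iso_trans (iso_prod (iso_row2 R) k) (iso_row R 2 n)) \o delta_mx 0)
    (enum 'I_(2 + n)) =
  map (fun h => (h, 0)) basH ++
  map (fun u => (0, u)) (map (iso_inv k \o delta_mx 0) (enum 'I_n)).
Proof.
have k0 : iso_inv k 0 = 0.
  by rewrite -(linear0 k) isoK.
have r0 : iso_inv (iso_row2 R) 0 = 0 by rewrite /= !mxE.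
rewrite map_enum_split; congr (_ ++ _).
  rewrite enum_ordSl enum_ordSl (size0nil (size_enum_ord 0)) /= !delta_mx_lshift.
  by rewrite !row_mxKl !row_mxKr k0 !mxE.
rewrite -[RHS]map_comp; apply: eq_map => i /=.
by rewrite delta_mx_rshift row_mxKl row_mxKr !mxE.
Qed.

(** The form on [R e_3 (+) R e_4 (+) R^2m] that is [chi] on the image of [P_4] and
    [ps] on the orthogonal of the image of [P_0]. *)
Definition stabF (chi : P4 P0 -> P4 P0 -> R) (u v : H * V) : R :=
  ps u.2 v.2 - c (pi u.2) (pi v.2) + chi (pi u.2, u.1) (pi v.2, v.1).

(** A further hyperbolic plane makes room for a local basis of [P_0]. *)
Definition stabF2 (chi : P4 P0 -> P4 P0 -> R) (u v : H * (H * V)) : R :=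
  alt_hyp R u.1 v.1 + stabF chi u.2 v.2.

Lemma pfs_stabF2 (chi : alt_form (P4 P0)) :
  pfs m.+2 (stabF2 chi) (map (iso_inv coordHHV \o delta_mx 0) (enum 'I_m.+2.*2)) =
  pfs m.+1 (stabF chi) (map (iso_inv coordHV \o delta_mx 0) (enum 'I_m.+1.*2)).
Proof.
have hr x : alt_hyp R x 0 = 0 by exact: form0r.
have hl x : alt_hyp R 0 x = 0 by exact: form0l.
have F0 u v : u = 0 \/ v = 0 -> stabF chi u v = 0.
  have z1 : (0 : H * V).1 = 0 by []. have z2 : (0 : H * V).2 = 0 by [].
  have z3 : (0, 0) = 0 :> P4 P0 by [].
  by case=> ->; rewrite /stabF z1 z2 linear0 z3 ?form0l ?form0r subrr add0r.
rewrite bas_row (pfs_cat (k := 1)) //; last first.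
  move=> x y /mapP[h _ ->] /mapP[u _ ->].
  by rewrite /stabF2 /= F0 ?addr0; [rewrite mulr0 mulr0 subr0|left].
rewrite [X in X * _](_ : _ = 1) ?mul1r; last first.
  by rewrite /= subr0 /stabF2 /= F0; [ring|left].
by rewrite pfs_map; apply: eq_pfs => x y; rewrite /stabF2 /= mul0r subr0 add0r.
Qed.

Lemma pfs_stabF (chi : alt_form (P4 P0)) :
  pfs m.+1 (stabF chi) (map (iso_inv coordHV \o delta_mx 0) (enum 'I_m.+1.*2)) =
  pf m.+1 (fun u v => stabF chi (iso_inv coordHV u) (iso_inv coordHV v)).
Proof. by rewrite (map_comp (iso_inv coordHV)) pfs_map. Qed.

Section Local.
Variables (d : R) (S : {linear H -> P0}) (T : {linear P0 -> H}).
Hypotheses (ST : forall x, S (T x) = d *: x) (TS : forall r, T (S r) = d *: r).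

Let A (s : R) (x : H * (H * V)) : H * (H * V) :=
  (s *: T (pi x.2.2), (d *: x.2.1, s *: j (S x.1) + d *: (x.2.2 - j (pi x.2.2)))).

Let lA s : linear (A s).
Proof.
move=> a x y; congr pair; [|congr pair] => /=.
- by rewrite !linearP.
- by rewrite scalerDr !scalerA mulrC.
rewrite (linearP S) (linearP pi) !(linearP j).
rewrite opprD addrACA -scalerBr !scalerDr !scalerA ![a * _]mulrC.
by rewrite addrACA.
Qed.

Let pi3 s x : pi (A s x).2.2 = s *: S x.1.
Proof. by rewrite /= linearD !linearZZ linearB !jK subrr scaler0 addr0. Qed.

Let AA x : A 1 (A d x) = (d * d) *: x.
Proof.
have e1 : (A d x).1 = d *: T (pi x.2.2) by [].
have e2 : (A d x).2.1 = d *: x.2.1 by [].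
have e3 : (A d x).2.2 = d *: j (S x.1) + d *: (x.2.2 - j (pi x.2.2)) by [].
rewrite {1}/A pi3 e1 e2 e3 !scale1r !linearZZ TS ST !linearZZ scalerA.
case: x {e1 e2 e3} => r [e w]; congr pair; congr pair; first by rewrite scalerA.
rewrite -[(r, _).1]/r -[(_, (_, w)).2.2]/w.
by rewrite /= scalerN (addrC (d *: j (S r))) addrK -!scalerDr scalerA addrC subrK.
Qed.

Let N (chi : P4 P0 -> P4 P0 -> R) (x y : H * H) : R :=
  chi (S x.1, d *: x.2) (S y.1, d *: y.2).

Let C (v w : V) : R :=
  alt_hyp R (T (pi v)) (T (pi w)) + d * d * (ps v w - c (pi v) (pi w)).

Let stabA (chi : alt_form (P4 P0)) x y : stabF2 chi (A 1 x) (A 1 y) =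
  N chi (x.1, x.2.1) (y.1, y.2.1) + C x.2.2 y.2.2.
Proof.
rewrite /stabF2 /stabF /N /C !pi3 !scale1r.
case: x => r [e v]; case: y => r' [e' v'].
set w := (A 1 (r, (e, v))).2.2; set w' := (A 1 (r', (e', v'))).2.2.
have -> : ps w w' = c (S r) (S r') + d * d * (ps v v' - c (pi v) (pi v')).
  have z (y : V) : pi (y - j (pi y)) = 0 by rewrite linearB jK subrr.
  rewrite -[w]/(1 *: j (S r) + d *: (v - j (pi v))) -[w']/(1 *: j (S r') + d *: (v' - j (pi v'))).
  rewrite !scale1r !formDl !formDr !formZl !formZr jE jA z form0r.
  rewrite [ps (v - _) (j _)]form_anti jA z form0r.
  by rewrite formBl jA z form0r formBr -piE; ring.
rewrite -[(A 1 _).1]/(1 *: T (pi v)) -[(A 1 (r', _)).1]/(1 *: T (pi v')) !scale1r.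
rewrite -[(A 1 _).2.1]/(d *: e) -[(A 1 (r', _)).2.1]/(d *: e').
rewrite -[(_, _).2.2]/v -[(_, (_, v')).2.2]/v'; ring.
Qed.

Let pfs_N a b :
  pfs 2 (N (form4 c a b)) [:: ((1, 0), 0); ((0, 1), 0); (0, (1, 0)); (0, (0, 1))] =
  d * d * c (S (1, 0)) (S (0, 1)) * pair3 c a b.
Proof.
pose u1 := S (1, 0); pose u2 := S (0, 1).
have J := jacobi_form jacobi a.1 u1 u2 b.1.
rewrite /= /N /= (linear0 S) -/u1 -/u2 /form4 /vol3 /pair3 /to3 /=.
rewrite !(form0l, form0r) /GRing.scale /=.
have e : c u1 u2 * c a.1 b.1 = c b.1 u2 * c a.1 u1 - c b.1 u1 * c a.1 u2.
  apply/eqP; rewrite -subr_eq0; apply/eqP; rewrite -[RHS]J [c u2 b.1]form_anti.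
  ring.
transitivity (d * d * (c u1 u2 * (a.2 * b.2) + c u1 u2 * c a.1 b.1)); last by ring.
rewrite e; ring.
Qed.

(** Where [d] is invertible, [A 1] exchanges the additional hyperbolic plane with
    the image of [P_0].  This decomposes the form into an explicit form on four
    vectors ([N]) and a form that does not depend on [chi] ([C]).  So the Pfaffian
    is [pair3 a b] up to factors that are the same for all [chi]. *)
Lemma local_pfaffian : exists e e' k,
  e * e' = (d * d) ^+ m.+2.*2 /\
  forall (chi : alt_form (P4 P0)) a b, (forall x y, chi x y = form4 c a b x y) ->
  e * pfs m.+1 (stabF chi) (map (iso_inv coordHV \o delta_mx 0) (enum 'I_m.+1.*2)) =
  k * pair3 c a b.
Proof.
have [e [e' [ee' eP]]] := pfs_endo coordHHV (lA 1) (lA d) AA.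
exists e, e', (d * d * c (S (1, 0)) (S (0, 1)) *
  pfs m C (map (iso_inv (iso_id V) \o delta_mx 0) (enum 'I_m.*2))).
split=> // chi a b chiE; rewrite -pfs_stabF2 -eP; last first.
  have l3 t (x y : H * (H * V)) : (pi (t *: x + y).2.2, (t *: x + y).2.1) =
      t *: (pi x.2.2, x.2.1) + (pi y.2.2, y.2.1) :> P4 P0.
    by rewrite linearP.
  split=> [z t x y|z t x y|x]; rewrite /stabF2 /stabF ?l3 ?linearP /=.
  - rewrite !formDr !formZr /GRing.scale /=; ring.
  - rewrite !formDl !formZl /GRing.scale /=; ring.
  - rewrite !formxx; ring.
rewrite mulrAC -(pfs_N a b).
rewrite (eq_pfs _ (w' := fun x y : H * (H * V) =>
  N (form4 c a b) (x.1, x.2.1) (y.1, y.2.1) + C x.2.2 y.2.2)); last first.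
  by move=> x y; rewrite stabA /N chiE.
have [fl fr f0] := form4_alt c a b.
have f0r x : form4 c a b x 0 = 0 by exact: (linear0 (mk_linear (fr x))).
have f0l x : form4 c a b 0 x = 0 by exact: (linear0 (mk_linear (fl x))).
have z5 : (S (0 : H * H).1, d *: (0 : H * H).2) = 0 :> P4 P0.
  by rewrite linear0 scaler0.
have z6 : ((0 : H), (0 : H)) = 0 :> H * H by [].
have N0r x : N (form4 c a b) x 0 = 0 by rewrite /N z5 f0r.
have N0l x : N (form4 c a b) 0 x = 0 by rewrite /N z5 f0l.
have C0r x : C x 0 = 0 by rewrite /C !linear0 !form0r subrr mulr0 addr0.
have C0l x : C 0 x = 0 by rewrite /C !linear0 !form0l subrr mulr0 addr0.
rewrite bas_row [coordHV]/coordHV bas_row map_cat catA (pfs_cat (k := 2)) //; last first.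
  move=> x y; rewrite mem_cat => xin /mapP[_ /mapP[w _ ->] ->] /=.
  rewrite z6 N0r add0r.
  have -> : x.2.2 = 0; last exact: C0l.
  by case/orP: xin => /mapP[h hin ->] //; move/mapP: hin => [h' _ ->].
congr (_ * _).
  rewrite !map_cons -[map _ [::]]/[::] -[_ ++ _]/[:: _; _; _; _] /=.
  by rewrite !C0r !addr0.
by rewrite [LHS]pfs_map [LHS]pfs_map; apply: eq_pfs => x y /=; rewrite z6 N0r add0r.
Qed.

End Local.

(** The factors of the local identities are found by comparison with the
    reference form, which has Pfaffian 1. *)
Lemma pfs_form4 : fg_projective P0 -> constant_rank P0 2 -> pf m ps = 1 ->
  forall (chi : alt_form (P4 P0)) a b, (forall x y, chi x y = form4 c a b x y) ->
  pfs m.+1 (stabF chi) (map (iso_inv coordHV \o delta_mx 0) (enum 'I_m.+1.*2)) = pair3 c a b.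
Proof.
move=> hP hr ps1 chi a b chiE; apply/eqP; rewrite -subr_eq0; apply/eqP.
apply: local_eq0 => p pp; have [_ p1 pP] := pp.
have [d [u [f [nd fu dx]]]] := local_basis hP hr pp.
have lS : linear (fun r : H => (r.1 : R) *: u 0 + (r.2 : R) *: u 1).
  by move=> t x y; rewrite /= !scalerDl !scalerDr !scalerA addrACA.
have lT : linear (fun x => (f 0 x, f 1 x)) by move=> t x y; rewrite !linearP.
have [||e [e' [k [ee' eP]]]] := @local_pfaffian d (mk_linear lS) (mk_linear lT).
- move=> x /=; rewrite dx !big_ord_recl big_ord0 addr0.
  by congr (_ + f _ _ *: u _); apply: val_inj.
- move=> [r s] /=; rewrite !linearD !linearZ /= !fu /=.
  by congr pair; rewrite /= /GRing.scale /=; ring.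
exists e; split.
  move=> pe; have : p ((d * d) ^+ m.+2.*2).
    by rewrite -ee' mulrC; case: pp => [[_ _ pM]] _ _; apply: pM.
  by move/(primeX pp) => /pP[].
rewrite mulrBr (eP chi a b chiE).
have e0 x y : alt_perp c (alt_hyp R) x y = form4 c (0, 1) (0, 1) x y.
  by rewrite /form4 /vol3 /pair3 /to3 /= !form0l; ring.
have := eP _ _ _ e0.
have -> : pair3 c (0, 1) (0, 1) = 1 by rewrite /pair3 /= form0l; ring.
rewrite mulr1; have -> : pfs m.+1 (stabF (alt_perp c (alt_hyp R)))
    (map (iso_inv coordHV \o delta_mx 0) (enum 'I_m.+1.*2)) = 1.
  rewrite (eq_pfs _ (w' := fun x y : H * V => (alt_hyp R x.1 y.1 + ps x.2 y.2 : R))); last first.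
    by move=> x y; rewrite /stabF /=; ring.
  have h0r x : alt_hyp R x 0 = 0 by exact: form0r.
  have h0l x : alt_hyp R 0 x = 0 by exact: form0l.
  rewrite bas_row (pfs_cat (k := 1)) //; last first.
    by move=> x y /mapP[h _ ->] /mapP[v _ ->]; rewrite h0r form0l addr0.
  rewrite [X in X * _](_ : _ = 1) ?mul1r.
    rewrite -[RHS]ps1 /pf [LHS]pfs_map; apply: eq_pfs => x y.
    by rewrite h0r add0r.
  by rewrite /= form0r; ring.
by rewrite mulr1 => ->; rewrite subrr.
Qed.

End PfaffianForm4.

Section TildeV.
Variable R : comPzRingType.
Variables (P0 : lmodType R) (hP0 : fg_projective P0) (hr : constant_rank P0 2).
Variable c : alt_form P0.
Hypothesis jacobi : forall p q r, c p q *: r + c q r *: p + c r p *: q = 0.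

(** The class of [chi] lies in [tilde_V_SL]. *)
Definition in_tilde (chi : alt_form (P4 P0)) : Prop :=
  exists (m : nat) (M : 'M[R]_m.*2) (hM : alt_inv_mx M), pfaffian M = 1 /\
    V_class (fg_projective_P4 hP0) (alt_perp c (alt_hyp R)) chi =
    V_class (fg_projective_rV R m.*2) (alt_mx (psi_alt R m)) (alt_mx hM).

(** The Pfaffian of the matrix that replaces [chi] is [pair3 a b], and it depends
    on the class only. *)
Lemma in_tilde_form4 (chi : alt_form (P4 P0)) a b :
  (forall x y, chi x y = form4 c a b x y) -> in_tilde chi <-> pair3 c a b = 1.
Proof.
move=> chiE; have [m [j jE]] := hyp_embedding c hP0.
have [Psil Psir _] := form_alt (Psi R m).
have [||pi piE] := @adjoint _ 'rV[R]_m.*2 P0 c (fun w y => Psi R m w (j y)).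
- by move=> y; apply: Psil.
- by move=> w t x y; rewrite linearP Psir.
have PsiE u v : Psi R m.+1 (coordHV R m u) (coordHV R m v) = alt_hyp R u.1 v.1 + Psi R m u.2 v.2.
  exact: Psi_row2.
pose J (x : P4 P0) : 'rV[R]_m.+1.*2 := coordHV R m (x.2, j x.1).
pose Pi (w : 'rV[R]_m.+1.*2) : P4 P0 :=
  (pi (iso_inv (coordHV R m) w).2, (iso_inv (coordHV R m) w).1).
have lJ : linear J by move=> t x y; rewrite /J -linearP; congr (coordHV R m (_, _)); rewrite /= linearP.
have lPi : linear Pi by move=> t x y; rewrite /Pi (iso_inv_linear (coordHV R m)) /= linearP.
have [|w x|M [hM [ME cE]]] := @V_class_matrix _ _ (fg_projective_P4 hP0)
    (alt_perp c (alt_hyp R)) chi m.+1 (mk_linear lJ) (mk_linear lPi).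
- by move=> x y; rewrite !mk_linearE /J PsiE jE addrC.
- rewrite !mk_linearE -[w in RHS](isoVK (coordHV R m)) /J PsiE -piE addrC.
  by [].
have pfM : pfaffian M = pair3 c a b.
  rewrite pfaffian_pf -(pfs_form4 jacobi jE piE hP0 hr (pf_Psi R m) chiE) pfs_stabF.
  apply: eq_pf => u v; rewrite ME !mk_linearE /stabF /Pi.
  rewrite -[u in Psi _ _ u](isoVK (coordHV R m)) -[v in Psi _ _ _ v](isoVK (coordHV R m)) PsiE.
  move: (iso_inv _ u) (iso_inv _ v) => [e x] [e' y] /=; ring.
split=> [[n [N [hN [pN cN]]]]|ab].
  by rewrite -pfM -pN; apply: V_class_pfaffian; rewrite -cE cN.
by exists m.+1, M, hM; split; [rewrite pfM|exact: cE].
Qed.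

End TildeV.

(** * Elementary groups and transvections *)

Section Transvection.
Variable R : comPzRingType.

Section Group.
Variable M : lmodType R.
Implicit Types (v w e : M) (phi psi kap : {linear M -> R^o}).

Definition is_subgroup (G : (M -> M) -> Prop) : Prop :=
  [/\ G id, forall f g, G f -> G g -> G (f \o g) &
      forall f g, G f -> cancel f g -> cancel g f -> G g].

Definition transv v phi (x : M) : M := x + phi x *: v.

Variables (G : (M -> M) -> Prop) (hG : is_subgroup G).

Lemma transv_ext v v' phi phi' : G (transv v phi) ->
  (forall x, phi x *: v = phi' x *: v') -> G (transv v' phi').
Proof.
move=> h e; have -> // : transv v' phi' = transv v phi.
by apply/funext => x; rewrite /transv e.
Qed.

Lemma transvD v v' phi : phi v' = 0 ->
  G (transv v phi) -> G (transv v' phi) -> G (transv (v + v') phi).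
Proof.
move=> p0 h h'; have [_ hM _] := hG; have := hM _ _ h h'; congr G.
apply/funext => x; rewrite /transv /= linearD linearZ /= p0 scaler0 addr0.
by rewrite scalerDr [phi x *: v + _]addrC addrA.
Qed.

Lemma transvDr v phi phi' psi : phi v = 0 -> (forall x, psi x = phi x + phi' x) ->
  G (transv v phi) -> G (transv v phi') -> G (transv v psi).
Proof.
move=> p0 e h h'; have [_ hM _] := hG; have := hM _ _ h h'; congr G.
apply/funext => x; rewrite /transv /= linearD linearZ /= p0 scaler0 addr0 e.
by rewrite scalerDl [phi x *: v + _]addrC addrA.
Qed.

Lemma transvK v phi : phi v = 0 -> cancel (transv v phi) (transv (- v) phi).
Proof.
move=> p0 x; rewrite /transv linearD linearZ /= p0 scaler0 addr0.
by rewrite scalerN addrK.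
Qed.

Lemma transvN v phi : phi v = 0 -> G (transv v phi) -> G (transv (- v) phi).
Proof.
move=> p0 h; have [_ _ hV] := hG; apply: hV h _ _; first exact: transvK.
by move=> x; have := @transvK (- v) phi; rewrite opprK; apply; rewrite linearN p0 oppr0.
Qed.

(** [1 + v phi] is the commutator of [1 + v kap] and [1 + u psi]. *)
Lemma transv_comm v u phi kap psi : kap v = 0 -> psi u = 0 -> psi v = 0 ->
  (forall x, phi x = kap u * psi x) ->
  G (transv v kap) -> G (transv u psi) -> G (transv v phi).
Proof.
move=> kv pu pv e hv hu; have [_ hM _] := hG.
have := hM _ _ hv (hM _ _ hu (hM _ _ (transvN kv hv) (transvN pu hu))); congr G.
apply/funext => x; rewrite /transv /=.
have psi1 y : psi (y + kap y *: - v) = psi y.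
  by rewrite (linearD psi) (linearZZ psi) (linearN psi) pv oppr0 scaler0 addr0.
have psi2 : psi (x + psi x *: - u) = psi x.
  by rewrite (linearD psi) (linearZZ psi) (linearN psi) pu oppr0 scaler0 addr0.
rewrite psi1 psi2; set y := x + _ *: - u.
have kv' : kap (- v) = 0 by rewrite linearN kv oppr0.
have kD a t s : kap (a + t *: - v + s *: u) = kap a + s * kap u.
  by rewrite !(linearD kap) !(linearZZ kap) kv' scaler0 addr0.
rewrite kD scalerDl addrA [kap y *: - v]scalerN [y - _ + _]addrAC subrK.
by rewrite /y scalerN subrK e mulrC.
Qed.

(** [e] is a basis vector with coordinate [es], and [G] contains the transvections
    between [R e] and the kernel of [es]. *)
Definition elementary_coord e (es : {linear M -> R^o}) : Prop :=
  [/\ es e = 1, forall v, es v = 0 -> G (transv v es) &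
      forall phi, phi e = 0 -> G (transv e phi)].

(** After the component along [e] is split off, what remains is a commutator of
    two transvections through [e]. *)
Lemma transv_coord e es v phi : elementary_coord e es ->
  es v = 0 \/ phi e = 0 -> phi v = 0 -> G (transv v phi).
Proof.
move=> [ee h1 h2] hor pv.
have core w psi : es w = 0 -> psi e = 0 -> psi w = 0 -> G (transv w psi).
  move=> ew pe pw; apply: (@transv_comm w e psi es psi) => //.
  - by move=> x; rewrite ee mul1r.
  - exact: h1.
  - exact: h2.
have [ev|ev] := hor.
  have l1 : linear (fun x => phi x - phi e * es x : R^o).
    by move=> t x y; rewrite !linearP /= /GRing.scale /=; ring.
  have l2 : linear (fun x => phi e * es x : R^o).
    by move=> t x y; rewrite !linearP /= /GRing.scale /=; ring.
  apply: (@transvDr v (mk_linear l1) (mk_linear l2)).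
  - by rewrite /= ev pv mulr0 subr0.
  - by move=> x /=; rewrite subrK.
  - by apply: core => //=; rewrite ?ev ?pv ?ee ?mulr0 ?mulr1 ?subrr ?subr0.
  apply: (@transv_ext (phi e *: v) _ es).
    by apply: h1; rewrite linearZ /= ev scaler0.
  by move=> x /=; rewrite scalerA mulrC.
have -> : v = (v - es v *: e) + es v *: e by rewrite subrK.
apply: transvD.
- by rewrite linearZ /= ev scaler0.
- apply: core => //; first by rewrite linearB linearZ /= ee /GRing.scale /= mulr1 subrr.
  by rewrite linearB linearZ /= pv ev scaler0 subr0.
have l2 : linear (fun x => es v * phi x : R^o).
  by move=> t x y; rewrite !linearP /= /GRing.scale /=; ring.
apply: (@transv_ext e _ (mk_linear l2)).
  by apply: h2 => /=; rewrite ev mulr0.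
by move=> x /=; rewrite scalerA mulrC.
Qed.

End Group.

Lemma E_subgroup (P : lmodType R) (d : decomposition P) : is_subgroup (E d).
Proof.
split; [exact: gen_id|by move=> f g; apply: gen_comp|].
by move=> f g h fK gK; apply: gen_inv h fK gK.
Qed.

Lemma E_gen (P : lmodType R) (d : decomposition P) (i j : d_index d)
    (s : {linear d j -> d i}) f : i != j ->
  (forall p, f p = p + s_in (d i) (s (s_out (d j) p))) -> E d f.
Proof. by move=> ij e; apply: gen_base; exists i, j, s; split=> //; apply/funext. Qed.

End Transvection.

(** * The elementary groups of P_3 and P_4 *)

Section ElementaryP.
Variable R : comPzRingType.
Variables (P0 : lmodType R).

Let E3 := E (P3_dec P0).
Let E4 := E (P4_dec P0).
Let hE3 : is_subgroup E3 := E_subgroup (P3_dec P0).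
Let hE4 : is_subgroup E4 := E_subgroup (P4_dec P0).

Definition snd3 : {linear P3 P0 -> R^o} := snd.
Definition cd3 : {linear P4 P0 -> R^o} := fst \o snd.
Definition cd4 : {linear P4 P0 -> R^o} := snd \o snd.
Definition f3 : P3 P0 := (0, 1).
Definition e3 : P4 P0 := (0, (1, 0)).
Definition e4 : P4 P0 := (0, (0, 1)).

Lemma pair00 (M N : lmodType R) : ((0 : M), (0 : N)) = 0.
Proof. by []. Qed.

Lemma eq_P4 (x y : P4 P0) : x.1 = y.1 -> x.2.1 = y.2.1 -> x.2.2 = y.2.2 -> x = y.
Proof. by case: x y => [x [x3 x4]] [y [y3 y4]] /= -> -> ->. Qed.

Lemma line_linear (M : lmodType R) (v : M) : linear (fun r : R^o => (r : R) *: v).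
Proof. by move=> a x y; rewrite /= scalerDl scalerA. Qed.

Lemma restr0_linear (M N : lmodType R) (phi : {linear (M * N)%type -> R^o}) :
  linear (fun p => phi (p, 0)).
Proof. by move=> a x y; rewrite -linearP; congr (phi (_, _)); rewrite /= scaler0 addr0. Qed.

Lemma restr1_linear (M N : lmodType R) (phi : {linear (M * N)%type -> R^o}) :
  linear (fun p => phi (0, p)).
Proof. by move=> a x y; rewrite -linearP; congr (phi (_, _)); rewrite /= scaler0 addr0. Qed.

Lemma P3_coord : elementary_coord E3 f3 snd3.
Proof.
split=> // [v v0|phi p0].
  apply: (@E_gen _ _ (P3_dec P0) false true (mk_linear (line_linear v.1))) => // p.
  by rewrite /transv /=; case: v v0 => x y /= ->; congr pair; rewrite /= scaler0.
apply: (@E_gen _ _ (P3_dec P0) true false (mk_linear (restr0_linear phi))) => // p.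
rewrite /transv /=; have -> : phi p = phi (p.1, 0).
  have {1}-> : p = (p.1, 0) + (p.2 : R) *: f3.
    case: p => x y; congr pair; rewrite /= ?scaler0 ?addr0 //.
    by rewrite /GRing.scale /=; ring.
  by rewrite linearD linearZ /= p0 scaler0 addr0.
by congr pair; rewrite /= ?scaler0 // /GRing.scale /= mulr1.
Qed.

Lemma P4_genC (h : R^o * R^o) (k : {linear P0 -> R^o}) :
  E4 (transv ((0, h) : P4 P0) (k \o fst)).
Proof.
have lr (r : R) : linear (fun p => r * k p : R^o).
  by move=> a x y; rewrite linearP /= /GRing.scale /=; ring.
have -> : ((0, h) : P4 P0) = (0, (h.1, 0)) + (0, (0, h.2)).
  by apply: eq_P4; rewrite /= ?addr0 ?add0r.
apply: (transvD hE4); first by rewrite /= linear0.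
  apply: (@E_gen _ _ (P4_dec P0) (Some false) None (mk_linear (lr h.1))) => // p.
  apply: eq_P4; rewrite /transv /= ?scaler0 ?addr0 //.
  by rewrite /GRing.scale /= mulrC.
apply: (@E_gen _ _ (P4_dec P0) (Some true) None (mk_linear (lr h.2))) => // p.
apply: eq_P4; rewrite /transv /= ?scaler0 ?addr0 //.
by rewrite /GRing.scale /= mulrC.
Qed.

Lemma P4_genR (p : P0) (phi : {linear P4 P0 -> R^o}) : (forall q, phi (q, 0) = 0) ->
  E4 (transv ((p, 0) : P4 P0) phi).
Proof.
move=> p0.
have l3 : linear (fun x : P4 P0 => phi e3 * x.2.1 : R^o).
  by move=> t x y /=; rewrite /GRing.scale /=; ring.
have l4 : linear (fun x : P4 P0 => phi e4 * x.2.2 : R^o).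
  by move=> t x y /=; rewrite /GRing.scale /=; ring.
apply: (transvDr hE4 (phi := mk_linear l3) (phi' := mk_linear l4)).
- by rewrite /= mulr0.
- move=> x /=.
  have {1}-> : x = (x.1, 0) + (x.2.1 : R) *: e3 + (x.2.2 : R) *: e4.
    case: x => q [r s]; congr pair; first by rewrite /= !scaler0 !addr0.
    by congr pair; rewrite /= /GRing.scale /=; ring.
  rewrite !linearD !linearZ /= p0 add0r /GRing.scale /=; ring.
- apply: (@E_gen _ _ (P4_dec P0) None (Some false) (mk_linear (line_linear (phi e3 *: p)))) => // x.
  by apply: eq_P4; rewrite /transv /= ?scaler0 // scalerA mulrC.
- apply: (@E_gen _ _ (P4_dec P0) None (Some true) (mk_linear (line_linear (phi e4 *: p)))) => // x.
  by apply: eq_P4; rewrite /transv /= ?scaler0 // scalerA mulrC.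
Qed.

Lemma P4_gen34 (r : R^o) : E4 (transv ((0, (0, r)) : P4 P0) cd3).
Proof.
pose s : {linear R^o -> R^o} := mk_linear (@line_linear R^o r).
apply: (@E_gen _ _ (P4_dec P0) (Some true) (Some false) s); [by []|move=> x].
by apply: eq_P4; rewrite /transv /= ?scaler0.
Qed.

Lemma P4_gen43 (r : R^o) : E4 (transv ((0, (r, 0)) : P4 P0) cd4).
Proof.
pose s : {linear R^o -> R^o} := mk_linear (@line_linear R^o r).
apply: (@E_gen _ _ (P4_dec P0) (Some false) (Some true) s); [by []|move=> x].
by apply: eq_P4; rewrite /transv /= ?scaler0.
Qed.

Lemma P4_coord4 : elementary_coord E4 e4 cd4.
Proof.
split=> // [v v0|phi p0].
  have -> : v = (v.1, 0) + (0, (v.2.1, 0)).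
    case: v v0 => x [y z] /= ->.
    by apply: eq_P4; rewrite /= ?addr0 ?add0r.
  by apply: (transvD hE4); [|exact: P4_genR|exact: P4_gen43].
have l3 : linear (fun x : P4 P0 => phi e3 * x.2.1 : R^o).
  by move=> t x y /=; rewrite /GRing.scale /=; ring.
apply: (transvDr hE4 (phi := mk_linear (restr0_linear phi) \o fst) (phi' := mk_linear l3)).
- by rewrite /= pair00 linear0.
- move=> x /=.
  have {1}-> : x = (x.1, 0) + (x.2.1 : R) *: e3 + (x.2.2 : R) *: e4.
    case: x => q [r s]; congr pair; first by rewrite /= !scaler0 !addr0.
    by congr pair; rewrite /= /GRing.scale /=; ring.
  rewrite !linearD !linearZ /= p0 scaler0 addr0 /GRing.scale /=; ring.
- exact: P4_genC.
apply: (transv_ext (P4_gen34 (phi e3))) => x /=.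
congr pair; first by rewrite /= !scaler0.
by congr pair; rewrite /= /GRing.scale /=; ring.
Qed.

Lemma P4_coord3 : elementary_coord E4 e3 cd3.
Proof.
split=> // [v v0|phi p0].
  have -> : v = (v.1, 0) + (0, (0, v.2.2)).
    case: v v0 => x [y z] /= ->.
    by apply: eq_P4; rewrite /= ?addr0 ?add0r.
  by apply: (transvD hE4); [|exact: P4_genR|exact: P4_gen34].
have l4 : linear (fun x : P4 P0 => phi e4 * x.2.2 : R^o).
  by move=> t x y /=; rewrite /GRing.scale /=; ring.
apply: (transvDr hE4 (phi := mk_linear (restr0_linear phi) \o fst) (phi' := mk_linear l4)).
- by rewrite /= pair00 linear0.
- move=> x /=.
  have {1}-> : x = (x.1, 0) + (x.2.1 : R) *: e3 + (x.2.2 : R) *: e4.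
    case: x => q [r s]; congr pair; first by rewrite /= !scaler0 !addr0.
    by congr pair; rewrite /= /GRing.scale /=; ring.
  rewrite !linearD !linearZ /= p0 scaler0 addr0 /GRing.scale /=; ring.
- exact: P4_genC.
apply: (transv_ext (P4_gen43 (phi e4))) => x /=.
congr pair; first by rewrite /= !scaler0.
by congr pair; rewrite /= /GRing.scale /=; ring.
Qed.

(* the trace ideal of [P_0] contains 1 *)
Hypothesis trace1 : exists cs : seq ({linear P0 -> R^o} * P0),
  \sum_(x <- cs) x.1 x.2 = 1.

(** A transvection inside [R e_3 (+) R e_4] is a sum of commutators through
    [P_0], one for each term of an expression of [1] in the trace ideal. *)
Lemma P4_transv_plane (h : R^o * R^o) (phi : {linear P4 P0 -> R^o}) :
  (forall q, phi (q, 0) = 0) -> phi (0, h) = 0 -> E4 (transv ((0, h) : P4 P0) phi).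
Proof.
move=> p0 ph; have [cs cs1] := trace1.
set v : P4 P0 := (0, h).
suff aux (ds : seq ({linear P0 -> R^o} * P0)) : E4 (transv ((\sum_(x <- ds) (x.1 x.2 : R)) *: v) phi).
  by have := aux cs; rewrite cs1 scale1r.
elim: ds => [|[k p] ds IH].
  rewrite big_nil scale0r; have -> : transv (0 : P4 P0) phi = id; last exact: gen_id.
  by apply/funext => x; rewrite /transv scaler0 addr0.
rewrite big_cons scalerDl; apply: (transvD hE4); last exact: IH.
  by rewrite linearZ /= ph scaler0.
have lk : linear (fun x => k p * phi x : R^o).
  by move=> t x y; rewrite linearP /= /GRing.scale /=; ring.
apply: (@transv_ext _ _ _ v _ (mk_linear lk)); last first.
  by move=> x; rewrite /= scalerA mulrC.
apply: (transv_comm hE4 (u := ((p, 0) : P4 P0)) (kap := k \o fst) (psi := phi)).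
- by rewrite /= linear0.
- exact: p0.
- exact: ph.
- by move=> x.
- exact: P4_genC.
- exact: P4_genR.
Qed.

Lemma P4_transv0 v (phi : {linear P4 P0 -> R^o}) :
  v.1 = 0 \/ (forall q, phi (q, 0) = 0) -> phi v = 0 -> E4 (transv v phi).
Proof.
case=> [|p0]; last first.
  have -> : v = (v.1, 0) + (0, v.2) by case: v => x y; congr pair; rewrite /= ?addr0 ?add0r.
  rewrite linearD p0 add0r => pv.
  by apply: (transvD hE4); [|exact: P4_genR|exact: P4_transv_plane].
case: v => x h /= -> pv.
apply: (transvDr hE4 (phi := mk_linear (restr0_linear phi) \o fst)
  (phi' := mk_linear (restr1_linear phi) \o snd)).
- by rewrite /= pair00 linear0.
- by move=> y; rewrite /= -linearD -pairE.
- exact: P4_genC.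
by apply: P4_transv_plane => [q|]; rewrite /= ?pair00 ?linear0.
Qed.

(** If [phi w = 1] then [v = phi(w) v - phi(v) w] is a sum of Koszul terms, each
    of which lacks one of the three coordinates. *)
Lemma P4_transv v w (phi : {linear P4 P0 -> R^o}) :
  phi w = 1 -> phi v = 0 -> E4 (transv v phi).
Proof.
case: v w => v0 [v3 v4] [w0 [w3 w4]] pw pv.
pose in0 (x : P0) : P4 P0 := (x, 0).
pose a0 : R := phi (in0 w0); pose a3 : R := w3 * phi e3; pose a4 : R := w4 * phi e4.
pose b0 : R := phi (in0 v0); pose b3 : R := v3 * phi e3; pose b4 : R := v4 * phi e4.
have phiE x r s : phi (x, (r, s)) = phi (in0 x) + r * phi e3 + s * phi e4.
  have -> : ((x, (r, s)) : P4 P0) = in0 x + (r : R) *: e3 + (s : R) *: e4.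
    apply: eq_P4; rewrite /= ?scaler0 ?addr0 // /GRing.scale /=; ring.
  by rewrite !linearD !linearZ.
pose kA : P4 P0 := ((a0 + a3) *: v0 - (b0 + b3) *: w0, ((a0 + a3) * v3 - (b0 + b3) * w3, 0)).
pose kB : P4 P0 := (a4 *: v0 - b4 *: w0, (0, a0 * v4 - b0 * w4)).
pose kC : P4 P0 := (0, (a4 * v3 - b4 * w3, a3 * v4 - b3 * w4)).
have p0Z t x : phi (in0 (t *: x)) = t * phi (in0 x).
  have -> : in0 (t *: x) = t *: in0 x by apply: eq_P4; rewrite /= ?scaler0.
  by rewrite linearZ.
have p0B x y : phi (in0 (x - y)) = phi (in0 x) - phi (in0 y).
  have -> : in0 (x - y) = in0 x - in0 y by apply: eq_P4; rewrite /= ?subr0.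
  by rewrite linearB.
have p00 : phi (in0 0) = 0 by rewrite /in0 pair00 linear0.
have pA : phi kA = 0 by rewrite phiE p0B !p0Z /a0 /a3 /b0 /b3; ring.
have pB : phi kB = 0 by rewrite phiE p0B !p0Z /a0 /a4 /b0 /b4; ring.
have pC : phi kC = 0 by rewrite phiE p00 /a4 /a3 /b4 /b3; ring.
have a1 : a0 + a3 + a4 = 1 by rewrite -pw phiE.
have bz : b0 + b3 + b4 = 0 by rewrite -pv phiE.
have -> : ((v0, (v3, v4)) : P4 P0) = kA + kB + kC.
  apply: eq_P4 => /=.
  - by rewrite addr0 addrACA -opprD -!scalerDl a1 bz scale1r scale0r subr0.
  - transitivity ((a0 + a3 + a4) * v3 - (b0 + b3 + b4) * w3); last by ring.
    by rewrite a1 bz mul1r mul0r subr0.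
  - transitivity ((a0 + a3 + a4) * v4 - (b0 + b3 + b4) * w4).
      by rewrite a1 bz mul1r mul0r subr0.
    by rewrite /a4 /b4; ring.
apply: (transvD hE4); [exact: pC| |by apply: P4_transv0; [left|exact: pC]].
apply: (transvD hE4); first exact: pB.
  by apply: (transv_coord hE4 P4_coord4); [left|exact: pA].
by apply: (transv_coord hE4 P4_coord3); [left|exact: pB].
Qed.

(** The dual statement: here [phi = lam(v) phi - phi(v) lam] is decomposed. *)
Lemma P4_transv' v (phi lam : {linear P4 P0 -> R^o}) :
  lam v = 1 -> phi v = 0 -> E4 (transv v phi).
Proof.
case: v => v0 [v3 v4] lv pv.
pose in0 (x : P0) : P4 P0 := (x, 0).
have in0P (psi : {linear P4 P0 -> R^o}) t (x y : P4 P0) :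
    psi (in0 (t *: x + y).1) = t * psi (in0 x.1) + psi (in0 y.1).
  have -> : in0 (t *: x + y).1 = t *: in0 x.1 + in0 y.1.
    by apply: eq_P4; rewrite /= ?scaler0 ?addr0.
  by rewrite linearP.
have decE (psi : {linear P4 P0 -> R^o}) x :
    psi x = psi (in0 x.1) + x.2.1 * psi e3 + x.2.2 * psi e4.
  have {1}-> : x = in0 x.1 + (x.2.1 : R) *: e3 + (x.2.2 : R) *: e4.
    apply: eq_P4; rewrite /= ?scaler0 ?addr0 // /GRing.scale /=; ring.
  by rewrite !linearD !linearZ.
pose a0 : R := lam (in0 v0); pose a3 : R := v3 * lam e3; pose a4 : R := v4 * lam e4.
pose b0 : R := phi (in0 v0); pose b3 : R := v3 * phi e3; pose b4 : R := v4 * phi e4.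
have a1 : a0 + a3 + a4 = 1 by rewrite -lv decE.
have bz : b0 + b3 + b4 = 0 by rewrite -pv [RHS]decE.
pose fA (x : P4 P0) : R^o := (a0 + a3) * (phi (in0 x.1) + x.2.1 * phi e3)
  - (b0 + b3) * (lam (in0 x.1) + x.2.1 * lam e3).
pose fB (x : P4 P0) : R^o := a4 * phi (in0 x.1) - b4 * lam (in0 x.1) +
  (a0 * (x.2.2 * phi e4) - b0 * (x.2.2 * lam e4)).
pose fC (x : P4 P0) : R^o := a4 * (x.2.1 * phi e3) - b4 * (x.2.1 * lam e3) +
  (a3 * (x.2.2 * phi e4) - b3 * (x.2.2 * lam e4)).
have lA : linear fA.
  by move=> t x y; rewrite /fA ?in0P /= /GRing.scale /=; ring.
have lB : linear fB.
  by move=> t x y; rewrite /fB ?in0P /= /GRing.scale /=; ring.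
have lC : linear fC.
  by move=> t x y; rewrite /fC ?in0P /= /GRing.scale /=; ring.
have in00 : in0 0 = 0 by [].
have pA : fA (v0, (v3, v4)) = 0 by rewrite /fA /= -/a0 -/a3 -/b0 -/b3; ring.
have pB : fB (v0, (v3, v4)) = 0 by rewrite /fB /= -/a0 -/a4 -/b0 -/b4; ring.
have pC : fC (v0, (v3, v4)) = 0 by rewrite /fC /= -/a3 -/a4 -/b3 -/b4; ring.
pose fAB x : R^o := fA x + fB x.
have lAB : linear fAB.
  by move=> t x y; rewrite /fAB lA lB addrACA -scalerDr.
apply: (transvDr hE4 (phi := mk_linear lAB) (phi' := mk_linear lC)).
- by rewrite /= /fAB pA pB addr0.
- move=> x; transitivity ((a0 + a3 + a4) * phi x - (b0 + b3 + b4) * lam x).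
    by rewrite a1 bz mul1r mul0r subr0.
  by rewrite (decE phi) (decE lam) /= /fAB /fA /fB /fC /a4 /b4; ring.
- apply: (transvDr hE4 (phi := mk_linear lA) (phi' := mk_linear lB)).
  + exact: pA.
  + by move=> x.
  + apply: (transv_coord hE4 P4_coord4); [right|exact: pA].
    by rewrite /= /fA /= in00 !linear0; ring.
  apply: (transv_coord hE4 P4_coord3); [right|exact: pB].
  by rewrite /= /fB /= in00 !linear0; ring.
apply: P4_transv0; [right => q|exact: pC].
by rewrite /= /fC /=; ring.
Qed.

(** The conjugate of a generator is a transvection [1 + v phi] in which [phi] or
    [v] is unimodular, being the image of a coordinate or of a basis vector. *)
Lemma P4_normal (g g' f : P4 P0 -> P4 P0) : linear g -> cancel g g' -> cancel g' g ->
  E4 f -> E4 (g \o f \o g').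
Proof.
move=> lg gK g'K; have lg' := inv_linear lg gK g'K.
elim=> {f} [f [i [k [s [ik ->]]]]||f h _ If _ Ih|f h _ If fK hK].
- have gD x y : g (x + y) = g x + g y by exact: (linearD (mk_linear lg)).
  have gZ t x : g (t *: x) = t *: g x by exact: (linearZ_LR (mk_linear lg)).
  have conj v (phi : {linear P4 P0 -> R^o}) :
      (forall p, s_in (P4_summand P0 i) (s (s_out (P4_summand P0 k) p)) = phi p *: v) ->
      E4 (transv (g v) (phi \o mk_linear lg')) ->
      E4 (g \o (fun p => p + s_in (P4_summand P0 i) (s (s_out (P4_summand P0 k) p))) \o g').
    move=> e; congr E4; apply/funext => x.
    by rewrite /transv /= e gD g'K gZ.
  case: i k s ik conj => [[]|] [[]|] //= s _ conj.
  + apply: (conj (0, (0, s 1)) cd3).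
      move=> p; rewrite -{1}[p.2.1]mulr1 (linearZ_LR s) /=.
      by apply: eq_P4; rewrite /= ?scaler0.
    by apply: (@P4_transv _ (g e3)) => /=; rewrite gK.
  + apply: (conj e4 (s \o fst)).
      move=> p; apply: eq_P4; rewrite /= ?scaler0 //.
      by rewrite /GRing.scale /= mulr1.
    apply: (@P4_transv' _ _ (cd4 \o mk_linear lg')) => /=; rewrite gK //=.
    by rewrite linear0.
  + apply: (conj (0, (s 1, 0)) cd4).
      move=> p; rewrite -{1}[p.2.2]mulr1 (linearZ_LR s) /=.
      by apply: eq_P4; rewrite /= ?scaler0.
    by apply: (@P4_transv _ (g e4)) => /=; rewrite gK.
  + apply: (conj e3 (s \o fst)).
      move=> p; apply: eq_P4; rewrite /= ?scaler0 //.
      by rewrite /GRing.scale /= mulr1.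
    apply: (@P4_transv' _ _ (cd3 \o mk_linear lg')) => /=; rewrite gK //=.
    by rewrite linear0.
  + apply: (conj (s 1, 0) cd4).
      move=> p; rewrite -{1}[p.2.2]mulr1 (linearZ_LR s) /=.
      by apply: eq_P4; rewrite /= ?scaler0.
    by apply: (@P4_transv _ (g e4)) => /=; rewrite gK.
  + apply: (conj (s 1, 0) cd3).
      move=> p; rewrite -{1}[p.2.1]mulr1 (linearZ_LR s) /=.
      by apply: eq_P4; rewrite /= ?scaler0.
    by apply: (@P4_transv _ (g e3)) => /=; rewrite gK.
- have -> : g \o id \o g' = id by apply/funext => x /=; rewrite g'K.
  exact: gen_id.
- have -> : g \o (f \o h) \o g' = (g \o f \o g') \o (g \o h \o g').
    by apply/funext => x /=; rewrite gK.
  exact: gen_comp.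
- by apply: gen_inv If _ _ => x /=; rewrite gK ?fK ?hK g'K.
Qed.

End ElementaryP.

(** * Orbits of forms and orbits of unimodular functionals *)

Section Orbits.
Variable R : comPzRingType.
Variables (P0 : lmodType R) (hP0 : fg_projective P0) (hr : constant_rank P0 2).
Variable c : alt_form P0.
Hypothesis jacobi : forall p q r, c p q *: r + c q r *: p + c r p *: q = 0.
Hypothesis multiple : forall f : P0 -> P0 -> R^o, alternating_map f ->
  exists r : R, forall p q, f p q = r * c p q.

Local Notation E3 := (E (P3_dec P0)).
Local Notation E4 := (E (P4_dec P0)).
Let hE3 : is_subgroup E3 := E_subgroup (P3_dec P0).

Lemma trace_unit : exists cs : seq ({linear P0 -> R^o} * P0),
  \sum_(x <- cs) x.1 x.2 = 1.
Proof.
have [|cs [csD e]] := @unit_combination R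
    [set d | exists (k : {linear P0 -> R^o}) p, d = k p]%classic.
  move=> p pp; have [d [u [f [nd fu _]]]] := local_basis hP0 hr pp.
  by exists d; split=> //; exists (f ord0), (u ord0); rewrite fu.
rewrite e; elim: cs csD {e} => [|[x d] cs IH] csD; first by exists [::]; rewrite !big_nil.
have [|ds dsE] := IH; first by move=> y ycs; apply: csD; rewrite inE ycs orbT.
have [k [p /= dE]] := csD (x, d) (mem_head _ _).
exists ((k, x *: p) :: ds); rewrite !big_cons dsE /= linearZ /=.
by rewrite dE.
Qed.

Lemma vol3_linear b y : linear (fun x : P3 P0 => vol3 c b x y : R^o).
Proof.
move=> t x x'; rewrite /vol3 /= !formDr !formDl !formZl !formZr /GRing.scale /=; ring.
Qed.

Lemma vol3_linearr b x : linear (fun y : P3 P0 => vol3 c b x y : R^o).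
Proof.
move=> t y y'; rewrite /vol3 /= !formDr !formZr /GRing.scale /=; ring.
Qed.

Lemma vol3_bb b y : vol3 c b b y = 0.
Proof. by rewrite /vol3 formxx; ring. Qed.

(** With [u] the first vector of a local basis, a multiple of [b] differs from a
    vector without [u]-component by a multiple of [u]; the latter is handled by
    the free coordinate, the former by a commutator through [u]. *)
Lemma E3_koszul_local b (d t : R) (u u' : P0) (f f' : {linear P0 -> R^o}) :
  f u = d -> f u' = 0 -> (forall x, d *: x = f x *: u + f' x *: u') ->
  E3 (transv b (mk_linear (vol3_linear b ((t * (d * d)) *: u, 0)))).
Proof.
move=> fu fu' dx.
pose U : P3 P0 := (u, 0).
have lw : linear (fun x : P3 P0 => t * vol3 c b x U : R^o).
  by move=> s x y; rewrite (vol3_linear b U s x y) /= mulrDr /GRing.scale /= mulrCA.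
have ldw : linear (fun x : P3 P0 => d * (t * vol3 c b x U) : R^o).
  by move=> s x y; rewrite (lw s x y) /= mulrDr /GRing.scale /= mulrCA.
pose w := mk_linear lw; pose dw := mk_linear ldw.
pose b' : P3 P0 := (f' b.1 *: u', d * b.2).
have dbE : d *: b = f b.1 *: U + b'.
  by congr pair; rewrite /= ?scaler0 ?add0r ?dx.
have wU : w U = 0 by rewrite /= /vol3 /= formxx; ring.
have wb' : w b' = 0.
  have -> : b' = d *: b - f b.1 *: U by rewrite dbE addrC addKr.
  rewrite (linearB w) !(linearZZ w) wU -[w b]/(t * vol3 c b b U) vol3_bb mulr0.
  by rewrite !scaler0 subrr.
apply: (@transv_ext _ _ _ (f b.1 *: U + b') _ dw); last first.
  move=> x; rewrite -dbE scalerA; congr (_ *: _).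
  by rewrite /= /vol3 /= !formZr /U /=; ring.
apply: (transvD hE3).
- by rewrite -[LHS]/(d * w b') wb' mulr0.
- apply: (transv_coord hE3 (P3_coord P0)); first by left; rewrite /= /GRing.scale /= mulr0.
  by rewrite -[LHS]/(d * w (f b.1 *: U)) linearZZ wU scaler0 mulr0.
apply: (transv_comm hE3 (u := U) (kap := f \o fst) (psi := w)).
- by rewrite /= linearZ /= fu' scaler0.
- exact: wU.
- exact: wb'.
- by move=> x; rewrite /= fu.
- apply: (transv_coord hE3 (P3_coord P0)); first by right; rewrite /= linear0.
  by rewrite /= linearZ /= fu' scaler0.
- by apply: (transv_coord hE3 (P3_coord P0)); [left|exact: wU].
Qed.

(** [vol3 b x y] is additive in [y], so that [y] may be cut into the pieces of the
    local lemma: the cubes of the [d] still generate the unit ideal. *)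
Lemma E3_koszul b y : E3 (transv b (mk_linear (vol3_linear b y))).
Proof.
have add y1 y2 : E3 (transv b (mk_linear (vol3_linear b y1))) ->
    E3 (transv b (mk_linear (vol3_linear b y2))) ->
    E3 (transv b (mk_linear (vol3_linear b (y1 + y2)))).
  move=> h1 h2; apply: (transvDr hE3 _ _ h1 h2); first exact: vol3_bb.
  by move=> x; exact: (raddfD (mk_linear (vol3_linearr b x))).
have -> : y = (y.1, 0) + (0, y.2).
  by case: y => q r; congr pair; rewrite /= ?addr0 ?add0r.
apply: (add); last first.
  apply: (transv_coord hE3 (P3_coord P0)); last exact: vol3_bb.
  by right; rewrite /= /vol3 /= !form0l !form0r; ring.
have [|cs [csD e]] := @unit_combination R [set z | exists d, z = d * d * d /\
    exists u f, dual_system d u f /\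
      forall x : P0, d *: x = \sum_(i < 2) f i x *: u i]%classic.
  move=> p pp; have [d [u [f [nd fu dx]]]] := local_basis hP0 hr pp.
  have [_ _ pP] := pp.
  exists (d * d * d); split; last by move=> /pP[/pP[]|].
  by exists d; split=> //; exists u, f.
rewrite -[y.1]scale1r e scaler_suml.
elim: cs csD {e} => [|[z z'] cs IH] csD.
  rewrite big_nil; have -> : transv b (mk_linear (vol3_linear b (0, 0))) = id; last exact: gen_id.
  apply/funext => x; rewrite /transv /= /vol3 /= !form0r.
  by rewrite mulr0 mul0r mulr0 subr0 addr0 scale0r addr0.
rewrite big_cons.
set s := \sum_(_ <- _) _.
have -> : (((z, z').1 * (z, z').2) *: y.1 + s, 0) = ((z * z') *: y.1, 0) + (s, 0) :> P3 P0.
  by congr pair; rewrite /= addr0.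
apply: (add); last by apply: IH => x xcs; apply: csD; rewrite inE xcs orbT.
have [d [/= -> [u [f [fu dx]]]]] := csD (z, z') (mem_head _ _).
have dx' x : d *: x = f 0 x *: u 0 + f 1 x *: u 1.
  rewrite dx !big_ord_recl big_ord0 addr0.
  by congr (_ + f _ _ *: u _); apply: val_inj.
have -> : ((z * (d * d * d)) *: y.1, 0) =
    ((z * f 0 y.1 * (d * d)) *: u 0, 0) + ((z * f 1 y.1 * (d * d)) *: u 1, 0) :> P3 P0.
  congr pair; rewrite /= ?addr0 //.
  by rewrite mulrA -scalerA dx' scalerDr !scalerA; congr (_ *: _ + _ *: _); ring.
apply: (add).
  by apply: (@E3_koszul_local _ _ _ _ (u 1) (f 0) (f 1)) => //; rewrite fu.
apply: (@E3_koszul_local _ _ _ _ (u 0) (f 1) (f 0)); try by rewrite fu.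
by move=> x; rewrite dx' addrC.
Qed.

(** On the two summands concerned a generator is a unipotent block matrix, which
    is extended by the identity. *)
Lemma E_SL (P : lmodType R) (d : decomposition P) f : complemented P ->
  (forall i, complemented (d i)) -> E d f -> SL f.
Proof.
move=> cP cd; elim=> {f} [f [i [j [s [ij ->]]]]||f g _ If _ Ig|f g _ If fK gK].
- have lJ : linear (fun x : d i * d j => s_in (d i) x.1 + s_in (d j) x.2).
    by move=> t x y; rewrite /= !linearP scalerDr addrACA.
  have lp : linear (fun x => (s_out (d i) x, s_out (d j) x)).
    by move=> t x y; rewrite !linearP.
  have JK : cancel (mk_linear lJ) (mk_linear lp).
    move=> [x y]; congr pair; rewrite /= linearD d_inK ?(d_out0 y) ?(d_out0 x) ?addr0 ?add0r //.
    by rewrite eq_sym.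
  apply: SL_ext (SL_extend JK cP (SL_elem s (cd i) (cd j))) => x.
  rewrite /= linearD; congr (x + _).
  by rewrite [X in X - _]addrAC [X in X - _]addrC addrK.
- exact: SL_id.
- exact: SL_comp.
- exact: SL_inv If fK gK.
Qed.

Lemma complemented_P4 : complemented (P4 P0).
Proof. exact/complemented_fg_projective/fg_projective_P4. Qed.

Lemma E4_SL f : E4 f -> SL f.
Proof.
have cR := complemented_regular R; have cP := complemented_fg_projective hP0.
by apply: E_SL; [exact: complemented_P4|case=> [[]|]].
Qed.

Lemma form_pullback (P : lmodType R) (chi : alt_form P) f : SL f ->
  exists chi' : alt_form P, forall x y, chi' x y = chi (f x) (f y).
Proof.
move=> [[lf [f' fK f'K]] _]; have lf' := inv_linear lf fK f'K.
have alt : alternating_map (fun x y => chi (f x) (f y)).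
  split=> [y t x x'|x t y y'|x]; rewrite ?lf ?formDl ?formDr ?formZl ?formZr ?formxx //.
have nd (k : {linear P -> R^o}) : exists! x, (fun x y => chi (f x) (f y)) x =1 k.
  have [p [pE pU]] := form_nondeg chi (k \o mk_linear lf').
  exists (f' p); split=> [y|q qE]; first by rewrite f'K pE /= fK.
  by rewrite (pU (f q)) ?fK // => y; rewrite -{1}(f'K y) qE.
by exists (AltForm alt nd).
Qed.

End Orbits.

Section RowOrbits.
Variable R : comPzRingType.
Variables (P0 : lmodType R) (hP0 : fg_projective P0) (hr : constant_rank P0 2).
Variable c : alt_form P0.
Hypothesis jacobi : forall p q r, c p q *: r + c q r *: p + c r p *: q = 0.
Hypothesis multiple : forall f : P0 -> P0 -> R^o, alternating_map f ->
  exists r : R, forall p q, f p q = r * c p q.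

Local Notation E3 := (E (P3_dec P0)).
Local Notation E4 := (E (P4_dec P0)).

Definition emb (x : P3 P0) : P4 P0 := (x.1, (x.2, 0)).

Definition row (chi : P4 P0 -> P4 P0 -> R) (x : P3 P0) : R := chi (emb x) (e4 P0).

Definition E3_orbit (a a' : P3 P0 -> R) : Prop :=
  exists f, E3 f /\ forall x, a' x = a (f x).

Lemma E3_orbit_refl a a' : a' =1 a -> E3_orbit a a'.
Proof. by move=> e; exists id; split=> //; exact: gen_id. Qed.

Lemma E3_orbit_trans a b d : E3_orbit a b -> E3_orbit b d -> E3_orbit a d.
Proof.
move=> [f [Ef fE]] [g [Eg gE]]; exists (f \o g).
by split=> [|x]; [exact: gen_comp|rewrite gE fE].
Qed.

Lemma E_bij (P : lmodType R) (d : decomposition P) f : E d f ->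
  exists f', [/\ E d f', cancel f f' & cancel f' f].
Proof.
elim=> {f} [f [i [j [s [ij ->]]]]||f g _ [f' [Ef fK f'K]] _ [g' [Eg gK g'K]]|f g Ef _ fK gK].
- have out0 p : s_out (d j) (s_in (d i) p) = 0 by apply: d_out0.
  have lN : linear (fun y => - s y) by move=> t x y; rewrite linearP opprD scalerN.
  exists (fun p => p + s_in (d i) (mk_linear lN (s_out (d j) p))); split.
  + by apply: (@E_gen _ _ d i j (mk_linear lN)).
  + by move=> p; rewrite linearD out0 addr0 /= linearN addrK.
  + by move=> p; rewrite linearD out0 addr0 /= linearN subrK.
- by exists id; split=> //; exact: gen_id.
- exists (g' \o f'); split; first exact: gen_comp.
  + by move=> x /=; rewrite fK gK.
  + by move=> x /=; rewrite g'K f'K.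
- by exists f.
Qed.

Lemma E3_orbit_sym a b : E3_orbit a b -> E3_orbit b a.
Proof.
move=> [f [Ef fE]]; have [f' [Ef' fK f'K]] := E_bij Ef; exists f'.
by split=> // x; rewrite fE f'K.
Qed.

(** The forms of Pfaffian 1. *)
Definition unit_form (chi : P4 P0 -> P4 P0 -> R) : Prop :=
  exists a b, pair3 c a b = 1 /\ forall x y, chi x y = form4 c a b x y.

Lemma row_form4 a b x : row (form4 c a b) x = pair3 c a x.
Proof.
rewrite /row /form4 /vol3 /pair3 /to3 /= !form0r; ring.
Qed.

(** The class in [V_SL] is invariant, and it determines the Pfaffian. *)
Lemma unit_form_SL (chi chi' : alt_form (P4 P0)) f : SL f -> unit_form chi ->
  (forall x y, chi' x y = chi (f x) (f y)) -> unit_form chi'.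
Proof.
move=> Sf [a [b [ab chiE]]] e.
have /(in_tilde_form4 hP0 hr jacobi chiE)[m [M [hM [pM cM]]]] := ab.
have [a' [b' chi'E]] := form4_complete multiple chi'.
exists a', b'; split=> //; apply/(in_tilde_form4 hP0 hr jacobi chi'E).
exists m, M, hM; split=> //; rewrite -cM; apply/V_class_eq.
by apply: V_sym; apply: V_SLinv Sf _ => x y; rewrite e.
Qed.

(** The functional on [P_3] moves within its orbit under [E(P_3)] when the form
    moves under [E(P_4)].  The one nontrivial case is [e_4 |-> e_4 + y], which
    adds [vol3 b _ y] to the functional [a]; as [a(b) = 1] and [b] spans the
    radical of [vol3 b], this is composition with a Koszul transvection. *)
Lemma E4_row_orbit e : E4 e -> forall chi chi' : alt_form (P4 P0),
  unit_form chi -> (forall x y, chi' x y = chi (e x) (e y)) ->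
  E3_orbit (row chi) (row chi').
Proof.
elim=> {e} [e [i [k [s [ik eX]]]]||f g Ef If Eg Ig|f g Ef If fK gK] chi chi' uc eE.
- have {}eX p : e p = p + s_in (P4_summand P0 i) (s (s_out (P4_summand P0 k) p)).
    by rewrite eX.
  have [a [b [ab chiE]]] := uc.
  have rE x : row chi x = pair3 c a x by rewrite /row chiE -[LHS]/(row (form4 c a b) x) row_form4.
  have rE' x : row chi' x = chi (e (emb x)) (e (e4 P0)) by rewrite /row eE.
  have koszul y : (forall x, e (emb x) = emb x) -> e (e4 P0) = e4 P0 + emb y ->
      E3_orbit (row chi) (row chi').
    move=> e1 e2; exists (transv b (mk_linear (vol3_linear c b y))).
    split=> [|x]; first exact: E3_koszul.
    rewrite rE' rE e1 e2 formDr [chi _ (e4 P0)]rE chiE.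
    rewrite -[form4 c a b _ _]/(vol3 c b x y + (pair3 c a x * 0 - pair3 c a y * 0)).
    rewrite !mulr0 subr0 addr0 /transv mk_linearE.
    rewrite [in RHS]/pair3 /= formDr formZr.
    transitivity (pair3 c a x + vol3 c b x y * pair3 c a b); first by rewrite ab mulr1.
    by rewrite /pair3 /GRing.scale /=; ring.
  have same (f : P3 P0 -> P3 P0) : E3 f -> (forall x, e (emb x) = emb (f x)) ->
      e (e4 P0) = e4 P0 -> E3_orbit (row chi) (row chi').
    by move=> Ef e1 e2; exists f; split=> // x; rewrite rE' e1 e2.
  have low (t : P3 P0 -> R) : (forall x, e (emb x) = emb x + t x *: e4 P0) ->
      e (e4 P0) = e4 P0 -> E3_orbit (row chi) (row chi').
    move=> e1 e2; apply: E3_orbit_refl => x.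
    by rewrite rE' e1 e2 formDl formZl formxx mulr0 addr0.
  case: i k s ik eX => [[]|] [[]|] //= s _ eX.
  + apply: (low (fun x => s x.2)) => [x|]; apply: eq_P4;
      by rewrite eX /= ?linear0 ?scaler0 ?addr0 ?add0r // /GRing.scale /= mulr1.
  + apply: (low (fun x => s x.1)) => [x|]; apply: eq_P4;
      by rewrite eX /= ?linear0 ?scaler0 ?addr0 ?add0r // /GRing.scale /= mulr1.
  + apply: (koszul (0, s 1)) => [x|]; apply: eq_P4;
      by rewrite eX /= ?linear0 ?scaler0 ?addr0 ?add0r.
  + apply: (same (fun x => (x.1, x.2 + s x.1))) => [|x|].
    * apply: (@E_gen _ _ (P3_dec P0) true false s); first by [].
      by case=> x y /=; congr pair; rewrite /= addr0.
    * by apply: eq_P4; rewrite eX /= ?addr0.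
    * by apply: eq_P4; rewrite eX /= ?linear0 ?addr0.
  + apply: (koszul (s 1, 0)) => [x|]; apply: eq_P4;
      by rewrite eX /= ?linear0 ?scaler0 ?addr0 ?add0r.
  + apply: (same (fun x => (x.1 + s x.2, x.2))) => [|x|].
    * apply: (@E_gen _ _ (P3_dec P0) false true s); first by [].
      by case=> x y /=; congr pair; rewrite /= addr0.
    * by apply: eq_P4; rewrite eX /= ?addr0.
    * by apply: eq_P4; rewrite eX /= ?linear0 ?addr0.
- by apply: E3_orbit_refl => x; rewrite /row eE.
- have [chi1 chi1E] := form_pullback chi (E4_SL hP0 Ef).
  have uc1 : unit_form chi1 := unit_form_SL (E4_SL hP0 Ef) uc chi1E.
  apply: E3_orbit_trans (If chi chi1 uc chi1E) (Ig chi1 chi' uc1 _) => x y.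
  by rewrite eE chi1E.
- apply: E3_orbit_sym; apply: If => [|x y]; last by rewrite eE !fK.
  apply: unit_form_SL uc eE; apply: E4_SL => //.
  exact: gen_inv Ef fK gK.
Qed.

Lemma E3_lift f : E3 f ->
  E4 (fun x => ((f (to3 x)).1, ((f (to3 x)).2, x.2.2))).
Proof.
elim=> {f} [f [i [k [s [ik ->]]]]||f g _ If _ Ig|f g _ If fK gK].
- case: i k s ik => [] [] //= s _.
  + apply: (@E_gen _ _ (P4_dec P0) (Some false) None s); first by [].
    by move=> p; apply: eq_P4; rewrite /= ?addr0.
  + apply: (@E_gen _ _ (P4_dec P0) None (Some false) s); first by [].
    by move=> p; apply: eq_P4; rewrite /= ?addr0.
- have -> : (fun x : P4 P0 => ((id (to3 x)).1, ((id (to3 x)).2, x.2.2))) = id.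
    by apply/funext => -[p [r t]].
  exact: gen_id.
- have := gen_comp If Ig; congr generated; apply/funext => x /=.
  by rewrite /to3 /=; case: (g _).
- apply: (gen_inv If) => x; apply: eq_P4; rewrite /= /to3 /=.
  + by rewrite -surjective_pairing fK.
  + by rewrite -surjective_pairing fK.
  + by [].
  + by rewrite -surjective_pairing gK.
  + by rewrite -surjective_pairing gK.
  + by [].
Qed.

(** Two forms with the same functional [a] differ by a transvection
    [x |-> x + l(x) e_4], by exactness of the Koszul complex of [a]. *)
Lemma same_row_orbit (chi chi' : alt_form (P4 P0)) : unit_form chi -> unit_form chi' ->
  row chi =1 row chi' -> exists e, E4 e /\ forall x y, chi' x y = chi (e x) (e y).
Proof.
move=> [a [b [ab chiE]]] [a' [b' [ab' chi'E]]] rr.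
have aa' x : pair3 c a' x = pair3 c a x.
  by have := rr x; rewrite /row chiE chi'E -[form4 c a b _ _]/(row (form4 c a b) x)
    -[form4 c a' b' _ _]/(row (form4 c a' b') x) !row_form4.
have ll : linear (fun x : P4 P0 => - vol3 c b b' (to3 x) : R^o).
  move=> t x y; have /= h := vol3_linearr c b b' t (to3 x) (to3 y).
  by rewrite [to3 _](_ : _ = t *: to3 x + to3 y) // h opprD scalerN.
pose l := mk_linear ll.
exists (transv (e4 P0) l); split.
  have [_ _ h] := P4_coord4 P0; apply: h.
  by rewrite /= /vol3 /to3 /= !form0r; ring.
move=> x y; rewrite chi'E chiE /form4 !aa'.
have t3 z : to3 (transv (e4 P0) l z) = to3 z.
  by congr pair; rewrite /transv /= ?scaler0 ?addr0 // /GRing.scale /= mulr0 addr0.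
have t4 z : (transv (e4 P0) l z).2.2 = z.2.2 - vol3 c b b' (to3 z).
  by rewrite /transv /= /GRing.scale /= mulr1.
rewrite !t3 !t4; move: (to3 x) (to3 y) (x.2.2) (y.2.2) => {x y}x y r s.
have ab1 : pair3 c a b' = 1 by rewrite -aa'.
suff e : pair3 c a b * vol3 c b' x y - pair3 c a b' * vol3 c b x y
    + pair3 c a x * vol3 c b b' y - pair3 c a y * vol3 c b b' x = 0.
  move: e; rewrite ab ab1 !mul1r => e.
  have -> : vol3 c b' x y = vol3 c b x y - pair3 c a x * vol3 c b b' y
      + pair3 c a y * vol3 c b b' x.
    by apply/eqP; rewrite -subr_eq0; apply/eqP; rewrite -[RHS]e; ring.
  by ring.
have J1 := jacobi_form jacobi a.1 b.1 x.1 y.1.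
have J2 := jacobi_form jacobi a.1 b'.1 x.1 y.1.
have J3 := jacobi_form jacobi a.1 b.1 b'.1 y.1.
have J4 := jacobi_form jacobi a.1 b.1 b'.1 x.1.
transitivity (b'.2 * (c b.1 x.1 * c a.1 y.1 + c x.1 y.1 * c a.1 b.1 + c y.1 b.1 * c a.1 x.1)
  - b.2 * (c b'.1 x.1 * c a.1 y.1 + c x.1 y.1 * c a.1 b'.1 + c y.1 b'.1 * c a.1 x.1)
  - x.2 * (c b.1 b'.1 * c a.1 y.1 + c b'.1 y.1 * c a.1 b.1 + c y.1 b.1 * c a.1 b'.1)
  + y.2 * (c b.1 b'.1 * c a.1 x.1 + c b'.1 x.1 * c a.1 b.1 + c x.1 b.1 * c a.1 b'.1)).
  rewrite /pair3 /vol3 (form_anti c y.1 b.1) (form_anti c y.1 b'.1) (form_anti c x.1 b.1).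
  ring.
by rewrite J1 J2 J3 J4 !mulr0 subr0 subrr addr0.
Qed.

(** An automorphism of [P_3], extended by the identity on [e_4], reduces to the
    case of equal functionals. *)
Lemma row_orbit_E4 (chi chi' : alt_form (P4 P0)) : unit_form chi -> unit_form chi' ->
  E3_orbit (row chi) (row chi') ->
  exists e, E4 e /\ forall x y, chi' x y = chi (e x) (e y).
Proof.
move=> uc uc' [f [Ef fE]]; have Eg := E3_lift Ef.
pose g (x : P4 P0) : P4 P0 := ((f (to3 x)).1, ((f (to3 x)).2, x.2.2)).
rewrite -/g in Eg.
have Sg := E4_SL hP0 Eg; have [chi1 chi1E] := form_pullback chi Sg.
have [|e [Ee eE]] := same_row_orbit (unit_form_SL Sg uc chi1E) uc'.
  move=> x; rewrite fE /row chi1E; congr (chi _ _).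
    by rewrite /g /emb /to3 /= -surjective_pairing.
  have [[lg _] _] := Sg.
  have [h1 h2] : (f 0).1 = 0 /\ (f 0).2 = 0.
    by have := linear0 (mk_linear lg); rewrite /= /g => -[].
  by apply: eq_P4; rewrite /g /to3 /= ?pair00 ?h1 ?h2.
exists (g \o e); split; first exact: gen_comp.
by move=> x y; rewrite eE chi1E.
Qed.

End RowOrbits.

(** * The bijection *)

Lemma sval_inj (T : Type) (P : T -> Prop) (x y : {z : T | P z}) :
  sval x = sval y -> x = y.
Proof. by case: x y => x Px [y Py] /= e; apply: eq_exist. Qed.

Lemma quot_bijection (S T : Type) (eS : S -> S -> Prop) (G : T -> quot eS) :
  injective G -> (forall s, exists t, G t = class_of eS s) ->
  exists F : quot eS -> T, bijective F.
Proof.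
move=> Ginj Gsurj.
have /choice[F FK] : forall D : quot eS, exists t, G t = D.
  case=> D hD; have [s sE] := hD; have [t tE] := Gsurj s; exists t.
  by rewrite tE; apply: eq_exist.
by exists F, G => // t; apply: Ginj; rewrite FK.
Qed.

Lemma equiv_class_of (T : Type) (e : T -> T -> Prop) x y :
  (forall u v, e u v -> e v u) -> (forall u v w, e u v -> e v w -> e u w) ->
  e x y -> class_of e x = class_of e y.
Proof.
move=> es et exy; apply: eq_class_of => z; split; apply: et => //; exact: es.
Qed.

Section Final.
Variable R : comPzRingType.
Hypothesis hdim : krull_dim_le R 4.
Variables (P0 : lmodType R) (hP0 : fg_projective P0) (hr : constant_rank P0 2).

Lemma stable_range_P4 : stable_range (P4 P0 * R^o)%type.
Proof.
apply: (@bass _ _ 5).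
  have ls0 : locally_split P0 2.
    move=> p pp; have [d [u [f [nd fu _]]]] := local_basis hP0 hr pp.
    by exists d, u, f.
  have ls1 := @locally_split_regular R.
  exact: locally_split_prod (locally_split_prod ls0 (locally_split_prod ls1 ls1)) ls1.
by move=> q qP; apply: hdim => i; have [] := qP i.
Qed.

Variable c : alt_form P0.
Hypothesis jacobi : forall p q r, c p q *: r + c q r *: p + c r p *: q = 0.
Hypothesis multiple : forall f : P0 -> P0 -> R^o, alternating_map f ->
  exists r : R, forall p q, f p q = r * c p q.

Local Notation E3 := (E (P3_dec P0)).
Local Notation E4 := (E (P4_dec P0)).
Local Notation cls4 chi := (V_class (fg_projective_P4 hP0) (alt_perp c (alt_hyp R)) chi).

Lemma unit_form_in_tilde (chi : alt_form (P4 P0)) :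
  in_tilde hP0 c chi <-> unit_form c chi.
Proof.
have [a [b chiE]] := form4_complete multiple chi.
split=> [/(in_tilde_form4 hP0 hr jacobi chiE) ab|]; first by exists a, b.
move=> [a' [b' [ab' chiE']]]; exact/(in_tilde_form4 hP0 hr jacobi chiE').
Qed.

(** Since [E(P_4)] is normal, the elementary factor can be moved to the other side
    of [f], where it acts on the form [chi] pulled back along [f]. *)
Lemma SpE_relP (chi : alt_form (P4 P0)) (f g : SL_group (P4 P0)) :
  SpE_rel (P4_dec P0) chi f g <->
  exists e, E4 e /\
    forall x y, chi (sval g x) (sval g y) = chi (sval f (e x)) (sval f (e y)).
Proof.
case: f g => f Sf [g Sg] /=.
have [[lf [f' fK f'K]] _] := Sf; have [[lg [g' gK g'K]] _] := Sg.
have lf' := inv_linear lf fK f'K; have tr := trace_unit hP0 hr.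
split=> [[s [e [[as_ sE] Ee gE]]]|[e [Ee eE]]].
  exists (f' \o e \o f); split; first exact: P4_normal.
  by move=> x y; rewrite /= in gE *; rewrite !gE sE !f'K.
have [e' [Ee' eK e'K]] := E_bij Ee.
have le' := SL_linear (E4_SL hP0 Ee').
exists (g \o e' \o f'), (f \o e \o f'); split.
- split; first split.
  + by move=> t x y /=; rewrite lf' le' lg.
  + exists (f \o e \o g') => x /=; first by rewrite gK e'K f'K.
    by rewrite fK eK g'K.
  + by move=> x y /=; rewrite eE !e'K !f'K.
- exact: P4_normal.
- by move=> x /=; rewrite !fK eK.
Qed.

Lemma SpE_rel_sym (chi : alt_form (P4 P0)) f g :
  SpE_rel (P4_dec P0) chi f g -> SpE_rel (P4_dec P0) chi g f.
Proof.
move=> /SpE_relP[e [Ee eE]]; apply/SpE_relP.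
have [e' [Ee' eK e'K]] := E_bij Ee.
by exists e'; split=> // x y; rewrite eE !e'K.
Qed.

Lemma SpE_rel_trans (chi : alt_form (P4 P0)) f g h :
  SpE_rel (P4_dec P0) chi f g -> SpE_rel (P4_dec P0) chi g h ->
  SpE_rel (P4_dec P0) chi f h.
Proof.
move=> /SpE_relP[e [Ee eE]] /SpE_relP[e1 [Ee1 eE1]]; apply/SpE_relP.
exists (e \o e1); split; first exact: gen_comp.
by move=> x y; rewrite eE1 eE.
Qed.

Lemma row_Um (chi : alt_form (P4 P0)) : unit_form c chi ->
  exists a : Um (P3 P0), forall x, sval a x = row chi x.
Proof.
move=> [a [b [ab chiE]]].
have rE x : row chi x = pair3 c a x by rewrite /row chiE -[LHS]/(row (form4 c a b) x) row_form4.
have hrow : linear (row chi : P3 P0 -> R^o) /\ forall y, exists p, row chi p = y.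
  split=> [t x y|y]; first by rewrite !rE /pair3 /= formDr formZr /GRing.scale /=; ring.
  exists ((y : R) *: b); rewrite rE.
  transitivity ((y : R) * pair3 c a b); last by rewrite ab mulr1.
  by rewrite /pair3 /= formZr /GRing.scale /=; ring.
by exists (exist (fun u : P3 P0 -> R^o => linear u /\ forall y, exists p, u p = y) _ hrow).
Qed.

(** A unimodular functional [a] is the functional of the form [form4 a b], for
    any [b] with [a(b) = 1]. *)
Lemma Um_row (u : Um (P3 P0)) : exists chi : alt_form (P4 P0),
  unit_form c chi /\ forall x, sval u x = row chi x.
Proof.
case: u => u [lu su] /=.
have lu0 : linear (fun p : P0 => u (p, 0)).
  by move=> t x y; rewrite -lu; congr (u (_, _)); rewrite /= scaler0 addr0.
have [al [alE _]] := form_nondeg c (mk_linear lu0).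
pose a : P3 P0 := (al, u (0, 1)).
have uE x : u x = pair3 c a x.
  rewrite /pair3 /= alE /= mulrC.
  have {1}-> : x = (x.2 : R) *: ((0, 1) : P3 P0) + ((x.1, 0) : P3 P0).
    case: x => p r; congr pair; rewrite /= ?scaler0 ?add0r //.
    by rewrite /GRing.scale /= mulr1 addr0.
  by rewrite lu addrC.
have [b ub] := su 1; have ab : pair3 c a b = 1 by rewrite -uE.
exists (alt_form4 jacobi ab); split; first by exists a, b.
by move=> x; rewrite uE -(row_form4 c a b).
Qed.

Variables (I : Type) (chi : I -> alt_form (P4 P0)) (cls : I -> tilde_V_SL R).
Hypothesis hcls : forall i, sval (cls i) = cls4 (chi i).
Hypothesis hbij : bijective cls.

Lemma chi_unit i : unit_form c (chi i).
Proof.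
apply/unit_form_in_tilde; have [m [M [hM [pM e]]]] := svalP (cls i).
by exists m, M, hM; split=> //; rewrite -hcls.
Qed.

Lemma coset_row (i : I) (g : SL_group (P4 P0)) : exists a : Um (P3 P0),
  forall x, sval a x = row (fun x y => chi i (sval g x) (sval g y)) x.
Proof.
have [chi1 chi1E] := form_pullback (chi i) (svalP g).
have [a aE] := row_Um (unit_form_SL hP0 hr jacobi multiple (svalP g) (chi_unit i) chi1E).
by exists a => x; rewrite aE /row chi1E.
Qed.

Lemma coset_row_orbit i i' (g g' : SL_group (P4 P0)) :
  E3_orbit (row (fun x y => chi i (sval g x) (sval g y)))
           (row (fun x y => chi i' (sval g' x) (sval g' y))) <->
  exists e, E4 e /\
    forall x y, chi i' (sval g' x) (sval g' y) = chi i (sval g (e x)) (sval g (e y)).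
Proof.
have [f fE] := form_pullback (chi i) (svalP g).
have [f' f'E] := form_pullback (chi i') (svalP g').
have uf := unit_form_SL hP0 hr jacobi multiple (svalP g) (chi_unit i) fE.
have uf' := unit_form_SL hP0 hr jacobi multiple (svalP g') (chi_unit i') f'E.
have ext (h : alt_form (P4 P0)) k : (forall x y, h x y = k x y) -> row h =1 row k.
  by move=> e x; rewrite /row e.
split=> [o|[e [Ee eE]]].
  have [|e [Ee eE]] := row_orbit_E4 hP0 hr jacobi multiple uf uf'.
    apply: E3_orbit_trans (E3_orbit_trans o _); apply: E3_orbit_refl => x.
      by rewrite (ext _ _ fE).
    by rewrite (ext _ _ f'E).
  by exists e; split=> // x y; rewrite -f'E eE fE.
have o : E3_orbit (row f) (row f').
  by apply: (E4_row_orbit hP0 hr jacobi multiple Ee uf) => x y; rewrite f'E fE eE.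
apply: E3_orbit_trans (E3_orbit_trans o _); apply: E3_orbit_refl => x.
  by rewrite (ext _ _ fE).
by rewrite (ext _ _ f'E).
Qed.

Lemma orbit_index i i' (g g' : SL_group (P4 P0)) e : E4 e ->
  (forall x y, chi i' (sval g' x) (sval g' y) = chi i (sval g (e x)) (sval g (e y))) ->
  i = i'.
Proof.
move=> Ee eE; apply: (bij_inj hbij); apply: sval_inj; rewrite !hcls.
have pull (h h' : alt_form (P4 P0)) f : SL f -> (forall x y, h' x y = h (f x) (f y)) ->
    cls4 h = cls4 h'.
  by move=> Sf hE; apply/V_class_eq; apply: V_SLinv Sf hE.
have [f fE] := form_pullback (chi i) (svalP g).
have [f' f'E] := form_pullback (chi i') (svalP g').
rewrite (pull _ _ _ (svalP g) fE) (pull _ _ _ (svalP g') f'E).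
by apply: pull (E4_SL hP0 Ee) _ => x y; rewrite f'E fE eE.
Qed.

(** The inverse map sends the coset of [g] in the part of index [i] to the orbit of
    the functional of [chi_i], pulled back along [g]. *)
Lemma orbits_bijection :
  exists F : quot (@Um_rel R (P3 P0) E3) ->
             {i : I & quot (SpE_rel (P4_dec P0) (chi i))},
    bijective F.
Proof.
have Us u v : Um_rel E3 u v -> Um_rel E3 v u by exact: E3_orbit_sym.
have Ut u v w : Um_rel E3 u v -> Um_rel E3 v w -> Um_rel E3 u w by exact: E3_orbit_trans.
have Ur u : Um_rel E3 u u by apply: E3_orbit_refl.
have Sr i g : SpE_rel (P4_dec P0) (chi i) g g.
  by apply/SpE_relP; exists id; split=> //; exact: gen_id.
(* a representative of each coset, and the functional of its form *)
have /choice[G0 G0E] : forall x : {i : I & quot (SpE_rel (P4_dec P0) (chi i))},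
    exists ga : SL_group (P4 P0) * Um (P3 P0),
      projT2 x = class_of (SpE_rel (P4_dec P0) (chi (projT1 x))) ga.1 /\
      forall z, sval ga.2 z =
        row (fun x' y => chi (projT1 x) (sval ga.1 x') (sval ga.1 y)) z.
  move=> [i [C [g gE]]]; have [a aE] := coset_row i g.
  by exists (g, a); split=> //=; apply: sval_inj.
have orbitE x i (g : SL_group (P4 P0)) : E3_orbit (sval (G0 x).2) (row (fun y z => chi i (sval g y) (sval g z))) <->
    exists e, E4 e /\ forall y z, chi i (sval g y) (sval g z) =
      chi (projT1 x) (sval (G0 x).1 (e y)) (sval (G0 x).1 (e z)).
  have [_ aE] := G0E x.
  have key := coset_row_orbit (projT1 x) i (G0 x).1 g.
  split=> [h|/key h]; first apply/key.
    by apply: E3_orbit_trans h; apply: E3_orbit_refl => z; rewrite aE.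
  by apply: E3_orbit_trans h; apply: E3_orbit_refl => z; rewrite aE.
apply: (@quot_bijection _ _ _ (fun x => class_of (Um_rel E3) (G0 x).2)).
- move=> x x' /(class_of_eq (Ur _)) o.
  have [e [Ee eE]] : exists e, E4 e /\ forall y z,
      chi (projT1 x') (sval (G0 x').1 y) (sval (G0 x').1 z) =
      chi (projT1 x) (sval (G0 x).1 (e y)) (sval (G0 x).1 (e z)).
    apply/orbitE; apply: E3_orbit_trans o _; apply: E3_orbit_refl => z.
    by have [_ ->] := G0E x'.
  have [gE _] := G0E x; have [gE' _] := G0E x'.
  have ii' := orbit_index Ee eE.
  move: (G0 x).1 (G0 x').1 gE gE' e Ee eE {o} => g g'.
  case: x x' ii' => i C [i' C'] /= ii'; case: i' / ii' C' => C' -> -> e Ee eE.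
  congr existT; apply: equiv_class_of; [exact: SpE_rel_sym|exact: SpE_rel_trans|].
  by apply/SpE_relP; exists e.
- move=> u; have [f [uf fE]] := Um_row u.
  have /unit_form_in_tilde[m [M [hM [pM fM]]]] := uf.
  have tf : exists (m : nat) (M : 'M[R]_m.*2) (hM : alt_inv_mx M), pfaffian M = 1 /\
      cls4 f = V_class (fg_projective_rV R m.*2) (alt_mx (psi_alt R m)) (alt_mx hM).
    by exists m, M, hM.
  have [cls' _ clsK] := hbij.
  pose i := cls' (exist _ (cls4 f) tf).
  have clsf : cls4 f = cls4 (chi i) by rewrite -hcls clsK.
  have [g [Sg gE]] := V_class_cancel stable_range_P4 clsf.
  pose g1 : SL_group (P4 P0) := exist _ g Sg.
  exists (existT _ i (class_of (SpE_rel (P4_dec P0) (chi i)) g1)).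
  set x := existT _ _ _.
  apply: equiv_class_of => //.
  have [/(class_of_eq (Sr _ _)) h _] := G0E x.
  apply: E3_orbit_trans (_ : E3_orbit (row (fun y z => chi i (sval g1 y) (sval g1 z))) _).
    apply/orbitE; exact/SpE_relP/SpE_rel_sym.
  by apply: E3_orbit_refl => z; rewrite fE /row /= gE.
Qed.

End Final.

Theorem theorem3p11 (R : comPzRingType)
    (hNoeth : noetherian R) (hdim : krull_dim_le R 4)
    (P0 : lmodType R) (hP0 : fg_projective P0) (hrank : constant_rank P0 2)
    (detP0 : exterior_square P0) (theta0 : lin_iso R^o detP0)
    (htrans : forall a b : Um (P5 P0), Um_rel (@SL R (P5 P0)) a b)
    (I : Type) (chi : I -> alt_form (P4 P0))
    (cls : I -> tilde_V_SL R)
    (hcls : forall i, sval (cls i) =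
       V_class (fg_projective_P4 hP0)
         (alt_perp (chi0 hrank theta0) (alt_hyp R)) (chi i))
    (hbij : bijective cls) :
  exists F : quot (@Um_rel R (P3 P0) (E (P3_dec P0))) ->
             {i : I & quot (SpE_rel (P4_dec P0) (chi i))},
    bijective F.
Proof.
exact: (@orbits_bijection R hdim P0 hP0 hrank (chi0 hrank theta0)
  (chi0_jacobi hrank theta0) (@chi0_multiple _ _ hrank _ theta0) I chi cls hcls hbij).
Qed.
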